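(* Let $n>d\ge 2$ be integers. Let $X\subseteq\mathbb{R}^n$ be closed, and let $(X,\mu)$ be an Ahlfors $d$-regular space with constant $A\ge 1$ supporting a weak $(1,d)$-Poincaré inequality with constants $C,\lambda\ge 1$. Then $X$ is uniformly $d$-rectifiable: there are constants $L,c>0$, depending only on $n,C,\lambda$ and $A$, such that for every $x\in X$ and every $0<r<\operatorname{diam}X$ there are a set $E\subseteq\mathbb{R}^d$ and an $L$-bi-Lipschitz map $f:E\to\mathbb{R}^n$ with $f(E)\subseteq X\cap B(x,r)$ and $\mathcal{H}^d(f(E))\ge c\,r^d$.
   Context: $X\subseteq\mathbb{R}^n$ carries the Euclidean metric; $B(x,r)$ denotes the closed ball, and $\mathcal{H}^d$ is $d$-dimensional Hausdorff measure. Ahlfors $d$-regular with constant $A$: $X=\operatorname{supp}\mu$, where $\mu$ is a Borel measure with $A^{-1}r^d\le\mu(B(x,r))\le Ar^d$ for all $x\in X$ and $0<r<\operatorname{diam}X$. Weak $(1,p)$-Poincaré inequality with constants $C,\lambda\ge1$: for every ball $B$ in $X$, every measurable function $u:X\to\mathbb{R}$ (integrable on balls) and every upper gradient $\rho$ of $u$, $$\frac1{\mu(B)}\int_B|u-u_B|\,d\mu\le C\operatorname{diam}(B)\left(\frac1{\mu(\lambda B)}\int_{\lambda B}\rho^p\,d\mu\right)^{1/p},\qquad u_B=\frac1{\mu(B)}\int_B u\,d\mu,$$ where $\lambda B$ is the ball with the same center and $\lambda$ times the radius. A Borel function $\rho:X\to[0,\infty]$ is an upper gradient of $u$ if for all $x,y\in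 X$, $|u(x)-u(y)|\le\int_\gamma\rho$ for every rectifiable curve $\gamma$ in $X$ connecting $x$ to $y$ (the integral being taken with respect to the arclength parametrization). A map $f:E\to\mathbb{R}^n$ is $L$-bi-Lipschitz if $L^{-1}|a-b|\le|f(a)-f(b)|\le L|a-b|$ for all $a,b\in E$. *)

(* Defs.v *)
From HB Require Import structures.
From mathcomp Require Import all_boot all_order all_algebra.
From mathcomp Require Import all_classical all_reals all_analysis.
From mathcomp Require Import measurable_realfun.

Set Implicit Arguments.
Unset Strict Implicit.
Unset Printing Implicit Defensive.

Import Order.TTheory GRing.Theory Num.Theory.
Import numFieldNormedType.Exports.

Local Open Scope classical_set_scope.
Local Open Scope ring_scope.

(** The library norm on ['rV[R]_n] is the sup norm, so the Euclidean metric is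
    defined here.  Both norms induce the same topology: [open], [closed] and
    [continuous] below are the library's. *)
Definition eucl_dist (R : realType) (n : nat) (x y : 'rV[R]_n) : R :=
  Num.sqrt (\sum_(i < n) (x ord0 i - y ord0 i) ^+ 2).

Definition cball (R : realType) (n : nat) (x : 'rV[R]_n) (r : R) :
    set 'rV[R]_n :=
  [set y | eucl_dist x y <= r].

(** Closed ball of the metric space [X]. *)
Definition ball_in (R : realType) (n : nat) (X : set 'rV[R]_n)
    (x : 'rV[R]_n) (r : R) : set 'rV[R]_n :=
  X `&` cball x r.

(** The diameter of the empty set is 0, not [-oo]. *)
Definition diam (R : realType) (n : nat) (S : set 'rV[R]_n) : \bar R :=
  maxe 0%E (ereal_sup [set (eucl_dist p.1 p.2)%:E | p in S `*` S]).

(** Hausdorff measure without normalising factor, meant for [0 < d]: when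
    [d = 0] the empty sets of a cover would contribute [0 ^+ 0 = 1]. *)
Definition hausdorff_pre (R : realType) (n d : nat) (delta : R)
    (S : set 'rV[R]_n) : \bar R :=
  ereal_inf [set (\sum_(0 <= k <oo) diam (E k) ^+ d)%E
            | E in [set E : (set 'rV[R]_n)^nat |
                S `<=` \bigcup_k E k
                /\ forall k, (diam (E k) <= delta%:E)%E]].

Definition hausdorff (R : realType) (n d : nat) (S : set 'rV[R]_n) : \bar R :=
  ereal_sup [set hausdorff_pre d delta S | delta in [set delta : R | 0 < delta]].

(** ['rV[R]_n] with its Borel sigma-algebra. *)
Notation borelRV R n := (g_sigma_algebraType (@open 'rV[R]_n)).

Definition msupport (R : realType) (n : nat)
    (mu : {measure set (borelRV R n) -> \bar R}) : set 'rV[R]_n :=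
  [set x | forall U : set 'rV[R]_n, open U -> U x -> (0 < mu U)%E].

(** A Borel measure on the closed set [X] is represented by its extension by
    zero to the ambient space. *)
Definition ahlfors_regular (R : realType) (n d : nat) (A : R)
    (X : set 'rV[R]_n) (mu : {measure set (borelRV R n) -> \bar R}) : Prop :=
  X = msupport mu /\
  forall (x : 'rV[R]_n) (r : R), X x -> 0 < r -> (r%:E < diam X)%E ->
    ((A^-1 * r ^+ d)%:E <= mu (cball x r) <= (A * r ^+ d)%:E)%E.

(** [curve_length g a b] is the length of [g] restricted to [[a, b]]. *)
Definition curve_length (R : realType) (n : nat) (g : R -> 'rV[R]_n)
    (a b : R) : \bar R :=
  ereal_sup [set (\sum_(0 <= k < size s)
                    eucl_dist (g (nth b (a :: s) k.+1)) (g (nth b (a :: s) k)))%:E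
            | s in [set s : seq R | itv_partition a b s]].

Definition rectifiable_curve (R : realType) (n : nat) (X : set 'rV[R]_n)
    (x y : 'rV[R]_n) (g : R -> 'rV[R]_n) (a b : R) : Prop :=
  [/\ a <= b, {within `[a, b], continuous g},
      (forall t, t \in `[a, b] -> X (g t)),
      g a = x /\ g b = y & (curve_length g a b < +oo)%E].

(** The value at arclength [s] is [g t] for any [t] such that [g] has length
    [s] on [[a, t]]; two such [t] give the same point, because [g] is constant
    between them. *)
Definition arclength_param (R : realType) (n : nat) (g : R -> 'rV[R]_n)
    (a b : R) (s : R) : 'rV[R]_n :=
  g (get [set t : R | t \in `[a, b] /\ curve_length g a t = s%:E]).

Definition curve_integral (R : realType) (n : nat) (rho : 'rV[R]_n -> \bar R)
    (g : R -> 'rV[R]_n) (a b : R) : \bar R :=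
  (\int[@lebesgue_measure R]_(s in `[0%R, fine (curve_length g a b)])
     rho (arclength_param g a b s))%E.

(** Functions on [X] are functions on the ambient space of which only the
    values on [X] are used. *)
Definition upper_gradient (R : realType) (n : nat) (X : set 'rV[R]_n)
    (u : 'rV[R]_n -> R) (rho : 'rV[R]_n -> \bar R) : Prop :=
  [/\ measurable_fun (X : set (borelRV R n)) (rho : borelRV R n -> \bar R),
      (forall x, X x -> (0 <= rho x)%E)
    & forall (x y : 'rV[R]_n) (g : R -> 'rV[R]_n) (a b : R), X x -> X y ->
        rectifiable_curve X x y g a b ->
        (`|u x - u y|%:E <= curve_integral rho g a b)%E].

Definition average (R : realType) (n : nat)
    (mu : {measure set (borelRV R n) -> \bar R}) (B : set 'rV[R]_n)
    (f : 'rV[R]_n -> \bar R) : \bar R :=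
  ((\int[mu]_(y in B) f y) / mu B)%E.

Definition weak_poincare (R : realType) (n : nat) (p C lambda : R)
    (X : set 'rV[R]_n) (mu : {measure set (borelRV R n) -> \bar R}) : Prop :=
  forall (u : 'rV[R]_n -> R) (rho : 'rV[R]_n -> \bar R),
    measurable_fun (X : set (borelRV R n)) (u : borelRV R n -> R) ->
    (forall (z : 'rV[R]_n) (s : R), X z -> 0 < s ->
       mu.-integrable (ball_in X z s) (EFin \o u)) ->
    upper_gradient X u rho ->
    forall (x : 'rV[R]_n) (r : R), X x -> 0 < r ->
      let B := ball_in X x r in
      let lambdaB := ball_in X x (lambda * r) in
      let u_B := fine (average mu B (EFin \o u)) in
      (average mu B (fun y => `|u y - u_B|%:E)
       <= C%:E * diam B
          * average mu lambdaB (fun y => rho y `^ p) `^ p^-1)%E.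

Definition bilipschitz (R : realType) (d n : nat) (L : R) (E : set 'rV[R]_d)
    (f : 'rV[R]_d -> 'rV[R]_n) : Prop :=
  forall a b, E a -> E b ->
    L^-1 * eucl_dist a b <= eucl_dist (f a) (f b) <= L * eucl_dist a b.

Definition uniformly_rectifiable (R : realType) (n d : nat) (L c : R)
    (X : set 'rV[R]_n) : Prop :=
  forall (x : 'rV[R]_n) (r : R), X x -> 0 < r -> (r%:E < diam X)%E ->
    exists (E : set 'rV[R]_d) (f : 'rV[R]_d -> 'rV[R]_n),
      [/\ bilipschitz L E f, f @` E `<=` X `&` cball x r
        & ((c * r ^+ d)%:E <= hausdorff d (f @` E))%E].

(* Main.v *)
(* For a dyadic cube [Q] and a vector [e], consider 1-Lipschitz functions that agree with the linear
   function [<e, .>] off [Q], and let [D(Q, e)] be the least [d]-energy over [X] in [Q] of their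
   asymptotic Lipschitz constants.  The densities [D(Q, e) / mu(Q)] form a bounded submartingale along
   the cubes, so, apart from cubes of bounded total multiplicity, they are almost constant over the
   next few generations and do not jump.  In such a cube there is a dichotomy.  If the density is small,
   the Poincare inequality forces [X] into a thin strip around a level set of [<e, .>].  If it is bounded
   below, [X] cannot lie on one side of a level set of [<e, .>] near any of its points, because
   truncating the minimiser there would save too much energy.  Since [X] is [d]-regular with [d < n], it
   has holes, and hence touching hyperplanes, inside any family of fewer than [n - d] strips; so one finds
   [n - d] orthonormal directions of small density, that is, [X] is close to a [d]-plane, and this plane
   is kept from one generation to the next until a bad cube occurs.  Most points meet boundedly many bad
   cubes, and induction on this number, stopping at the first bad cube, glues the orthogonal projections
   to these planes and the charts of the stopped pieces into a bi-Lipschitz chart. *)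

Require Import Defs.
From mathcomp Require Import all_boot all_order all_algebra.
From mathcomp Require Import all_classical all_reals all_analysis.
From mathcomp Require Import measurable_realfun.
From mathcomp Require Import ring lra.
Import Order.TTheory GRing.Theory Num.Theory.
Import numFieldNormedType.Exports.
Set Implicit Arguments.
Unset Strict Implicit.
Unset Printing Implicit Defensive.
Local Open Scope classical_set_scope.
Local Open Scope ring_scope.

(** * Euclidean norm and curves *)

(** An almost minimal competitor on a cube is only known to lie within two side lengths of [<e, .>],
    which says nothing about [X] inside that cube. So near-minimisers on the cells [N] generations
    further down are glued. The result is within two cell sides of [<e, .>], and almost constant
    density makes its energy almost minimal; the Poincare inequality and the truncation are applied
    to this function. The vectors [e] have norm at most [1 / 3], so that a [1]-Lipschitz barrier has
    slope left to outgrow [<e, .>]. A cube may meet [X] only near its boundary; its mass may then be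
    tiny, and its density says nothing about [X] nearby. Hence several shifted grids are used: any
    two points, at any two generations from the second on, are deep inside their cubes in a common
    grid. The price is that null directions come from different grids; the resulting frames are
    compared through the fact that [X] is not close to a [(d - 1)]-plane. Jumps are measured against
    a reference density that is reset only at heavy cubes. Only finitely many [e], forming a net,
    are tested, and all constants are fixed before the space. *)

Section Euclid.
Context {R : realType} {n : nat}.
Implicit Types (u v w x y z : 'rV[R]_n) (a b c : R).

Definition dotp u v : R := \sum_(i < n) u ord0 i * v ord0 i.
Definition enorm u : R := Num.sqrt (dotp u u).

Lemma dotpC u v : dotp u v = dotp v u.
Proof. by apply: eq_bigr => i _; rewrite mulrC. Qed.

Lemma dotpDl u v w : dotp (u + v) w = dotp u w + dotp v w.
Proof. by rewrite /dotp -big_split; apply: eq_bigr => i _; rewrite mxE mulrDl. Qed.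

Lemma dotpZl a u w : dotp (a *: u) w = a * dotp u w.
Proof. by rewrite /dotp mulr_sumr; apply: eq_bigr => i _; rewrite mxE mulrA. Qed.

Lemma dotpNl u w : dotp (- u) w = - dotp u w.
Proof. by rewrite -scaleN1r dotpZl mulN1r. Qed.

Lemma dotpBl u v w : dotp (u - v) w = dotp u w - dotp v w.
Proof. by rewrite dotpDl dotpNl. Qed.

Lemma dotpDr u v w : dotp w (u + v) = dotp w u + dotp w v.
Proof. by rewrite dotpC dotpDl !(dotpC _ w). Qed.

Lemma dotpZr a u w : dotp w (a *: u) = a * dotp w u.
Proof. by rewrite dotpC dotpZl dotpC. Qed.

Lemma dotpNr u w : dotp w (- u) = - dotp w u.
Proof. by rewrite dotpC dotpNl dotpC. Qed.

Lemma dotpBr u v w : dotp w (u - v) = dotp w u - dotp w v.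
Proof. by rewrite dotpDr dotpNr. Qed.

Lemma dotp0r u : dotp u 0 = 0.
Proof. by rewrite -(scale0r 0) dotpZr mul0r. Qed.

Lemma dotp0l u : dotp 0 u = 0. Proof. by rewrite dotpC dotp0r. Qed.

Lemma dotpp_ge0 u : 0 <= dotp u u.
Proof. by apply: sumr_ge0 => i _; rewrite -expr2 sqr_ge0. Qed.

Lemma enorm_ge0 u : 0 <= enorm u. Proof. exact: sqrtr_ge0. Qed.

Lemma enorm_sqr u : enorm u ^+ 2 = dotp u u.
Proof. by rewrite sqr_sqrtr// dotpp_ge0. Qed.

Lemma enorm0 : enorm 0 = 0. Proof. by rewrite /enorm dotp0r sqrtr0. Qed.

Lemma dotpp_eq0 u : (dotp u u == 0) = (u == 0).
Proof.
apply/eqP/eqP => [u0|->]; last exact: dotp0r.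
apply/rowP => i; rewrite mxE.
have /eqP := u0; rewrite /dotp psumr_eq0; last by move=> j _; rewrite -expr2 sqr_ge0.
by move=> /allP /(_ i); rewrite mem_index_enum => /(_ isT)/=; rewrite mulf_eq0 orbb => /eqP.
Qed.

Lemma enorm_eq0 u : (enorm u == 0) = (u == 0).
Proof. by rewrite -dotpp_eq0 -enorm_sqr sqrf_eq0. Qed.

Lemma enormZ a u : enorm (a *: u) = `|a| * enorm u.
Proof.
by rewrite /enorm dotpZl dotpZr mulrA -expr2 sqrtrM ?sqr_ge0// sqrtr_sqr.
Qed.

Lemma enormN u : enorm (- u) = enorm u.
Proof. by rewrite -scaleN1r enormZ normrN1 mul1r. Qed.

Lemma dotp_le u v : dotp u v <= enorm u * enorm v.
Proof.
have [->|u0] := eqVneq u 0; first by rewrite dotp0l enorm0 mul0r.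
have [->|v0] := eqVneq v 0; first by rewrite dotp0r enorm0 mulr0.
have pu : 0 < enorm u by rewrite lt_def enorm_eq0 u0 enorm_ge0.
have pv : 0 < enorm v by rewrite lt_def enorm_eq0 v0 enorm_ge0.
have := dotpp_ge0 (enorm v *: u - enorm u *: v).
rewrite dotpBl !dotpBr !dotpZl !dotpZr -!enorm_sqr (dotpC v u).
have -> : enorm v * (enorm v * enorm u ^+ 2) - enorm v * (enorm u * dotp u v) -
   (enorm u * (enorm v * dotp u v) - enorm u * (enorm u * enorm v ^+ 2)) =
   (2 * (enorm u * enorm v)) * (enorm u * enorm v - dotp u v) by ring.
by rewrite pmulr_rge0 ?subr_ge0// !mulr_gt0.
Qed.

Lemma dotp_abs u v : `|dotp u v| <= enorm u * enorm v.
Proof. by rewrite ler_norml dotp_le andbT lerNl -dotpNl -(enormN u) dotp_le. Qed.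

Lemma enormD u v : enorm (u + v) <= enorm u + enorm v.
Proof.
rewrite -(ler_pXn2r (ltn0Sn 1)) ?nnegrE ?enorm_ge0 ?addr_ge0 ?enorm_ge0//.
rewrite enorm_sqr dotpDl !dotpDr -!enorm_sqr (dotpC v u).
by have := dotp_le u v; lra.
Qed.

Lemma enormB u v : enorm (u - v) = enorm (v - u).
Proof. by rewrite -opprB enormN. Qed.

Lemma eucl_distE x y : eucl_dist x y = enorm (x - y).
Proof. by congr Num.sqrt; apply: eq_bigr => i _; rewrite !mxE expr2. Qed.

Lemma eucl_dist_ge0 x y : 0 <= eucl_dist x y.
Proof. by rewrite eucl_distE enorm_ge0. Qed.

Lemma eucl_distC x y : eucl_dist x y = eucl_dist y x.
Proof. by rewrite !eucl_distE enormB. Qed.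

Lemma eucl_dist0 x : eucl_dist x x = 0.
Proof. by rewrite eucl_distE subrr enorm0. Qed.

Lemma eucl_dist_eq0 x y : eucl_dist x y = 0 -> x = y.
Proof. by rewrite eucl_distE => /eqP; rewrite enorm_eq0 subr_eq0 => /eqP. Qed.

Lemma eucl_dist_tri y x z : eucl_dist x z <= eucl_dist x y + eucl_dist y z.
Proof. by rewrite !eucl_distE -(subrKA y) enormD. Qed.

Lemma coord_le_enorm u (i : 'I_n) : `|u ord0 i| <= enorm u.
Proof.
rewrite -sqrtr_sqr ler_sqrt ?dotpp_ge0// /dotp (bigD1 i)//= expr2 lerDl.
by apply: sumr_ge0 => j _; rewrite -expr2 sqr_ge0.
Qed.

Lemma enorm_le_sum u : enorm u <= \sum_(i < n) `|u ord0 i|.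
Proof.
have s0 : 0 <= \sum_(i < n) `|u ord0 i| by apply: sumr_ge0.
rewrite -(ler_pXn2r (ltn0Sn 1)) ?nnegrE ?enorm_ge0// enorm_sqr.
rewrite expr2 mulr_suml; apply: ler_sum => i _.
apply: le_trans (ler_norm _) _; rewrite normrM ler_wpM2l//.
by rewrite (bigD1 i)//= lerDl; apply: sumr_ge0.
Qed.

Lemma enorm_le_sup u c : (forall i, `|u ord0 i| <= c) -> enorm u <= n%:R * c.
Proof.
move=> H; apply: le_trans (enorm_le_sum u) _.
apply: (@le_trans _ _ (\sum_(i < n) c)); first exact: ler_sum.
by rewrite sumr_const card_ord mulr_natl.
Qed.

End Euclid.

Section CurveLength.
Context {R : realType} {n : nat}.
Variable g : R -> 'rV[R]_n.
Implicit Types (a b c t : R) (s : seq R).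

(** The sum in [curve_length] in recursive form, so that partitions can be treated by induction on
    the list. *)
Fixpoint polygon a s : R :=
  if s is h :: s' then eucl_dist (g a) (g h) + polygon h s' else 0.

Lemma polygonE a b s :
  \sum_(0 <= k < size s)
     eucl_dist (g (nth b (a :: s) k.+1)) (g (nth b (a :: s) k)) = polygon a s.
Proof.
elim: s a => [|h s ih] a; first by rewrite big_nil.
rewrite [size _]/= big_nat_recl//= eucl_distC; congr (_ + _).
by rewrite -ih.
Qed.

Lemma curve_lengthE a b : curve_length g a b =
  ereal_sup [set (polygon a s)%:E | s in itv_partition a b].
Proof.
rewrite /curve_length; congr ereal_sup.
by apply/seteqP; split=> _ [s ps <-]; exists s => //; rewrite polygonE.
Qed.

Lemma polygon_ge0 a s : 0 <= polygon a s.
Proof. by elim: s a => //= h s ih a; rewrite addr_ge0 ?eucl_dist_ge0. Qed.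

Lemma polygon_le_length a b s : itv_partition a b s ->
  ((polygon a s)%:E <= curve_length g a b)%E.
Proof. by move=> p; rewrite curve_lengthE; apply: ereal_sup_ubound; exists s. Qed.

Lemma curve_length_xx a : curve_length g a a = 0%E.
Proof.
rewrite curve_lengthE (_ : [set _ | _ in _] = [set 0%E]) ?ereal_sup1//.
apply/seteqP; split=> [_ [s /itv_partitionxx -> <-]//|_ ->]; exists [::] => //.
Qed.

Lemma dist_le_length a b : a <= b -> ((eucl_dist (g a) (g b))%:E <= curve_length g a b)%E.
Proof.
rewrite le_eqVlt => /predU1P[->|ab]; first by rewrite eucl_dist0 curve_length_xx.
by have := polygon_le_length (itv_partition1 ab); rewrite /= addr0.
Qed.

Lemma curve_length_ge0 a b : a <= b -> (0 <= curve_length g a b)%E.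
Proof. by move=> /dist_le_length; apply: le_trans; rewrite lee_fin eucl_dist_ge0. Qed.

Lemma polygon_cat a s s' : polygon a (s ++ s') = polygon a s + polygon (last a s) s'.
Proof. by elim: s a => [|h s ih] a /=; rewrite ?add0r// ih addrA. Qed.

Lemma curve_lengthD_ge a c b : a <= c -> c <= b ->
  (curve_length g a c + curve_length g c b <= curve_length g a b)%E.
Proof.
move=> ac cb; have [ly|] := ltP (curve_length g a b) +oo%E; last first.
  by rewrite leye_eq => /eqP ->; rewrite leey.
have bnd s s' : itv_partition a c s -> itv_partition c b s' ->
    ((polygon a s)%:E + (polygon c s')%:E <= curve_length g a b)%E.
  move=> ps ps'; rewrite -EFinD.
  have -> : polygon a s + polygon c s' = polygon a (s ++ s').
    by rewrite polygon_cat; case: ps => _ /eqP ->.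
  exact/polygon_le_length/itv_partition_cat/ps'.
have fin : curve_length g a b \is a fin_num.
  by rewrite ge0_fin_numE// curve_length_ge0// (le_trans ac).
rewrite (curve_lengthE c b) -leeBrDl//; last first.
  rewrite ge0_fin_numE ?curve_length_ge0//.
  apply: le_lt_trans ly; rewrite curve_lengthE; apply: ge_ereal_sup => _ [s ps <-].
  have [s' ps'] : exists s', itv_partition c b s'.
    have [<-|] := eqVneq c b; first by exists [::]; split => /=.
    by move=> cb'; exists [:: b]; apply: itv_partition1; rewrite lt_neqAle cb'.
  by apply: le_trans (bnd _ _ ps ps'); rewrite -EFinD lee_fin lerDl polygon_ge0.
apply: ge_ereal_sup => _ [s' ps' <-].
rewrite leeBrDl//; last first.
  rewrite ge0_fin_numE ?curve_length_ge0//.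
  apply: le_lt_trans ly; rewrite curve_lengthE; apply: ge_ereal_sup => _ [s ps <-].
  by apply: le_trans (bnd _ _ ps ps'); rewrite -EFinD lee_fin lerDl polygon_ge0.
rewrite -leeBrDr// curve_lengthE; apply: ge_ereal_sup => _ [s ps <-].
by rewrite leeBrDr//; exact: bnd.
Qed.

Lemma curve_length_le a c b : a <= c -> c <= b ->
  (curve_length g a c <= curve_length g a b)%E.
Proof.
move=> ac cb; apply: le_trans (curve_lengthD_ge ac cb).
by rewrite leeDl// curve_length_ge0.
Qed.

(** Inserting [c] into a partition does not decrease the polygonal sum. The induction peels off
    points until the next one lies beyond [c]. *)
Lemma curve_lengthD_le a c b : a <= c -> c <= b ->
  (curve_length g a b <= curve_length g a c + curve_length g c b)%E.
Proof.
move=> ac cb; rewrite (curve_lengthE a b); apply: ge_ereal_sup => _ [s ps <-].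
elim: s a ac ps => [|h s ih] a ac ps.
  by rewrite adde_ge0 ?curve_length_ge0.
have ps' := itv_partition_cons ps; have hb := itv_partition_le ps'.
have ah : a < h by case: ps => /= /andP[].
rewrite /= EFinD; have [hc|ch] := leP h c.
  apply: (@le_trans _ _ ((eucl_dist (g a) (g h))%:E +
     (curve_length g h c + curve_length g c b)))%E; first by rewrite leeD2l// ih.
  rewrite addeA leeD2r//; apply: le_trans (curve_lengthD_ge (ltW ah) hc).
  by rewrite leeD2r// dist_le_length// ltW.
apply: (@le_trans _ _ ((eucl_dist (g a) (g c))%:E +
   ((eucl_dist (g c) (g h))%:E + (polygon h s)%:E)))%E.
  by rewrite -!EFinD lee_fin addrA lerD2r eucl_dist_tri.
rewrite leeD ?dist_le_length//.
have := @polygon_le_length c b (h :: s); rewrite /= EFinD; apply.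
by case: ps => /= /andP[_ p] l; split => //=; rewrite ch p.
Qed.

End CurveLength.

Section CurveParam.
Context {R : realType} {n : nat}.
Variable g : R -> 'rV[R]_n.
Implicit Types (a b c t : R) (s : seq R).

Let gc (i : 'I_n) : R -> R := fun t => g t ord0 i.

Lemma variation_cons a b (f : R -> R) h s :
  variation a b f (h :: s) = `|f h - f a| + variation h b f s.
Proof. by rewrite /variation [size _]/= big_nat_recl. Qed.

Lemma polygon_le_variation a b s :
  polygon g a s <= \sum_(i < n) variation a b (gc i) s.
Proof.
elim: s a => [|h s ih] a /=.
  by apply: sumr_ge0 => i _; exact: variation_ge0.
under eq_bigr do rewrite variation_cons.
rewrite big_split lerD// eucl_distC eucl_distE; apply: le_trans (enorm_le_sum _) _.
by apply: ler_sum => i _; rewrite !mxE.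
Qed.

Lemma variation_le_polygon a b s (i : 'I_n) : variation a b (gc i) s <= polygon g a s.
Proof.
elim: s a => [|h s ih] a /=; first by rewrite variation_nil.
rewrite variation_cons lerD// eucl_distC eucl_distE.
by apply: le_trans (coord_le_enorm _ i); rewrite !mxE.
Qed.

Lemma coord_BV a b (i : 'I_n) : a <= b -> (curve_length g a b < +oo)%E ->
  bounded_variation a b (gc i).
Proof.
move=> ab fin; exists (fine (curve_length g a b)) => _ [s ps <-].
apply: le_trans (variation_le_polygon _ _ _ _) _.
rewrite -lee_fin fineK ?ge0_fin_numE ?curve_length_ge0//.
exact: polygon_le_length.
Qed.

Lemma length_le_TV a b : a <= b ->
  (curve_length g a b <= \sum_(i < n) total_variation a b (gc i))%E.
Proof.
move=> ab; rewrite curve_lengthE; apply: ge_ereal_sup => _ [s ps <-].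
apply: (@le_trans _ _ (\sum_(i < n) (variation a b (gc i) s)%:E)%E).
  by rewrite sumEFin lee_fin polygon_le_variation.
apply: lee_sum => i _; apply: ereal_sup_ubound; exists (variation a b (gc i) s) => //.
by exists s.
Qed.

(** The increments of the length function are dominated by those of the sum of the total variations
    of the coordinates. These are continuous for a continuous curve of bounded variation, so the
    length is continuous and the intermediate value theorem applies. *)
Lemma arclength_surj a b c : a <= b -> {within `[a, b], continuous g} ->
  (curve_length g a b < +oo)%E -> 0 <= c <= fine (curve_length g a b) ->
  exists t, t \in `[a, b] /\ curve_length g a t = c%:E.
Proof.
rewrite le_eqVlt => /predU1P[<- _ _|ab gcont fin cl].
  rewrite curve_length_xx /= => /andP[c0 c0']; exists a.
  by rewrite in_itv/= lexx curve_length_xx; split => //; congr EFin; apply/le_anti; rewrite c0 c0'.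
have tfin t : t \in `[a, b] -> curve_length g a t \is a fin_num.
  rewrite in_itv/= => /andP[at_ tb]; rewrite ge0_fin_numE ?curve_length_ge0//.
  exact: le_lt_trans (curve_length_le _ at_ tb) fin.
have TVfin i x y : a <= x -> x <= y -> y <= b -> total_variation x y (gc i) \is a fin_num.
  move=> ax xy yb; apply/bounded_variationP => //; apply: coord_BV => //.
  apply: le_lt_trans fin; apply: le_trans (curve_length_le g (le_trans ax xy) yb).
  by apply: le_trans (curve_lengthD_ge g ax xy); rewrite leeDr// curve_length_ge0.
pose V t := \sum_(i < n) fine (total_variation a t (gc i)).
have Vc : {within `[a, b], continuous V}.
  have Vic i : {within `[a, b], continuous (fine \o (total_variation a)^~ (gc i))}.
    apply: total_variation_continuous => //; last by apply: coord_BV => //; exact: ltW.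
    move=> x; exact: (@continuous_comp _ _ _ _ (fun u : 'rV[R]_n => u ord0 i)
       _ (gcont x) (@coord_continuous _ _ _ _ _ _)).
  have -> : V = fun t => \sum_(i <- index_enum 'I_n) (fine \o (total_variation a)^~ (gc i)) t by [].
  elim: (index_enum 'I_n) => [|i r ih].
    rewrite (_ : (fun _ => _) = cst 0); last by apply/funext => t; rewrite big_nil.
    exact: cst_continuous.
  rewrite (_ : (fun _ => _) = fun t => (fine \o (total_variation a)^~ (gc i)) t +
    \sum_(i <- r) (fine \o (total_variation a)^~ (gc i)) t); last first.
    by apply/funext => t; rewrite big_cons.
  move=> x; apply: (@cvgD _ _ _ _ _ (fine \o (total_variation a)^~ (gc i))); [exact: Vic|exact: ih].
have dom x y : x \in `[a, b] -> y \in `[a, b] -> x <= y ->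
    0 <= fine (curve_length g a y) - fine (curve_length g a x) <= V y - V x.
  move=> xab yab xy; have := xab; have := yab; rewrite !in_itv/= => /andP[ay yb] /andP[ax xb].
  rewrite subr_ge0 fine_le ?tfin ?curve_length_le//=.
  rewrite lerBlDr -lee_fin fineK ?tfin//.
  apply: le_trans (curve_lengthD_le g ax xy) _.
  rewrite (addrC (V y - V x)) EFinD fineK ?tfin// leeD2l//.
  apply: le_trans (length_le_TV xy) _.
  rewrite /V -sumrB -sumEFin; apply: lee_sum => i _.
  rewrite EFinB !fineK ?TVfin//.
  by rewrite (total_variationD (gc i) ax xy) addeAC subee ?TVfin// add0e.
have Lc : {within `[a, b], continuous (fine \o curve_length g a)}.
  apply/subspace_continuousP => x xab.
  have /subspace_continuousP/(_ x xab)/cvgrPdist_lt Vx := Vc.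
  apply/cvgrPdist_lt => e e0; have := Vx _ e0.
  have nab : \forall y \near within `[a, b] (nbhs x), `[a, b]%classic y by exact: withinT.
  move=> H; near=> y.
  have yab : `[a, b]%classic y by near: y.
  have : `|V x - V y| < e by near: y.
  apply: le_lt_trans => /=.
  have [xy|/ltW yx] := leP x y.
    have /andP[d0 d1] := dom _ _ xab yab xy.
    by rewrite distrC ger0_norm// distrC ger0_norm// (le_trans d0).
  have /andP[d0 d1] := dom _ _ yab xab yx.
  by rewrite ger0_norm// ger0_norm// (le_trans d0).
have [|t tab tE] := @IVT _ (fine \o curve_length g a) a b c (ltW ab) Lc.
  rewrite /= curve_length_xx /= minElt maxElt.
  have l0 : 0 <= fine (curve_length g a b) by rewrite fine_ge0// curve_length_ge0// ltW.
  have [_|l0'] := ltP 0 (fine (curve_length g a b)); first exact: cl.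
  have e0 : fine (curve_length g a b) = 0 by apply/le_anti; rewrite l0 l0'.
  by move: cl; rewrite e0.
by exists t; split => //; rewrite -tE /= fineK ?tfin.
Unshelve. all: by end_near. Qed.

Lemma arclength_paramP a b c : a <= b -> {within `[a, b], continuous g} ->
  (curve_length g a b < +oo)%E -> 0 <= c <= fine (curve_length g a b) ->
  exists t, [/\ t \in `[a, b], curve_length g a t = c%:E & arclength_param g a b c = g t].
Proof.
move=> ab gcont fin cl.
have [t0 Ht0] := arclength_surj ab gcont fin cl.
have [t1 t2] := @getPex _ [set t : R | t \in `[a, b] /\ curve_length g a t = c%:E]
  (ex_intro _ t0 Ht0).
by eexists; split; [exact: t1|exact: t2|].
Qed.

Lemma arclength_param_lip a b c c' : a <= b -> {within `[a, b], continuous g} ->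
  (curve_length g a b < +oo)%E -> 0 <= c -> c <= c' -> c' <= fine (curve_length g a b) ->
  eucl_dist (arclength_param g a b c) (arclength_param g a b c') <= c' - c.
Proof.
move=> ab gcont fin c0 cc' cl.
have [|t [+ tc ->]] := @arclength_paramP a b c ab gcont fin; first by rewrite c0 (le_trans cc').
have [|t' [+ tc' ->]] := @arclength_paramP a b c' ab gcont fin.
  by rewrite cl (le_trans c0).
rewrite !in_itv/= => /andP[at' tb'] /andP[at_ tb].
have [tt'|/ltW tt'] := leP t t'.
  rewrite lerBrDl -lee_fin EFinD -tc -tc'.
  by apply: le_trans (curve_lengthD_ge g at_ tt'); rewrite leeD2l// dist_le_length.
(* If the larger arclength is reached at the earlier time, no length is left between the two times
   and the two points coincide. *)
have := curve_lengthD_ge g at' tt'; rewrite tc tc'.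
have := dist_le_length g tt'; rewrite eucl_distC => d1 d2.
have : ((c' + eucl_dist (g t) (g t'))%:E <= c%:E)%E.
  by apply: le_trans d2; rewrite EFinD leeD2l.
rewrite lee_fin => d3; have := eucl_dist_ge0 (g t) (g t'); lra.
Qed.

Lemma arclength_param0 a b : a <= b -> {within `[a, b], continuous g} ->
  (curve_length g a b < +oo)%E -> arclength_param g a b 0 = g a.
Proof.
move=> ab gcont fin.
have [|t [+ tc ->]] := @arclength_paramP a b 0 ab gcont fin.
  by rewrite lexx fine_ge0// curve_length_ge0.
rewrite in_itv/= => /andP[at_ tb]; apply: eucl_dist_eq0.
have := dist_le_length g at_; rewrite tc lee_fin eucl_distC => d.
by apply/le_anti; rewrite d eucl_dist_ge0.
Qed.

Lemma arclength_param1 a b : a <= b -> {within `[a, b], continuous g} ->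
  (curve_length g a b < +oo)%E ->
  arclength_param g a b (fine (curve_length g a b)) = g b.
Proof.
move=> ab gcont fin.
have l0 := curve_length_ge0 g ab.
have [|t [+ tc ->]] := @arclength_paramP a b (fine (curve_length g a b)) ab gcont fin.
  by rewrite lexx fine_ge0.
rewrite in_itv/= => /andP[at_ tb]; apply: eucl_dist_eq0.
move: tc; rewrite fineK ?ge0_fin_numE// => tc.
have := curve_lengthD_ge g at_ tb; rewrite tc.
have lf : curve_length g a b \is a fin_num by rewrite ge0_fin_numE.
rewrite -[leRHS]addr0 leeD2lE// => d2.
have := le_trans (dist_le_length g tb) d2; rewrite lee_fin => d.
by apply/le_anti; rewrite d eucl_dist_ge0.
Qed.

End CurveParam.

(** * Borel sets and functions for the Euclidean metric *)

Section BorelRV.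
Context {R : realType} {n : nat}.
Implicit Types (x y z : 'rV[R]_n) (v : 'rV[R]_n -> R) (S : set 'rV[R]_n).

Definition bset S : Prop := measurable (S : set (borelRV R n)).
Definition bfun v : Prop := measurable_fun setT (v : borelRV R n -> R).

Lemma open_bset S : open S -> bset S.
Proof. exact: sub_sigma_algebra. Qed.

Lemma closed_bset S : closed S -> bset S.
Proof.
by move=> cS; rewrite -(setCK S); apply: measurableC; apply: open_bset; rewrite openC.
Qed.

Lemma bfun_gtP v : (forall c : R, bset [set x | c < v x]) -> bfun v.
Proof.
move=> H mD; apply: (measurability _ (RGenOInfty.measurableE R)) => //.
move=> _ [_ [c ->] <-]; rewrite setTI.
have -> : v @^-1` `]c, +oo[ = [set x | c < v x].
  by apply/seteqP; split => x /=; rewrite in_itv/= andbT.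
exact: H.
Qed.

Lemma eucl_dist_continuous y : continuous (fun x => eucl_dist x y).
Proof.
move=> x; have FF := nbhs_filter x; apply/cvgrPdist_lt => e e0.
(* A sup-norm ball of radius [e / n.+1] lies in the Euclidean ball of radius [e]; taking [n.+1]
   instead of [n] also covers [n = 0]. *)
have n0 : 0 < n.+1%:R :> R by rewrite ltr0n.
have d0 : 0 < e / n.+1%:R by rewrite divr_gt0.
apply: (@filterS _ _ FF _ _ _ (nbhsx_ballx x _ d0)) => x' [_ xx'].
have dd : eucl_dist x x' < e.
  rewrite eucl_distE; apply: (@le_lt_trans _ _ (n%:R * (e / n.+1%:R))).
    by apply: enorm_le_sup => i; rewrite !mxE; exact: ltW (xx' ord0 i).
  by rewrite mulrCA gtr_pMr// ltr_pdivrMr// mul1r ltr_nat.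
apply: le_lt_trans dd; rewrite ler_norml lerNl opprB.
have := eucl_dist_tri x x' y; have := eucl_dist_tri x' x y; rewrite (eucl_distC x' x) => h1 h2.
by apply/andP; split; lra.
Qed.

Lemma lip_continuous v (K : R) : (forall x y, v x - v y <= K * eucl_dist x y) ->
  continuous v.
Proof.
move=> vL x; have FF := nbhs_filter x; apply/cvgrPdist_lt => e e0.
have K0 : 0 <= `|K| by [].
have d0 : 0 < e / (`|K| + 1) by rewrite divr_gt0// ltr_wpDl.
have := @eucl_dist_continuous x x; rewrite /continuous_at eucl_dist0.
move/cvgrPdist_lt => /(_ _ d0); apply: filterS => y /=.
rewrite sub0r normrN ger0_norm ?eucl_dist_ge0// ltr_pdivlMr ?ltr_wpDl// => yx.
have K1 : K * eucl_dist x y <= `|K| * eucl_dist x y.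
  by rewrite ler_wpM2r ?eucl_dist_ge0// ler_norm.
have := vL x y; have := vL y x; rewrite (eucl_distC y x) => h1 h2.
rewrite ltr_norml; have := eucl_dist_ge0 x y; move: yx; rewrite (eucl_distC y x) mulrDr mulr1 (mulrC _ `|K|) => yx yx0.
by apply/andP; split; lra.
Qed.

Lemma continuous_bfun v : continuous v -> bfun v.
Proof.
move=> cv; apply: bfun_gtP => c; apply: open_bset.
have -> : [set x | c < v x] = v @^-1` [set t | c < t] by [].
by apply: open_comp; [move=> x _; exact: cv|exact: open_gt].
Qed.

Lemma open_eball x (r : R) : open [set y | eucl_dist y x < r].
Proof.
have -> : [set y | eucl_dist y x < r] = (fun y => eucl_dist y x) @^-1` [set t | t < r] by [].
by apply: open_comp; [move=> y _; exact: eucl_dist_continuous|exact: open_lt].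
Qed.

Lemma closed_cball x (r : R) : closed (cball x r).
Proof.
have -> : cball x r = (fun y => eucl_dist y x) @^-1` [set t | t <= r].
  by apply/seteqP; split=> y /=; rewrite /cball/= eucl_distC.
apply: closed_comp; [move=> y _; exact: eucl_dist_continuous|exact: closed_le].
Qed.

Lemma bset_cball x (r : R) : bset (cball x r).
Proof. by apply: closed_bset; exact: closed_cball. Qed.

End BorelRV.

(** * Asymptotic Lipschitz constants as upper gradients *)

Section Slopes.
Context {R : realType} {n : nat}.
Implicit Types (x y z : 'rV[R]_n) (v rho : 'rV[R]_n -> R).

Definition one_lip v := forall x y, v x - v y <= eucl_dist x y.

Lemma one_lip_abs v x y : one_lip v -> `|v x - v y| <= eucl_dist x y.
Proof. by move=> vL; rewrite ler_norml vL andbT lerNl opprB eucl_distC vL. Qed.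

Lemma one_lip_bfun v : one_lip v -> bfun v.
Proof.
move=> vL; apply: continuous_bfun; apply: (@lip_continuous _ _ _ 1) => x y.
by rewrite mul1r.
Qed.

(** An upper bound for the asymptotic Lipschitz constant at [x], the limit of the Lipschitz
    constants on shrinking balls around [x]. Both points vary, so at a fixed radius the quantity is
    lower semicontinuous in [x]. *)
Definition lip_at v (c : R) x := forall e : R, 0 < e -> exists2 r : R, 0 < r &
  forall y z, eucl_dist y x < r -> eucl_dist z x < r -> `|v y - v z| <= (c + e) * eucl_dist y z.

Definition slopes v (r : R) x : set R :=
  [set t | exists y z, [/\ eucl_dist y x < r, eucl_dist z x < r & t = `|v y - v z| / eucl_dist y z]].
Definition slope v (r : R) x : R := sup (slopes v r x).

Lemma slopes_le1 v r x : one_lip v -> ubound (slopes v r x) 1.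
Proof.
move=> vL _ [y [z [_ _ ->]]].
have [->|yz] := eqVneq (eucl_dist y z) 0; first by rewrite invr0 mulr0.
by rewrite ler_pdivrMr ?mul1r ?one_lip_abs// lt_neqAle eq_sym yz eucl_dist_ge0.
Qed.

(** The pair [x, x] contributes the quotient [0 / 0], whose value is [0]. *)
Lemma slopes_neq0 v r x : 0 < r -> slopes v r x !=set0.
Proof. by move=> r0; exists (`|v x - v x| / eucl_dist x x), x, x; rewrite eucl_dist0. Qed.

Lemma slope_ge v r x y z : one_lip v -> eucl_dist y x < r -> eucl_dist z x < r ->
  `|v y - v z| <= slope v r x * eucl_dist y z.
Proof.
move=> vL yx zx.
have [yz|yz] := eqVneq (eucl_dist y z) 0.
  by rewrite yz mulr0 -yz one_lip_abs.
rewrite -ler_pdivrMr ?lt_neqAle 1?eq_sym ?yz ?eucl_dist_ge0//.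
by apply: ub_le_sup; [exists 1; exact: slopes_le1|exists y, z].
Qed.

Lemma slope_ge0 v r x : one_lip v -> 0 < r -> 0 <= slope v r x.
Proof.
move=> vL r0; apply: (@le_trans _ _ (`|v x - v x| / eucl_dist x x)).
  by rewrite subrr normr0 mul0r.
by apply: ub_le_sup; [exists 1; exact: slopes_le1|exists x, x; rewrite eucl_dist0].
Qed.

Lemma slope_le1 v r x : one_lip v -> 0 < r -> slope v r x <= 1.
Proof. by move=> vL r0; apply: ge_sup; [exact: slopes_neq0|exact: slopes_le1]. Qed.

(** A pair of points witnessing a quotient above [c] near [x] also serves all points close to [x],
    so the superlevel sets are open. *)
Lemma slope_bfun v r : one_lip v -> 0 < r -> bfun (slope v r).
Proof.
move=> vL r0; apply: bfun_gtP => c; apply: open_bset.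
have -> : [set x | c < slope v r x] = \bigcup_(p in [set p : 'rV[R]_n * 'rV[R]_n |
    c < `|v p.1 - v p.2| / eucl_dist p.1 p.2])
    ([set x | eucl_dist x p.1 < r] `&` [set x | eucl_dist x p.2 < r]).
  apply/seteqP; split => [x /= cx|x [[y z] /= cyz [yx zx]]].
    have [_ [y [z [yx zx ->]]] cyz] := sup_gt (slopes_neq0 v x r0) cx.
    by exists (y, z) => //=; split => /=; rewrite eucl_distC.
  apply: lt_le_trans cyz _; apply: ub_le_sup; first by exists 1; exact: slopes_le1.
  by exists y, z; split => //; rewrite eucl_distC.
apply: bigcup_open => p _; apply: openI; exact: open_eball.
Qed.

Lemma lip_at_slope v c x (e : R) : one_lip v -> lip_at v c x -> 0 < e -> 0 <= c ->
  exists2 r0 : R, 0 < r0 & forall r, 0 < r -> r <= r0 -> slope v r x <= c + e.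
Proof.
move=> vL Lx e0 c0; have [r0 r00 H] := Lx _ e0; exists r0 => // r rgt0 rr0.
apply: ge_sup; first exact: slopes_neq0.
move=> _ [y [z [yx zx ->]]].
have [->|yz] := eqVneq (eucl_dist y z) 0; first by rewrite invr0 mulr0; lra.
rewrite ler_pdivrMr; last by rewrite lt_neqAle eq_sym yz eucl_dist_ge0.
by apply: H; [exact: lt_le_trans yx rr0|exact: lt_le_trans zx rr0].
Qed.

Lemma one_lip_at v x : one_lip v -> lip_at v 1 x.
Proof.
move=> vL e e0; exists 1 => // y z _ _; apply: le_trans (one_lip_abs _ _ vL) _.
by rewrite ler_peMl ?eucl_dist_ge0// lerDl ltW.
Qed.

Lemma lip_at_near v v' c x (r0 : R) : 0 < r0 -> (forall y, eucl_dist y x < r0 -> v y = v' y) ->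
  lip_at v c x -> lip_at v' c x.
Proof.
move=> r00 vv' H e e0; have [r rgt0 Hr] := H e e0.
exists (Num.min r r0); first by rewrite lt_min rgt0.
move=> y z; rewrite !lt_min => /andP[yr yr0] /andP[zr zr0].
by rewrite -!vv'//; exact: Hr.
Qed.

End Slopes.

Section UpperGradient.
Context {R : realType} {n : nat}.
Implicit Types (x y z : 'rV[R]_n) (v rho : 'rV[R]_n -> R) (H : R -> 'rV[R]_n).

Definition lip_curve H := forall s t, s <= t -> eucl_dist (H s) (H t) <= t - s.

Lemma lip_curve_abs H s t : lip_curve H -> eucl_dist (H s) (H t) <= `|t - s|.
Proof.
move=> HL; have [st|/ltW ts] := leP s t; first by rewrite ger0_norm ?subr_ge0// HL.
by rewrite distrC ger0_norm ?subr_ge0// eucl_distC HL.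
Qed.

Lemma lip_curve_continuous H : lip_curve H -> continuous H.
Proof.
move=> HL t; apply/cvg_ballP => e e0.
near=> s.
have st : `|t - s| < e by near: s; exact: (@cvgr_dist_lt _ _ _ _ _ id t).
split=> // i j; rewrite ord1; apply: le_lt_trans st.
apply: (@le_trans _ _ (eucl_dist (H t) (H s))); last first.
  by rewrite distrC; exact: lip_curve_abs.
rewrite eucl_distE; by apply: le_trans (coord_le_enorm _ j); rewrite !mxE.
Unshelve. all: by end_near. Qed.

Lemma lip_curve_meas H f : lip_curve H -> bfun f -> measurable_fun setT (f \o H : R -> R).
Proof.
move=> HL mf.
apply: (@measurable_comp _ _ _ _ _ _ setT (f : borelRV R n -> R) setT (H : R -> borelRV R n)) => //.
apply: (@measurability _ _ _ (borelRV R n) setT H (@open 'rV[R]_n)) => //.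
move=> _ [B oB <-]; rewrite setTI; apply: open_measurable.
by apply: open_comp => // t _; exact: lip_curve_continuous.
Qed.

Local Notation leb := (@lebesgue_measure R).

(** Each step is shorter than [r], so both its endpoints lie in the [r]-ball around [H s] for every
    [s] in the step. The increment is then at most [del] times the slope at every such [s], hence at
    most the integral over the step. *)
Lemma slope_chain v H (r del : R) (a : R) N : one_lip v -> lip_curve H -> 0 < del -> del < r ->
  (`|v (H (a + N%:R * del)%R) - v (H a)|%:E <=
     \int[leb]_(s in `[a, (a + N%:R * del)%R[) (slope v r (H s))%:E)%E.
Proof.
move=> vL HL d0 dr; have r0 : 0 < r by exact: lt_trans dr.
have ms D : measurable D -> measurable_fun D (fun s => (slope v r (H s))%:E).
  move=> mD; apply/measurable_EFinP; apply: measurable_funTS.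
  exact: lip_curve_meas (slope_bfun vL r0).
elim: N => [|N ih].
  by rewrite mul0r addr0 subrr normr0 integral_ge0// => s _; rewrite lee_fin slope_ge0.
set b := a + N%:R * del in ih *.
have bE : a + N.+1%:R * del = b + del by rewrite /b -natr1 mulrDl mul1r addrA.
have ab : a <= b by rewrite lerDl mulr_ge0// ltW.
have bd : b <= b + del by rewrite lerDl ltW.
rewrite bE (@itv_bndbnd_setU _ _ (BLeft a) (BLeft b) (BLeft (b + del)))//.
rewrite ge0_integral_setU//=; last 3 first.
- by apply: ms; exact: measurableU.
- by move=> s _; rewrite lee_fin slope_ge0.
- apply/disj_setPS => s /= []; rewrite !in_itv/= => /andP[_ sb] /andP[bs _].
  by have := lt_le_trans sb bs; rewrite ltxx.
apply: (@le_trans _ _ (`|v (H b) - v (H a)|%:E + `|v (H (b + del)%R) - v (H b)|%:E)%E).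
  rewrite -EFinD lee_fin (_ : v (H (b + del)) - v (H a) =
    (v (H b) - v (H a)) + (v (H (b + del)) - v (H b))) ?ler_normD//; ring.
apply: leeD => //.
set c := `|v (H (b + del)) - v (H b)|.
apply: (@le_trans _ _ (\int[leb]_(s in `[b, (b + del)%R[) (c / del)%:E)%E).
  rewrite integral_cst//= lebesgue_measure_itv/= lte_fin ltrDl d0 -EFinB -EFinM lee_fin.
  by rewrite (_ : b + del - b = del) ?divfK// ?gt_eqF//; ring.
apply: ge0_le_integral => //.
- by move=> s _; rewrite lee_fin; apply: divr_ge0; [exact: normr_ge0|exact: ltW].
- exact: ms.
move=> s; rewrite /= in_itv/= => /andP[bs sb]; rewrite lee_fin ler_pdivrMr//.
have d1 : eucl_dist (H (b + del)) (H s) < r.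
  by rewrite eucl_distC; apply: le_lt_trans (HL _ _ (ltW sb)) _; lra.
have d2 : eucl_dist (H b) (H s) < r by apply: le_lt_trans (HL _ _ bs) _; lra.
apply: le_trans (slope_ge vL d1 d2) _; rewrite ler_wpM2l ?slope_ge0//.
by rewrite eucl_distC; apply: le_trans (HL _ _ bd) _; rewrite addrC addKr.
Qed.

Lemma slope_curve v H (r : R) (l : R) : one_lip v -> lip_curve H -> 0 < r -> 0 <= l ->
  (`|v (H l) - v (H 0)|%:E <= \int[leb]_(s in `[0%R, l]) (slope v r (H s))%:E)%E.
Proof.
move=> vL HL r0; rewrite le_eqVlt => /predU1P[<-|l0].
  by rewrite subrr normr0 integral_ge0// => s _; rewrite lee_fin slope_ge0.
pose N := (Num.truncn (l / r)).+1.
have N0 : 0 < N%:R :> R by rewrite ltr0n.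
have := @slope_chain v H r (l / N%:R) 0 N vL HL.
rewrite divr_gt0// add0r mulrCA divff ?gt_eqF// mulr1 => /(_ isT).
have -> : l / N%:R < r.
  by rewrite ltr_pdivrMr// mulrC -ltr_pdivrMr// truncnS_gt.
move=> /(_ isT) h; apply: le_trans h _; apply: ge0_subset_integral => //=.
- apply/measurable_EFinP; apply: measurable_funTS.
  exact: lip_curve_meas (slope_bfun vL r0).
- by move=> s _; rewrite lee_fin slope_ge0.
- by move=> s; rewrite /= !in_itv/= => /andP[-> /ltW].
Qed.

(** The radius tends to zero in [slope_curve]. The slopes need not converge to [rho], which is only
    an upper bound, but their maxima with [rho] do, and these are dominated by [1]. *)
Lemma lip_at_curve v rho H (l : R) : one_lip v -> bfun rho -> lip_curve H -> 0 <= l ->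
  (forall x, 0 <= rho x <= 1) ->
  (forall s, 0 <= s <= l -> lip_at v (rho (H s)) (H s)) ->
  (`|v (H l) - v (H 0)|%:E <= \int[leb]_(s in `[0%R, l]) (rho (H s))%:E)%E.
Proof.
move=> vL mrho HL l0 rho01 vrho.
pose f_ (k : nat) s := (Num.max (slope v (k.+1%:R^-1) (H s)) (rho (H s)))%:E.
have k0 (k : nat) : 0 < k.+1%:R^-1 :> R by rewrite invr_gt0.
have mf k : measurable_fun `[0, l] (f_ k).
  apply/measurable_EFinP; apply: measurable_funTS; apply: measurable_maxr.
    exact: lip_curve_meas (slope_bfun vL (k0 k)).
  exact: lip_curve_meas mrho.
have mr : measurable_fun `[0, l] (fun s => (rho (H s))%:E).
  by apply/measurable_EFinP; apply: measurable_funTS; exact: lip_curve_meas mrho.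
have cv s : `[0, l]%classic s -> f_ ^~ s @ \oo --> (rho (H s))%:E.
  rewrite /= in_itv/= => sl; apply/cvg_EFin; first by apply: nearW => k.
  rewrite /f_ /=; apply/cvgrPdist_le => e e0.
  have [|r0 r00 Hr] := lip_at_slope vL (vrho s sl) e0; first by case/andP: (rho01 (H s)).
  near=> k.
  have kr : k.+1%:R^-1 <= r0.
    rewrite -(invrK r0) lef_pV2 ?posrE ?invr_gt0//.
    near: k; exists (Num.truncn r0^-1).+1 => // m /= hm.
    apply: le_trans (ltW (truncnS_gt _)) _; rewrite ler_nat; exact: leq_trans hm _.
  have := Hr _ (k0 k) kr; rewrite distrC => h.
  rewrite ger0_norm; first by rewrite lerBlDl ge_max h lerDl ltW.
  by rewrite subr_ge0 le_max lexx orbT.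
have ig : leb.-integrable `[0, l] (cst 1%:E).
  apply/integrableP; split; first exact: measurable_cst.
  rewrite /= integral_cst//= lebesgue_measure_itv/= normr1 mul1e; case: ifP => _ //.
  by rewrite -EFinB ltry.
have [] := @dominated_convergence _ _ _ leb `[0, l]%classic _ f_ _ (cst 1%:E) mf mr _ ig.
- exact: (measurable_itv `[0, l]).
- by apply: aeW => s /=; exact: cv.
- apply: aeW => s /= k _; rewrite lee_fin ger0_norm; last by rewrite le_max slope_ge0.
  by rewrite ge_max slope_le1//; case/andP: (rho01 (H s)).
move=> _ _ clim; rewrite -(cvg_lim _ clim)//; apply: lime_ge; first by apply/cvg_ex; eexists; exact: clim.
apply: nearW => k; apply: le_trans (slope_curve vL HL (k0 k) l0) _.
apply: ge0_le_integral => //=.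
- by move=> s sl; rewrite lee_fin slope_ge0.
- apply/measurable_EFinP; apply: measurable_funTS.
  exact: lip_curve_meas (slope_bfun vL (k0 k)).
- exact: mf.
- by move=> s sl; rewrite lee_fin le_max lexx.
Unshelve. all: by end_near. Qed.

End UpperGradient.

Lemma clamp_lip {R : realType} (l s t : R) : 0 <= l -> s <= t ->
  Num.max 0 (Num.min t l) - Num.max 0 (Num.min s l) <= t - s.
Proof.
by move=> l0 st; rewrite !minElt; case: (ltP s l) => sl; case: (ltP t l) => tl;
  rewrite !maxElt; do ?[case: ltP => ?]; lra.
Qed.

Section LipUpperGradient.
Context {R : realType} {n : nat}.
Implicit Types (x y z : 'rV[R]_n) (v rho : 'rV[R]_n -> R) (X : set 'rV[R]_n).

Lemma lip_at_upper_gradient X v rho : one_lip v -> bfun rho ->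
  (forall x, 0 <= rho x <= 1) -> (forall x, X x -> lip_at v (rho x) x) ->
  upper_gradient X v (EFin \o rho).
Proof.
move=> vL mrho rho01 vrho; split.
- by apply/measurable_EFinP; exact: measurable_funTS.
- by move=> x _; rewrite lee_fin; case/andP: (rho01 x).
move=> x y g a b _ _ [ab gc gX [gax gby] lfin].
set l := fine (curve_length g a b).
have l0 : 0 <= l by rewrite fine_ge0// curve_length_ge0.
(* Composition with the projection of the line onto [[0, l]] extends the arclength parametrisation
   to a [1]-Lipschitz curve on the whole line, as [lip_curve] demands. *)
pose cl s := Num.max 0 (Num.min s l).
have cl0 s : 0 <= cl s by rewrite le_max lexx.
have cll s : cl s <= l by rewrite ge_max l0 ge_min lexx orbT.
have clE s : 0 <= s <= l -> cl s = s.
  by move=> /andP[s0 sl]; rewrite /cl (min_idPl sl) (max_idPr s0).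
pose H s := arclength_param g a b (cl s).
have HL : lip_curve H.
  move=> s t st.
  have cst : cl s <= cl t by rewrite /cl ge_max !le_max lexx/= le_min !ge_min st lexx !orbT.
  apply: le_trans (arclength_param_lip ab gc lfin (cl0 s) cst (cll t)) _.
  exact: clamp_lip.
have H0 : H 0 = x by rewrite /H clE ?lexx// arclength_param0.
have Hl : H l = y by rewrite /H clE ?lexx ?l0// arclength_param1.
have := @lip_at_curve _ _ v rho H l vL mrho HL l0 rho01.
rewrite H0 Hl distrC => h; apply: le_trans (h _) _.
  move=> s sl; apply: vrho; rewrite /H clE//.
  by have [t [tab _ ->]] := arclength_paramP ab gc lfin sl; exact: gX.
rewrite /curve_integral -/l le_eqVlt; apply/orP; left; apply/eqP.
apply: eq_integral => s /set_mem /=; rewrite in_itv/= => sl.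
by rewrite /H clE.
Qed.

End LipUpperGradient.

(** * Oscillation bounds from the Poincare inequality *)

Section Support.
Context {R : realType} {n : nat}.
Variable mu : {measure set (borelRV R n) -> \bar R}.

(** Every point off the support lies in a null ball with rational centre and radius [1 / k.+1].
    There are countably many such balls, and [F] enumerates the null ones. *)
Lemma msupportC_null : mu (~` msupport mu) = 0%E.
Proof.
pose B (p : 'rV[rat]_n * nat) : set 'rV[R]_n :=
  [set y | eucl_dist y (map_mx ratr p.1) < p.2.+1%:R^-1].
pose F (m : nat) : set 'rV[R]_n :=
  if unpickle m is Some p then (if mu (B p) == 0%E then B p else set0) else set0.
have mF m : bset (F m).
  rewrite /F; case: unpickle => [p|]; last exact: measurable0.
  by case: ifP => _; [apply: open_bset; exact: open_eball|exact: measurable0].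
have F0 m : mu (F m) = 0%E.
  by rewrite /F; case: unpickle => [p|]; rewrite ?measure0//; case: ifPn => [/eqP//|]; rewrite measure0.
have sub : ~` msupport mu `<=` \bigcup_m F m.
  move=> x; rewrite /msupport/= -existsNP => -[U] /not_implyP[oU] /not_implyP[Ux] /negP.
  rewrite -leNgt => mU.
  have mU0 : mu U = 0%E by apply/le_anti; rewrite mU measure_ge0.
  have /nbhs_ballP [e /= e0 eU] : nbhs x U by exact: open_nbhs_nbhs.
  pose k := Num.truncn (2 / e).
  have k0 : 0 < k.+1%:R^-1 :> R by rewrite invr_gt0.
  have ke : k.+1%:R^-1 < e / 2.
    by rewrite -[e / 2]invrK ltf_pV2 ?posrE ?invr_gt0 ?divr_gt0// invf_div truncnS_gt.
  pose h : R := k.+1%:R^-1 / n.+1%:R.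
  have h0 : 0 < h by rewrite divr_gt0.
  have hq (i : 'I_n) : exists q : rat, x ord0 i - h < ratr q < x ord0 i + h.
    have [|q] := @rat_in_itvoo R (x ord0 i - h) (x ord0 i + h); first by lra.
    by rewrite in_itv/=; exists q.
  have [q Hq] := choice hq.
  pose p := (\row_i q i : 'rV[rat]_n, k).
  have Bx : B p x.
    rewrite /B /= eucl_distE; apply: (@le_lt_trans _ _ (n%:R * h)).
      apply: enorm_le_sup => i; rewrite !mxE ler_norml.
      have /andP[h1 h2] := Hq i; move: h1 h2; rewrite /= => h1 h2; apply/andP; split; lra.
    by rewrite mulrCA gtr_pMr// ltr_pdivrMr// mul1r ltr_nat.
  have BU : B p `<=` U.
    move=> y /= yp; apply: eU; split => // i j; rewrite ord1.
    apply: (@le_lt_trans _ _ (eucl_dist x y)).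
      by rewrite eucl_distE; apply: le_trans (coord_le_enorm _ j); rewrite !mxE.
    apply: le_lt_trans (eucl_dist_tri (map_mx ratr p.1) _ _) _.
    move: Bx yp; rewrite /B /p /= (eucl_distC _ y) => b1 b2; by apply: (lt_trans (ltrD b1 b2)); rewrite [ltRHS]splitr ltrD.
  exists (pickle p) => //; rewrite /F pickleK ifT//.
  apply/eqP/le_anti; rewrite measure_ge0 andbT -mU0; apply: le_measure => //.
  - by rewrite inE; apply: open_bset; exact: open_eball.
  - by rewrite inE; exact: open_bset.
have mS : bset (~` msupport mu).
  apply: open_bset; rewrite openE => x.
  rewrite /msupport/= -existsNP => -[U] /not_implyP[oU] /not_implyP[Ux] nU.
  apply: (@filterS _ _ (nbhs_filter x) U); last by apply: open_nbhs_nbhs.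
  by move=> y Uy /(_ U oU Uy).
apply/le_anti; rewrite measure_ge0 andbT.
apply: (@le_trans _ _ (\sum_(0 <= m <oo) mu (F m))%E).
  by apply: measure_sigma_subadditive.
by rewrite eseries0// => i _ _; exact: F0.
Qed.

End Support.

Section PoincareLip.
Context {R : realType} {n d : nat}.
Variables (C lam A : R) (X : set 'rV[R]_n) (mu : {measure set (borelRV R n) -> \bar R}).
Hypotheses (hC : 1 <= C) (hlam : 1 <= lam) (hA : 1 <= A) (d0 : (0 < d)%N).
Hypotheses (cX : closed X) (reg : ahlfors_regular d A X mu).
Hypothesis pi : weak_poincare d%:R C lam X mu.

Lemma mu_cball_lty x (r : R) : X x -> 0 < r -> (r%:E < diam X)%E -> (mu (cball x r) < +oo)%E.
Proof. by move=> Xx r0 rD; have [_ /(_ x r Xx r0 rD)/andP[_ h]] := reg; apply: le_lt_trans h (ltry _). Qed.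

Lemma mu_ball_in x (r : R) : mu (ball_in X x r) = mu (cball x r).
Proof.
apply/le_anti/andP; split.
  apply: le_measure; [by rewrite inE; apply: measurableI; [exact: closed_bset|exact: bset_cball]
    |by rewrite inE; exact: bset_cball|by move=> ? []].
apply: (@le_trans _ _ (mu (ball_in X x r) + mu (~` X))%E).
  apply: (le_trans _ (measureU2 _ _ _)); first last.
  - by apply: measurableC; exact: closed_bset.
  - by apply: measurableI; [exact: closed_bset|exact: bset_cball].
  apply: le_measure.
  - by rewrite inE; exact: bset_cball.
  - rewrite inE; apply: measurableU; last by apply: measurableC; exact: closed_bset.
    by apply: measurableI; [exact: closed_bset|exact: bset_cball].
  by move=> y xy; have [Xy|nX] := pselect (X y); [left|right].
have -> : mu (~` X) = 0%E by have [XE _] := reg; rewrite XE msupportC_null.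
by rewrite adde0.
Qed.

(** Regularity bounds the mass only of balls smaller than [diam X]. A larger ball is compact in [X],
    so finitely many balls of radius [r0] cover it. *)
Lemma mu_ball_lty (r0 : R) x s : 0 < r0 -> (r0%:E < diam X)%E -> (mu (ball_in X x s) < +oo)%E.
Proof.
move=> r00 r0D.
have cB : compact (ball_in X x s).
  apply: bounded_closed_compact; last by apply: closedI => //; exact: closed_cball.
  exists (enorm x + s); split; first exact: num_real.
  move=> M hM y [_ xy] /=; rewrite [leLHS](_ : _ = mx_norm y)// mx_normrE; apply: bigmax_le.
    by apply: le_trans (ltW hM); rewrite addr_ge0 ?enorm_ge0// (le_trans _ xy)// eucl_dist_ge0.
  move=> [i j] _; rewrite ord1; apply: le_trans (coord_le_enorm _ j) _.
  apply: le_trans (ltW hM); rewrite -(subrK x y) addrC; apply: le_trans (enormD _ _) _.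
  by rewrite lerD2l -eucl_distE eucl_distC.
have [D DX DB] : finite_subset_cover (ball_in X x s) (fun y => [set z | eucl_dist z y < r0]) (ball_in X x s).
  move: cB; rewrite compact_cover => cB; apply: cB.
    by move=> y _; exact: open_eball.
  by move=> y By; exists y => //=; rewrite eucl_dist0.
have mb (y : 'rV[R]_n) : bset [set z | eucl_dist z y < r0] by apply: open_bset; exact: open_eball.
have mB : bset (ball_in X x s) by apply: measurableI; [exact: closed_bset|exact: bset_cball].
have {DB} DB : ball_in X x s `<=` \big[setU/set0]_(y <- finmap.enum_fset D) [set z | eucl_dist z y < r0].
  by rewrite -bigcup_fset.
apply: (@le_lt_trans _ _ (mu (\big[setU/set0]_(y <- finmap.enum_fset D) [set z | eucl_dist z y < r0]))).
  by apply: le_measure; [rewrite inE|rewrite inE; apply: bigsetU_measurable => *; exact: mb|].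
have : forall y, y \in (finmap.enum_fset D) -> X y by move=> y yD; have := DX y yD; rewrite inE => -[].
elim: (finmap.enum_fset D) => [|y l ih] lX; first by rewrite big_nil measure0.
rewrite big_cons; apply: le_lt_trans (measureU2 _ (mb y) _) _.
  by apply: bigsetU_measurable => *; exact: mb.
apply: lte_add_pinfty; last by apply: ih => z zl; apply: lX; rewrite inE zl orbT.
apply: le_lt_trans (mu_cball_lty (lX y (mem_head _ _)) r00 r0D).
apply: le_measure; [by rewrite inE; exact: mb|by rewrite inE; exact: bset_cball|].
by move=> z /= /ltW; rewrite /cball/= eucl_distC.
Qed.

Lemma mu_ball_ge x r : X x -> 0 < r -> (r%:E < diam X)%E ->
  A^-1 * r ^+ d <= fine (mu (ball_in X x r)).
Proof.
move=> Xx r0 rD; rewrite mu_ball_in -lee_fin fineK ?ge0_fin_numE ?mu_cball_lty//.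
by have [_ /(_ x r Xx r0 rD)/andP[]] := reg.
Qed.

Lemma mu_ball_le x r : X x -> 0 < r -> (r%:E < diam X)%E ->
  fine (mu (ball_in X x r)) <= A * r ^+ d.
Proof.
move=> Xx r0 rD; rewrite mu_ball_in -lee_fin fineK ?ge0_fin_numE ?mu_cball_lty//.
by have [_ /(_ x r Xx r0 rD)/andP[]] := reg.
Qed.

Lemma diam_ball_in x r : 0 <= r -> (diam (ball_in X x r) <= (2 * r)%:E)%E.
Proof.
move=> r0; rewrite /diam ge_max lee_fin mulr_ge0//=; apply: ge_ereal_sup.
move=> _ [[y z] [[_ xy] [_ xz]] <-]; rewrite lee_fin.
have xy' : eucl_dist x y <= r := xy.
have xz' : eucl_dist x z <= r := xz.
by apply: le_trans (eucl_dist_tri x y z) _; rewrite (eucl_distC y x); lra.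
Qed.

(* The energy threshold comes from testing the inequality on the ball of radius [k * r / 4] around
   whichever of the two points has a value far from the average. *)
Definition osc_energy (k : R) : R := ((k / 4) ^+ d.+1 / A ^+ 2 / (2 * C)) ^+ d / (2 * A).

Lemma poincare_osc v rho (k : R) x r : one_lip v -> bfun rho ->
  (forall x, 0 <= rho x <= 1) -> (forall x, X x -> lip_at v (rho x) x) ->
  0 < k <= 1 -> X x -> 0 < r -> ((lam * r)%:E < diam X)%E ->
  Rintegral mu (ball_in X x (lam * r) : set (borelRV R n)) (fun y => rho y ^+ d) <= osc_energy k * r ^+ d ->
  forall y, X y -> eucl_dist x y <= r / 2 -> `|v y - v x| <= k * r.
Proof.
move=> vL mrho rho01 vrho /andP[k0 k1] Xx r0 lrD small y Xy xy.
move: hC hlam hA => hC' hlam' hA'.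
have C0 : 0 < C by lra.
have A0 : 0 < A by lra.
have lr0 : 0 < lam * r by rewrite mulr_gt0//; lra.
have rlr : r <= lam * r by rewrite ler_peMl// ltW.
have rD : (r%:E < diam X)%E by apply: le_lt_trans lrD; rewrite lee_fin.
have mX := closed_bset cX.
have mB z s : bset (ball_in X z s) by apply: measurableI => //; exact: bset_cball.
have fB z s : mu (ball_in X z s) \is a fin_num.
  by rewrite ge0_fin_numE// (mu_ball_lty _ _ r0 rD).
have mv : bfun v by exact: one_lip_bfun.
have vint z s : mu.-integrable (ball_in X z s : set (borelRV R n)) (EFin \o v).
  apply: measurable_bounded_integrable; [exact: mB|by rewrite -ge0_fin_numE|exact: measurable_funTS|].
  exists (`|v z| + `|s|); split; first exact: num_real.
  move=> M hM w [_ zw] /=; apply: le_trans (ltW hM).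
  rewrite -(subrK (v z) (v w)) addrC; apply: le_trans (ler_normD _ _) _.
  rewrite lerD2l; apply: le_trans (one_lip_abs _ _ vL) _.
  by rewrite eucl_distC (le_trans zw)// ler_norm.
have ug := lip_at_upper_gradient vL mrho rho01 vrho.
set B := ball_in X x r; set lB := ball_in X x (lam * r).
pose b := fine (average mu B (EFin \o v)).
have H : (average mu B (fun y => `|v y - b|%:E) <= C%:E * diam B *
   average mu lB (fun y => (rho y)%:E `^ d%:R) `^ (d%:R)^-1)%E.
  exact: (@pi v (EFin \o rho) (measurable_funTS mv) (fun z s _ _ => vint z s) ug x r Xx r0).
rewrite leNgt; apply/negP => far.
(* A value at distance [k * r / 2] from the mean forces a distance of at least [k * r / 4] on a ball
   of that radius, whose share of the mass of [B] is at least [(k / 4) ^ d / A ^ 2]. So the mean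
   deviation is at least [eta * r]. *)
pose eta := (k / 4) ^+ d.+1 / A ^+ 2.
have eta0 : 0 < eta by rewrite divr_gt0 ?exprn_gt0// divr_gt0.
have [w [Xw xw vw]] : exists w, [/\ X w, eucl_dist x w <= r / 2 & k * r / 2 < `|v w - b|].
  have [vx|vx] := ltP (k * r / 2) `|v x - b|.
    by exists x; rewrite eucl_dist0 divr_ge0// ltW.
  exists y; split => //; rewrite ltNge; apply/negP => vy; move: far; apply/negP; rewrite -leNgt.
  rewrite -(subrKA b); apply: le_trans (ler_normD _ _) _.
  by rewrite (distrC b); lra.
have kr0 : 0 < k * r / 4 by rewrite divr_gt0// mulr_gt0.
have krr : k * r / 4 <= r / 4 by rewrite ler_wpM2r// ler_piMl// ltW.
have sub : ball_in X w (k * r / 4) `<=` B.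
  move=> z [Xz wz]; split => //; have wz' : eucl_dist w z <= k * r / 4 := wz.
  by rewrite /cball/=; apply: le_trans (eucl_dist_tri w _ _) _; lra.
have big z : ball_in X w (k * r / 4) z -> k * r / 4 <= `|v z - b|.
  move=> [Xz wz]; have wz' : eucl_dist w z <= k * r / 4 := wz.
  have := one_lip_abs w z vL; have := ler_normD (v w - v z) (v z - b); rewrite subrKA; lra.
have intabs : measurable_fun (B : set (borelRV R n)) (fun y : borelRV R n => `|v y - b|%:E).
  apply/measurable_EFinP; apply: measurableT_comp => //; apply: measurable_funB => //.
  exact: measurable_funTS.
have lo : ((k * r / 4 * (A^-1 * (k * r / 4) ^+ d))%:E <= \int[mu]_(y in B) `|v y - b|%:E)%E.
  apply: (@le_trans _ _ (\int[mu]_(y in ball_in X w (k * r / 4)) (k * r / 4)%:E)%E).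
    rewrite integral_cst; last exact: mB.
    rewrite -(fineK (fB _ _)) -EFinM lee_fin ler_wpM2l ?(ltW kr0)// mu_ball_ge//.
    by apply: le_lt_trans rD; rewrite lee_fin; lra.
  apply: (@le_trans _ _ (\int[mu]_(y in ball_in X w (k * r / 4)) `|v y - b|%:E)%E).
    apply: ge0_le_integral; [exact: mB|by move=> *; rewrite lee_fin ltW|exact: measurable_cst| |].
      by apply: measurable_funS intabs; [exact: mB|exact: sub].
    by move=> z Bz; rewrite lee_fin big.
  by apply: ge0_subset_integral => //; [exact: mB|exact: mB].
have M0 : 0 < fine (mu B).
  by apply: lt_le_trans (mu_ball_ge Xx r0 rD); rewrite mulr_gt0 ?invr_gt0 ?exprn_gt0.
have M'0 : A^-1 * r ^+ d <= fine (mu lB).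
  apply: le_trans (mu_ball_ge Xx lr0 lrD); rewrite ler_wpM2l ?invr_ge0 ?(ltW A0)//.
  by rewrite lerXn2r// ?nnegrE ltW.
have {}lo : ((eta * r)%:E <= average mu B (fun y => `|v y - b|%:E))%E.
  rewrite /average -(fineK (fB x r)) -/B.
  apply: (@le_trans _ _ ((k * r / 4 * (A^-1 * (k * r / 4) ^+ d))%:E / (fine (mu B))%:E)%E); last first.
    by apply: lee_wpmul2r => //; rewrite inver gt_eqF// lee_fin invr_ge0 ltW.
  rewrite inver gt_eqF// -EFinM lee_fin ler_pdivlMr//.
  apply: (@le_trans _ _ (eta * r * (A * r ^+ d))); first by apply: ler_wpM2l; [apply: mulr_ge0; exact: ltW|exact: mu_ball_le].
  rewrite le_eqVlt; apply/orP; left; apply/eqP; rewrite /eta !expr_div_n !exprMn !exprS.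
  by field; rewrite expf_neq0 ?gt_eqF.
(* [T] bounds the mean of [rho ^ d]. Its factor [1 / 2] provides the strict inequality that
   contradicts [eta * r <= C * (2 * r) * T ^ (1 / d)]. *)
pose T := (eta / (2 * C)) ^+ d / 2.
have T0 : 0 <= T by rewrite divr_ge0// exprn_ge0// divr_ge0 ?ltW// mulr_gt0.
have hi : (average mu lB (fun y => (rho y)%:E `^ d%:R) <= T%:E)%E.
  have M'p : 0 < fine (mu lB) by apply: lt_le_trans M'0; rewrite mulr_gt0 ?invr_gt0 ?exprn_gt0.
  rewrite /average -(fineK (fB x (lam * r))) -/lB inver gt_eqF//.
  have -> : (\int[mu]_(y in lB) ((rho y)%:E `^ d%:R))%E =
     (Rintegral mu (lB : set (borelRV R n)) (fun y => rho y ^+ d))%:E.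
    rewrite /Rintegral fineK; last first.
      apply: integrable_fin_num; first exact: mB.
      apply: measurable_bounded_integrable; [exact: mB|by rewrite -ge0_fin_numE //; exact: fB| |].
        by apply: measurable_funX; exact: measurable_funTS.
      exists 1; split; first exact: num_real.
      move=> M hM z _ /=; apply: le_trans (ltW hM); rewrite ger0_norm ?exprn_ge0 ?exprn_ile1//.
      + by case/andP: (rho01 z).
      + by case/andP: (rho01 z).
      + by case/andP: (rho01 z).
    apply: eq_integral => z _; rewrite poweR_EFin powR_mulrn//; by case/andP: (rho01 z).
  rewrite -EFinM lee_fin ler_pdivrMr//; apply: le_trans small _.
  apply: (@le_trans _ _ (T * (A^-1 * r ^+ d))); last by rewrite ler_wpM2l.
  rewrite /osc_energy -/eta /T le_eqVlt; apply/orP; left; apply/eqP.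
  by field; rewrite !gt_eqF.
have T1 : T `^ (d%:R)^-1 < eta / (2 * C).
  have e2 : 0 <= eta / (2 * C) by rewrite divr_ge0 ?ltW// mulr_gt0.
  have -> : eta / (2 * C) = ((eta / (2 * C)) ^+ d) `^ (d%:R)^-1.
    by rewrite -powR_mulrn// -powRrM divff ?powRr1// pnatr_eq0 -lt0n.
  rewrite gt0_ltr_powR ?nnegrE ?invr_gt0 ?ltr0n ?exprn_ge0//.
  rewrite /T gtr_pMr; first by rewrite invf_lt1// ltr1n.
  by rewrite exprn_gt0// divr_gt0// mulr_gt0.
have : ((eta * r)%:E <= (C * (2 * r) * (T `^ (d%:R)^-1))%:E)%E.
  apply: le_trans lo _; apply: le_trans H _.
  rewrite !EFinM; apply: lee_pmul.
  - by rewrite mule_ge0 ?lee_fin ?(ltW C0)// /diam le_max lexx.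
  - exact: poweR_ge0.
  - by rewrite lee_pmul2l// -EFinM diam_ball_in// ltW.
  rewrite -poweR_EFin; apply: gt0_ler_poweR => //.
  - rewrite in_itv/= leey andbT /average mule_ge0 ?inve_ge0//.
    by apply: integral_ge0 => z zz; rewrite lee_fin powR_ge0.
  - by rewrite in_itv/= leey andbT lee_fin.
rewrite lee_fin; apply/negP; rewrite -ltNge.
apply: (@lt_le_trans _ _ (C * (2 * r) * (eta / (2 * C)))).
  by rewrite ltr_pM2l// !mulr_gt0.
rewrite le_eqVlt; apply/orP; left; apply/eqP; field; by rewrite gt_eqF.
Qed.
End PoincareLip.

(** * Weighted trees *)

Section WeightedTree.
Context {R : realType} {T : Type}.
Variables (ch : T -> seq T) (M D : T -> R).
Implicit Types (t s : T).
Hypothesis M0 : forall t, 0 <= M t.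
Hypothesis D0 : forall t, 0 <= D t.
Hypothesis DM : forall t, D t <= M t.
Hypothesis Madd : forall t, M t = \sum_(s <- ch t) M s.
Hypothesis Dsub : forall t, D t <= \sum_(s <- ch t) D s.

Fixpoint desc N t : seq T := if N is N'.+1 then flatten [seq ch s | s <- desc N' t] else [:: t].

Lemma big_descS N t (F : T -> R) :
  \sum_(s <- desc N.+1 t) F s = \sum_(s <- desc N t) \sum_(s' <- ch s) F s'.
Proof. by rewrite /= big_flatten big_map. Qed.

Lemma big_descD N N' t (F : T -> R) :
  \sum_(s <- desc (N + N') t) F s = \sum_(s <- desc N t) \sum_(s' <- desc N' s) F s'.
Proof.
elim: N' F => [|N' ih] F.
  by rewrite addn0; apply: eq_bigr => s _; rewrite big_seq1.
by rewrite addnS big_descS ih; apply: eq_bigr => s _; rewrite big_descS.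
Qed.

Lemma desc_mass N t : \sum_(s <- desc N t) M s = M t.
Proof.
elim: N => [|N ih]; first by rewrite big_seq1.
by rewrite big_descS -ih; apply: eq_bigr => s _; rewrite -Madd.
Qed.

Lemma desc_sub N t : D t <= \sum_(s <- desc N t) D s.
Proof.
elim: N => [|N ih]; first by rewrite big_seq1.
by apply: le_trans ih _; rewrite big_descS; apply: ler_sum => s _; exact: Dsub.
Qed.

(** On null nodes the value is arbitrary: there [0 <= D <= M] forces [D t = 0], so [densE] holds at
    every node. *)
Definition dens t : R := if M t == 0 then 0 else D t / M t.

Lemma densE t : M t * dens t = D t.
Proof.
rewrite /dens; case: ifPn => [/eqP Mt|Mt]; last by rewrite mulrCA divff ?mulr1.
by rewrite mulr0; apply/le_anti; rewrite D0/= -Mt DM.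
Qed.

Lemma dens_ge0 t : 0 <= dens t.
Proof. by rewrite /dens; case: ifP => // _; rewrite divr_ge0. Qed.

Lemma dens_le1 t : dens t <= 1.
Proof.
rewrite /dens; case: ifPn => // Mt.
by rewrite ler_pdivrMr ?mul1r// lt_neqAle eq_sym Mt M0.
Qed.

Definition energy2 N t : R := \sum_(s <- desc N t) M s * dens s ^+ 2.

Lemma energy2_le N t : energy2 N t <= M t.
Proof.
rewrite -(desc_mass N t); apply: ler_sum => s _.
by rewrite ler_piMr// exprn_ile1 ?dens_ge0 ?dens_le1.
Qed.

Lemma energy2_ge0 N t : 0 <= energy2 N t.
Proof. by apply: sumr_ge0 => s _; rewrite mulr_ge0// sqr_ge0. Qed.

(* The densities form a submartingale, so the deviation of the densities of the descendants is
   controlled by the increment of the second moment. *)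
Lemma dens_deviation N t : \sum_(s <- desc N t) M s * (dens s - dens t) ^+ 2 <=
  energy2 N t - M t * dens t ^+ 2.
Proof.
have -> : \sum_(s <- desc N t) M s * (dens s - dens t) ^+ 2 = energy2 N t
   - 2 * dens t * (\sum_(s <- desc N t) D s) + dens t ^+ 2 * \sum_(s <- desc N t) M s.
  rewrite /energy2 !mulr_sumr -sumrB -big_split /=; apply: eq_bigr => s _.
  by rewrite -densE; ring.
have h : 2 * dens t * (M t * dens t) <= 2 * dens t * \sum_(s <- desc N t) D s.
  by rewrite ler_wpM2l ?mulr_ge0 ?dens_ge0// densE desc_sub.
rewrite desc_mass; move: h.
set S := \sum_(s <- _) _; set E := energy2 N t; lra.
Qed.

Lemma energy2_gap N t : M t * dens t ^+ 2 <= energy2 N t.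
Proof.
rewrite -subr_ge0; apply: le_trans (dens_deviation N t).
by apply: sumr_ge0 => s _; rewrite mulr_ge0// sqr_ge0.
Qed.

(** The second moments [S j] increase with [j] and are bounded by [M t]. A node with a large
    [N]-step increment is charged to [S (j + N) - S j]; summed over [j], these differences split
    into [N] telescoping sums of at most [M t] each. *)
Lemma oscillating_mass (eps : R) N J t : 0 < eps ->
  eps * (\sum_(j < J) \sum_(s <- desc j t | eps * M s < energy2 N s - M s * dens s ^+ 2) M s)
  <= N%:R * M t.
Proof.
move=> eps0; rewrite mulr_sumr.
pose S j := energy2 j t.
have SN j : \sum_(s <- desc j t) (energy2 N s - M s * dens s ^+ 2) = S (j + N)%N - S j.
  by rewrite sumrB /S /energy2 big_descD.
apply: (@le_trans _ _ (\sum_(j < J) (S (j + N)%N - S j))).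
  apply: ler_sum => j _; rewrite -SN mulr_sumr big_mkcond /=; apply: ler_sum => s _.
  by case: ifPn => [/ltW//|_]; rewrite subr_ge0 energy2_gap.
elim: N {SN} => [|N ih].
  by rewrite big1 ?mul0r// => j _; rewrite addn0 subrr.
have -> : \sum_(j < J) (S (j + N.+1)%N - S j) =
   \sum_(j < J) (S (j + N)%N - S j) + \sum_(j < J) (S (j.+1 + N)%N - S (j + N)%N).
  rewrite -big_split /=; apply: eq_bigr => j _; rewrite addnS addSn; ring.
rewrite -natr1 mulrDl mul1r lerD//.
rewrite -(big_mkord xpredT (fun j => S (j.+1 + N)%N - S (j + N)%N)) telescope_sumr// add0n.
by have := energy2_le (J + N) t; have := energy2_ge0 N t; rewrite /S; lra.
Qed.

Variables (cref : T -> R) (ev : T -> bool) (del : R).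
Hypothesis del0 : 0 < del.
Hypothesis cref01 : forall t, 0 <= cref t <= 1.
Hypothesis cref_step : forall t,
  forall i, (i < size (ch t))%N -> let s := nth t (ch t) i in
  if ev s then cref s = dens s /\ del <= `|dens s - cref t| else cref s = cref t.

(** This equals [M t * ((cref t - dens t) ^ 2 + 1 - dens t ^ 2)]. While the reference value is kept,
    the sum of [Phi] over the children does not exceed [Phi] of the parent, because [D] is
    subadditive and [cref] nonnegative; resetting it to the density lowers the potential by
    [M * (dens - cref) ^ 2]. The total drop therefore pays for all resets. *)
Let Phi t : R := M t * (1 + cref t ^+ 2) - 2 * cref t * D t.

Lemma jump_potential_ge0 t : 0 <= Phi t.
Proof.
rewrite /Phi -densE; have /andP[c0 c1] := cref01 t.
have -> : M t * (1 + cref t ^+ 2) - 2 * cref t * (M t * dens t) =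
  M t * ((1 - cref t) ^+ 2 + 2 * cref t * (1 - dens t)) by ring.
by rewrite mulr_ge0// addr_ge0 ?sqr_ge0// mulr_ge0 ?subr_ge0 ?dens_le1// mulr_ge0.
Qed.

Lemma jump_potential_step t :
  \sum_(s <- ch t) ((if ev s then del ^+ 2 * M s else 0) + Phi s) <= Phi t.
Proof.
have /andP[c0 c1] := cref01 t.
apply: (@le_trans _ _ (\sum_(s <- ch t) (M s * (1 + cref t ^+ 2) - 2 * cref t * D s))).
  rewrite [leLHS](big_nth t) [leRHS](big_nth t) !big_nat; apply: ler_sum => i /andP[_ ilt].
  have := cref_step ilt; cbv zeta; set s := nth t (ch t) i.
  case: ifP => _; last by rewrite /Phi => ->; rewrite add0r.
  move=> [cs dl]; rewrite /Phi cs.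
  have d2 : del ^+ 2 <= (dens s - cref t) ^+ 2.
    by rewrite -[leRHS]real_normK ?num_real// lerXn2r ?nnegrE// ltW.
  have := ler_wpM2l (M0 s) d2; rewrite -densE; lra.
rewrite sumrB -mulr_suml -mulr_sumr -Madd /Phi lerD2l lerN2.
by rewrite ler_wpM2l ?mulr_ge0// Dsub.
Qed.

Lemma jump_mass J t :
  del ^+ 2 * (\sum_(j < J) \sum_(s <- desc j.+1 t | ev s) M s) <= 2 * M t.
Proof.
have H : del ^+ 2 * (\sum_(j < J) \sum_(s <- desc j.+1 t | ev s) M s) +
    \sum_(s <- desc J t) Phi s <= Phi t.
  elim: J => [|J ih]; first by rewrite big_ord0 mulr0 add0r big_seq1.
  apply: le_trans ih; rewrite big_ord_recr /= mulrDr -addrA lerD2l.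
  rewrite mulr_sumr [X in X + _]big_mkcond -big_split.
  rewrite -[flatten _]/(desc J.+1 t) big_descS; apply: ler_sum => s _.
  exact: jump_potential_step.
have P0 : 0 <= \sum_(s <- desc J t) Phi s.
  by apply: sumr_ge0 => s _; exact: jump_potential_ge0.
have P2 : Phi t <= 2 * M t.
  have /andP[c0 c1] := cref01 t; rewrite /Phi.
  have := mulr_ge0 c0 (D0 t); have := ler_wpM2l (M0 t) (exprn_ile1 2 c0 c1); lra.
lra.
Qed.

End WeightedTree.

(** * Integrals of bounded Borel functions *)

Section BoundedIntegral.
Context {R : realType} {n : nat}.
Implicit Types (f g : 'rV[R]_n -> R) (S : set 'rV[R]_n).

Definition ind S : 'rV[R]_n -> R := fun x => (x \in S)%:R.
Definition bbm f : Prop := bfun f /\ exists K : R, forall x, `|f x| <= K.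

Lemma ind_in S x : S x -> ind S x = 1.
Proof. by move=> Sx; rewrite /ind mem_set. Qed.

Lemma ind_out S x : ~ S x -> ind S x = 0.
Proof. by move=> Sx; rewrite /ind memNset. Qed.

Lemma ind_ge0 S x : 0 <= ind S x. Proof. by rewrite /ind ler0n. Qed.

Lemma ind_le1 S x : ind S x <= 1. Proof. by rewrite /ind lern1 leq_b1. Qed.

Lemma bbm_ind S : bset S -> bbm (ind S).
Proof.
move=> mS; split; first exact: measurable_indic.
by exists 1 => x; rewrite ger0_norm ?ind_ge0 ?ind_le1.
Qed.

Lemma bbm_cst (c : R) : bbm (fun _ => c).
Proof. by split; [exact: measurable_cst|exists `|c|]. Qed.

Lemma bbmD f g : bbm f -> bbm g -> bbm (fun x => f x + g x).
Proof.
move=> [mf [K Kf]] [mg [K' Kg]]; split; first exact: measurable_funD.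
by exists (K + K') => x; apply: le_trans (ler_normD _ _) _; rewrite lerD.
Qed.

Lemma bbmM f g : bbm f -> bbm g -> bbm (fun x => f x * g x).
Proof.
move=> [mf [K Kf]] [mg [K' Kg]]; split; first exact: measurable_funM.
by exists (K * K') => x; rewrite normrM ler_pM.
Qed.

Lemma bbmZ (c : R) f : bbm f -> bbm (fun x => c * f x).
Proof. by move=> bf; apply: bbmM bf; exact: bbm_cst. Qed.

Lemma bbmX f k : bbm f -> bbm (fun x => f x ^+ k).
Proof.
move=> bf; elim: k => [|k ih]; first exact: bbm_cst.
by rewrite (_ : (fun _ => _) = fun x => f x * f x ^+ k); [exact: bbmM|apply/funext => x; rewrite exprS].
Qed.

Lemma bbm_sum (I : Type) (r : seq I) (F : I -> 'rV[R]_n -> R) :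
  (forall i, bbm (F i)) -> bbm (fun x => \sum_(i <- r) F i x).
Proof.
move=> bF; elim: r => [|i r ih].
  rewrite (_ : (fun _ => _) = fun=> 0); first exact: bbm_cst.
  by apply/funext => x; rewrite big_nil.
rewrite (_ : (fun _ => _) = fun x => F i x + \sum_(j <- r) F j x); first exact: bbmD.
by apply/funext => x; rewrite big_cons.
Qed.

Variables (mu : {measure set (borelRV R n) -> \bar R}) (dom : set 'rV[R]_n).
Hypotheses (mdom : bset dom) (fdom : (mu dom < +oo)%E).

Definition Lf f : R := Rintegral mu (dom : set (borelRV R n)) f.

Lemma bbm_integrable f : bbm f -> mu.-integrable (dom : set (borelRV R n)) (EFin \o f).
Proof.
move=> [mf [K Kf]]; apply: measurable_bounded_integrable => //; first exact: measurable_funTS.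
exists K; split; first exact: num_real.
by move=> K' hK x _ /=; apply: le_trans (ltW hK).
Qed.

Lemma LfD f g : bbm f -> bbm g -> Lf (fun x => f x + g x) = Lf f + Lf g.
Proof. by move=> bf bg; rewrite /Lf RintegralD//; exact: bbm_integrable. Qed.

Lemma LfZ (c : R) f : bbm f -> Lf (fun x => c * f x) = c * Lf f.
Proof. by move=> bf; rewrite /Lf RintegralZl//; exact: bbm_integrable. Qed.

Lemma Lf_le f g : bbm f -> bbm g -> (forall x, dom x -> f x <= g x) -> Lf f <= Lf g.
Proof. by move=> bf bg fg; apply: le_Rintegral => //; exact: bbm_integrable. Qed.

Lemma Lf_ge0 f : (forall x, dom x -> 0 <= f x) -> 0 <= Lf f.
Proof. by move=> f0; apply: Rintegral_ge0. Qed.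

Lemma Lf_eq f g : (forall x, dom x -> f x = g x) -> Lf f = Lf g.
Proof. by move=> fg; apply: eq_Rintegral => x /set_mem; exact: fg. Qed.

Lemma Lf0 : Lf (fun=> 0) = 0.
Proof. by rewrite /Lf Rintegral_cst// mul0r. Qed.

Lemma Lf_sum (I : Type) (r : seq I) (F : I -> 'rV[R]_n -> R) :
  (forall i, bbm (F i)) -> Lf (fun x => \sum_(i <- r) F i x) = \sum_(i <- r) Lf (F i).
Proof.
move=> bF; elim: r => [|i r ih].
  by rewrite big_nil -[RHS]Lf0; apply: Lf_eq => x _; rewrite big_nil.
rewrite big_cons -ih -LfD//; last exact: bbm_sum.
by apply: Lf_eq => x _; rewrite big_cons.
Qed.

Definition msr S : R := Lf (ind S).

Lemma msrE S : bset S -> msr S = fine (mu (S `&` dom)).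
Proof.
move=> mS; rewrite /msr /Lf /Rintegral; congr fine.
rewrite -(integral_indic _ mdom mS); apply: eq_integral => x _; by rewrite indicE.
Qed.

Lemma msr_ge0 S : 0 <= msr S.
Proof. by apply: Lf_ge0 => x _; exact: ind_ge0. Qed.

Lemma msr_le S S' : bset S -> bset S' -> (forall x, dom x -> S x -> S' x) -> msr S <= msr S'.
Proof.
move=> mS mS' SS'; apply: Lf_le; [exact: bbm_ind|exact: bbm_ind|].
move=> x dx; have [Sx|nS] := pselect (S x); last by rewrite (ind_out nS) ind_ge0.
by rewrite !ind_in//; exact: SS'.
Qed.

(** Membership in [r] is expressed through an index, because [I] is a mere type without decidable
    equality. *)
Lemma msr_cover (I : Type) (r : seq I) S (F : I -> set 'rV[R]_n) : bset S ->
  (forall i, bset (F i)) -> (forall x, dom x -> S x -> exists2 j, (j < size r)%N & exists i0, F (nth i0 r j) x) ->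
  msr S <= \sum_(i <- r) msr (F i).
Proof.
move=> mS mF cov; rewrite -Lf_sum; last by move=> i; exact: bbm_ind.
apply: Lf_le; [exact: bbm_ind|by apply: bbm_sum => i; exact: bbm_ind|].
move=> x dx; have [Sx|nS] := pselect (S x); last first.
  by rewrite (ind_out nS); apply: sumr_ge0 => i _; exact: ind_ge0.
rewrite ind_in//; have [j jr [i0 Fx]] := cov _ dx Sx.
rewrite (big_nth i0) big_mkord (bigD1 (Ordinal jr))//= (ind_in Fx) lerDl.
by apply: sumr_ge0 => i _; exact: ind_ge0.
Qed.

End BoundedIntegral.

(** * Dyadic cubes and admissible pairs *)

Section FiniteIntersections.
Context {R : realType} {n : nat}.

Lemma bigsetI_seqP (I : eqType) (r : seq I) (F : I -> set 'rV[R]_n) x :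
  (\big[setI/setT]_(i <- r) F i) x <-> (forall i, i \in r -> F i x).
Proof.
elim: r => [|i r ih]; first by rewrite big_nil.
rewrite big_cons; split => [[Fi /ih Fr] j|H]; first by rewrite inE => /predU1P[->//|/Fr].
by split; [apply: H; rewrite mem_head|apply/ih => j jr; apply: H; rewrite inE jr orbT].
Qed.

Lemma forall_bigsetI (I : finType) (F : I -> set 'rV[R]_n) :
  [set x | forall i, F i x] = \big[setI/setT]_(i <- enum I) F i.
Proof.
apply/seteqP; split => x; first by move=> H; apply/bigsetI_seqP => i _; exact: H.
by move=> /bigsetI_seqP H i; apply: H; rewrite mem_enum.
Qed.

Lemma bset_forall (I : finType) (F : I -> set 'rV[R]_n) :
  (forall i, bset (F i)) -> bset [set x | forall i, F i x].
Proof.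
move=> mF; rewrite forall_bigsetI; elim/big_ind: _ => //; first exact: measurableT.
by move=> A B; exact: measurableI.
Qed.

Lemma open_forall (I : finType) (F : I -> set 'rV[R]_n) :
  (forall i, open (F i)) -> open [set x | forall i, F i x].
Proof.
move=> oF; rewrite forall_bigsetI; elim/big_ind: _ => //; first exact: openT.
by move=> A B; exact: openI.
Qed.

End FiniteIntersections.

Section Cubes.
Context {R : realType} {n : nat}.
Variables (o : 'rV[R]_n) (T : R) (sh : R).
Hypothesis T0 : 0 < T.
Implicit Types (x y : 'rV[R]_n).

Definition node := (nat * {ffun 'I_n -> nat})%type.
Implicit Types (p s : node).

(* Normalised so that the root cube is [0 <= gcoord < 1] in every coordinate. *)
Definition gcoord x (i : 'I_n) : R := (x ord0 i - o ord0 i) / T + 2^-1 - sh.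
Definition side (j : nat) : R := T / 2 ^+ j.
Definition cube p : set 'rV[R]_n :=
  [set x | forall i, (p.2 i)%:R <= 2 ^+ p.1 * gcoord x i < (p.2 i)%:R + 1].
Definition icube p : set 'rV[R]_n :=
  [set x | forall i, (p.2 i)%:R < 2 ^+ p.1 * gcoord x i < (p.2 i)%:R + 1].
Definition subnode p (c : {ffun 'I_n -> bool}) : node :=
  (p.1.+1, [ffun i => ((p.2 i).*2 + c i)%N]).
Definition subnodes p : seq node := [seq subnode p c | c <- enum {ffun 'I_n -> bool}].
Definition root : node := (0, [ffun=> 0%N]).
(* Meaningful only where [gcoord >= 0], since [Num.truncn] is [0] on negative numbers. *)
Definition cell (j : nat) x : node := (j, [ffun i => Num.truncn (2 ^+ j * gcoord x i)]).

Lemma side_gt0 j : 0 < side j. Proof. by rewrite divr_gt0// exprn_gt0. Qed.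

Lemma sideS j : side j.+1 = side j / 2.
Proof. by rewrite /side exprS invfM mulrA mulrAC. Qed.

Lemma icube_cube p x : icube p x -> cube p x.
Proof. by move=> H i; have /andP[h1 h2] := H i; rewrite (ltW h1). Qed.

Lemma subnode_cube p c x : cube (subnode p c) x -> cube p x.
Proof.
move=> H i; have := H i; rewrite /= ffunE exprS natrD -muln2 natrM.
by case: (c i) => /= /andP[h1 h2]; apply/andP; split; lra.
Qed.

Lemma subnode_icube p c x : icube (subnode p c) x -> icube p x.
Proof.
move=> H i; have := H i; rewrite /= ffunE exprS natrD -muln2 natrM.
by case: (c i) => /= /andP[h1 h2]; apply/andP; split; lra.
Qed.

Lemma cube_cell p x : cube p x -> p = cell p.1 x.
Proof.
case: p => j z H; congr pair; apply/ffunP => i; rewrite ffunE; apply/esym.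
by apply: Num.Theory.truncn_def; move: (H i); rewrite /= natr1.
Qed.

Lemma cell_cube j x : (forall i, 0 <= gcoord x i) -> cube (cell j x) x.
Proof.
move=> H i; rewrite /= ffunE natr1 truncn_itv// mulr_ge0// exprn_ge0//.
Qed.

Lemma cube_ge0 p x i : cube p x -> 0 <= gcoord x i.
Proof.
move=> H; have /andP[h _] := H i.
have : 0 <= 2 ^+ p.1 * gcoord x i by apply: le_trans h; rewrite ler0n.
by rewrite pmulr_rge0// exprn_gt0.
Qed.

(** Half-open cubes make the children an exact partition. Stated for indicators, this yields
    additivity of every integral by linearity. *)
Lemma ind_subnodes p x : \sum_(s <- subnodes p) ind (cube s) x = ind (cube p) x.
Proof.
rewrite big_map big_enum /=.
have [px|npx] := pselect (cube p x); last first.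
  rewrite (ind_out npx) big1// => c _; rewrite ind_out// => sx; apply: npx; exact: subnode_cube sx.
pose c0 := [ffun i => (p.2 i)%:R * 2 + 1 <= 2 ^+ p.1.+1 * gcoord x i].
have c0x : cube (subnode p c0) x.
  move=> i; have := px i; rewrite /= !ffunE exprS natrD -muln2 natrM => /andP[h1 h2].
  case: (leP ((p.2 i)%:R * 2 + 1) (2 * 2 ^+ p.1 * gcoord x i)) => /= h3; apply/andP; split; lra.
rewrite (bigD1 c0)//= (ind_in c0x) (ind_in px) big1 ?addr0// => c cc0.
rewrite ind_out// => cx; move/eqP: cc0; apply; apply/ffunP => i.
have /ffunP/(_ i) := congr1 snd (etrans (cube_cell c0x) (esym (cube_cell cx))).
by rewrite !ffunE /= => /addnI; case: (c i); case: leP.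
Qed.

Lemma ind_desc N p x : \sum_(s <- desc subnodes N p) ind (cube s) x = ind (cube p) x.
Proof.
elim: N => [|N ih]; first by rewrite big_seq1.
by rewrite big_descS -ih; apply: eq_bigr => s _; exact: ind_subnodes.
Qed.

Lemma mem_descS N p s : (s \in desc subnodes N.+1 p) =
  has (fun s' => s \in subnodes s') (desc subnodes N p).
Proof. by apply/flatten_mapP/hasP => -[s' h1 h2]; exists s'. Qed.

Lemma desc_ind N p (P : node -> Prop) : P p -> (forall s c, P s -> P (subnode s c)) ->
  {in desc subnodes N p, forall s, P s}.
Proof.
move=> Pp Pc; elim: N => [|N ih] s; first by rewrite inE => /eqP ->.
by rewrite mem_descS => /hasP[s' s'd /mapP[c _ ->]]; apply: Pc; exact: ih.
Qed.

Lemma desc_level N p s : s \in desc subnodes N p -> s.1 = (p.1 + N)%N.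
Proof.
elim: N s => [|N ih] s; first by rewrite inE => /eqP ->; rewrite addn0.
by rewrite mem_descS => /hasP[s' /ih s'd /mapP[c _ ->]]; rewrite /= s'd addnS.
Qed.

Lemma desc_cube N p s x : s \in desc subnodes N p -> cube s x -> cube p x.
Proof. by apply: (@desc_ind N p (fun s => cube s x -> cube p x)) => // s' c h /subnode_cube. Qed.

Lemma desc_icube N p s x : s \in desc subnodes N p -> icube s x -> icube p x.
Proof. by apply: (@desc_ind N p (fun s => icube s x -> icube p x)) => // s' c h /subnode_icube. Qed.

Lemma mem_desc N p x : cube p x -> cell (p.1 + N) x \in desc subnodes N p.
Proof.
move=> px; have : 0 < \sum_(s <- desc subnodes N p) ind (cube s) x.
  by rewrite ind_desc ind_in.
apply: contraLR => nc; rewrite -leNgt big_seq big1// => s sd.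
rewrite ind_out// => sx; move/negP: nc; apply.
by rewrite -(desc_level sd) -(cube_cell sx).
Qed.

(** Turns a function defined cell by cell into a finite sum, from which its measurability and its
    integral can be read off. *)
Lemma big_desc_cell N p x (F : node -> R) : cube p x ->
  \sum_(s <- desc subnodes N p) F s * ind (cube s) x = F (cell (p.1 + N) x).
Proof.
move=> px; rewrite (eq_big_seq (fun s => F (cell (p.1 + N) x) * ind (cube s) x)); last first.
  move=> s sd; have [sx|nsx] := pselect (cube s x); last by rewrite ind_out// !mulr0.
  by rewrite -(desc_level sd) -(cube_cell sx).
by rewrite -mulr_sumr ind_desc ind_in// mulr1.
Qed.

Lemma big_desc_out N p x (F : node -> R) : ~ cube p x ->
  \sum_(s <- desc subnodes N p) F s * ind (cube s) x = 0.
Proof.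
move=> px; rewrite big_seq big1// => s sd; rewrite ind_out ?mulr0// => sx.
by apply: px; exact: desc_cube sd sx.
Qed.

Lemma gcoord_lip x y i : gcoord x i - gcoord y i <= T^-1 * eucl_dist x y.
Proof.
have -> : gcoord x i - gcoord y i = T^-1 * (x ord0 i - y ord0 i) by rewrite /gcoord; ring.
rewrite ler_pM2l ?invr_gt0// eucl_distE; apply: le_trans (coord_le_enorm _ i).
by rewrite !mxE ler_norm.
Qed.

Lemma gcoord_continuous i : continuous (gcoord^~ i).
Proof. by apply: (@lip_continuous _ _ _ T^-1) => x y; exact: gcoord_lip. Qed.

Lemma bset_gcoord_ge (c : R) i : bset [set x | c <= gcoord x i].
Proof.
apply: closed_bset; apply: (@closed_comp _ _ (gcoord^~ i) [set t | c <= t]).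
  by move=> x _; exact: gcoord_continuous.
exact: closed_ge.
Qed.

Lemma open_gcoord_gt (c : R) i : open [set x | c < gcoord x i].
Proof.
by apply: (@open_comp _ _ (gcoord^~ i) [set t | c < t]);
  [move=> x _; exact: gcoord_continuous|exact: open_gt].
Qed.

Lemma open_gcoord_lt (c : R) i : open [set x | gcoord x i < c].
Proof.
by apply: (@open_comp _ _ (gcoord^~ i) [set t | t < c]);
  [move=> x _; exact: gcoord_continuous|exact: open_lt].
Qed.

Lemma pow2_gt0 (j : nat) : 0 < 2 ^+ j :> R. Proof. exact: exprn_gt0. Qed.

Lemma bset_cube p : bset (cube p).
Proof.
have -> : cube p = [set x | forall i, ([set x | (p.2 i)%:R / 2 ^+ p.1 <= gcoord x i] `&`
    ~` [set x | ((p.2 i)%:R + 1) / 2 ^+ p.1 <= gcoord x i]) x].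
  apply/seteqP; split => x /= H i; have := H i; rewrite /= !ler_pdivrMr ?pow2_gt0// mulrC.
    by move=> /andP[-> h]; split => //; apply/negP; rewrite -ltNge.
  by move=> [-> /negP]; rewrite -ltNge.
apply: bset_forall => i; apply: measurableI; first exact: bset_gcoord_ge.
by apply: measurableC; exact: bset_gcoord_ge.
Qed.

Lemma open_icube p : open (icube p).
Proof.
have -> : icube p = [set x | forall i, ([set x | (p.2 i)%:R / 2 ^+ p.1 < gcoord x i] `&`
    [set x | gcoord x i < ((p.2 i)%:R + 1) / 2 ^+ p.1]) x].
  apply/seteqP; split => x /= H i; have := H i.
    by rewrite /= ltr_pdivrMr ?ltr_pdivlMr ?pow2_gt0// mulrC => /andP.
  by rewrite /= ltr_pdivrMr ?ltr_pdivlMr ?pow2_gt0// mulrC => -[-> ->].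
apply: open_forall => i; apply: openI; [exact: open_gcoord_gt|exact: open_gcoord_lt].
Qed.

Lemma icube_ball p x : icube p x -> exists2 r : R, 0 < r & forall y, eucl_dist y x < r -> icube p y.
Proof.
move=> px; have /nbhs_ballP[e /= e0 eU] : nbhs x (icube p).
  by apply: open_nbhs_nbhs; split => //; exact: open_icube.
exists e => // y yx; apply: eU; split => // i j; rewrite ord1.
apply: le_lt_trans yx; rewrite eucl_distC eucl_distE.
by apply: le_trans (coord_le_enorm _ j); rewrite !mxE.
Qed.

Lemma cube_diam p x y : cube p x -> cube p y -> eucl_dist x y <= n%:R * side p.1.
Proof.
move=> px py; rewrite eucl_distE; apply: enorm_le_sup => i; rewrite !mxE.
have /andP[h1 h2] := px i; have /andP[h3 h4] := py i.
have E : 2 ^+ p.1 * gcoord x i - 2 ^+ p.1 * gcoord y i = (x ord0 i - y ord0 i) / side p.1.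
  by rewrite /gcoord /side; field; rewrite ?expf_neq0 ?gt_eqF.
rewrite -(mulfK (_ : side p.1 != 0) (x ord0 i - y ord0 i)) ?gt_eqF ?side_gt0//.
rewrite mulrAC -E normrM (gtr0_norm (side_gt0 _)) ler_piMl ?(ltW (side_gt0 _))//.
by rewrite ler_norml; apply/andP; split; lra.
Qed.

Definition lin (e : 'rV[R]_n) : 'rV[R]_n -> R := fun x => dotp e x.

Lemma lin_lip e x y : enorm e <= 1 / 3 -> lin e x - lin e y <= 3^-1 * eucl_dist x y.
Proof.
move=> e3; rewrite /lin -dotpBr; apply: le_trans (dotp_le _ _) _.
by rewrite eucl_distE ler_wpM2r ?enorm_ge0//; lra.
Qed.

Lemma lin_one_lip e : enorm e <= 1 / 3 -> one_lip (lin e).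
Proof.
move=> e3 x y; apply: le_trans (lin_lip x y e3) _.
by rewrite ler_piMl ?eucl_dist_ge0//; lra.
Qed.

(* A competitor for the boundary data [lin e] on the cube [p] with an upper bound of its slope. *)
Definition admissible (e : 'rV[R]_n) p (vr : ('rV[R]_n -> R) * ('rV[R]_n -> R)) : Prop :=
  [/\ one_lip vr.1, bfun vr.2, (forall x, 0 <= vr.2 x <= 1),
      (forall x, ~ icube p x -> vr.1 x = lin e x /\ vr.2 x = 1) &
      (forall x, lip_at vr.1 (vr.2 x) x)].

Lemma admissible_lin e p : enorm e <= 1 / 3 -> admissible e p (lin e, fun=> 1).
Proof.
move=> e3; split => //=.
- exact: lin_one_lip.
- exact: measurable_cst.
- by move=> x; rewrite ler01 lexx.
- by move=> x; apply: one_lip_at; exact: lin_one_lip.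
Qed.

Hypothesis n0 : (0 < n)%N.

(** Moving by one side length along a coordinate axis leaves the cube. At the new point the
    competitor equals [lin e], and both functions are [1]-Lipschitz. *)
Lemma admissible_near e p vr x : enorm e <= 1 / 3 -> admissible e p vr ->
  `|vr.1 x - lin e x| <= 2 * side p.1.
Proof.
move=> e3 [vL _ _ vout _].
have [px|npx] := pselect (icube p x); last first.
  by rewrite (vout x npx).1 subrr normr0 mulr_ge0// ltW// side_gt0.
pose i0 := Ordinal n0; pose y := x + side p.1 *: delta_mx ord0 i0 : 'rV[R]_n.
have yi : gcoord y i0 = gcoord x i0 + (2 ^+ p.1)^-1.
  rewrite /gcoord /y !mxE !eqxx mulr1 /side; by field; rewrite ?expf_neq0 ?gt_eqF.
have ny : ~ icube p y.
  move=> /(_ i0); rewrite yi mulrDr divff ?expf_neq0// => /andP[_].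
  by have /andP[h _] := px i0; move=> h'; move: h h'; lra.
have xy : eucl_dist x y = side p.1.
  rewrite eucl_distE opprD addNKr enormN enormZ gtr0_norm ?side_gt0//.
  rewrite /enorm /dotp (bigD1 i0)//= big1 ?addr0; last first.
    by move=> i ii0; rewrite mxE eqxx (negPf ii0) mul0r.
  by rewrite mxE !eqxx mul1r sqrtr1 mulr1.
have -> : vr.1 x - lin e x = (vr.1 x - vr.1 y) + (lin e y - lin e x).
  by rewrite (vout y ny).1; ring.
apply: le_trans (ler_normD _ _) _.
have := one_lip_abs x y vL; have := one_lip_abs y x (lin_one_lip e3).
rewrite (eucl_distC y x) xy; lra.
Qed.

(** The segment between the two points crosses a grid hyperplane that separates the cubes. At the
    crossing point [q] the competitors of both cubes equal [lin e], so the Lipschitz bounds on the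
    two halves add up without loss; this makes the gluing [1]-Lipschitz. *)
Lemma segment_out j (z z' : {ffun 'I_n -> nat}) x y : z != z' -> icube (j, z) x -> icube (j, z') y ->
  exists q, [/\ ~ icube (j, z) q, ~ icube (j, z') q & eucl_dist x q + eucl_dist q y = eucl_dist x y].
Proof.
wlog [i zi] : z z' x y / exists i, (z i < z' i)%N.
  move=> W zz' xz yz'.
  have [i zi] : exists i, z i != z' i.
    apply/existsP; move: zz'; apply: contraNT; rewrite negb_exists => /forallP H.
    by apply/eqP/ffunP => i; have := H i; rewrite negbK => /eqP.
  have [lt|gt] := ltnP (z i) (z' i); first by apply: (W z z' x y) => //; exists i.
  have [||||q [q1 q2 q3]] := W z' z y x; rewrite 1?eq_sym//.
    by exists i; rewrite ltn_neqAle eq_sym zi.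
  by exists q; split => //; rewrite addrC (eucl_distC q) (eucl_distC x) q3 eucl_distC.
move=> zz' xz yz'.
have /andP[x1 x2] := xz i; have /andP[y1 y2] := yz' i; rewrite /= in x1 x2 y1 y2.
have zz : (z i)%:R + 1 <= (z' i)%:R :> R by rewrite natr1 ler_nat.
set a := 2 ^+ j * gcoord x i in x1 x2; set b := 2 ^+ j * gcoord y i in y1 y2.
pose l := ((z' i)%:R - a) / (b - a).
have ba : 0 < b - a by lra.
have l0 : 0 <= l by rewrite divr_ge0//; lra.
have l1 : l <= 1 by rewrite ler_pdivrMr//; lra.
pose q := x + l *: (y - x).
have qi : 2 ^+ j * gcoord q i = (z' i)%:R.
  have -> : 2 ^+ j * gcoord q i = a + l * (b - a).
    by rewrite /a /b /gcoord /q !mxE; ring.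
  by rewrite /l divfK ?gt_eqF//; ring.
exists q; split.
- by move=> /(_ i)/=; rewrite qi => /andP[_]; lra.
- by move=> /(_ i)/=; rewrite qi ltxx.
rewrite !eucl_distE.
have -> : x - q = - (l *: (y - x)) by rewrite /q opprD addNKr.
have -> : q - y = - ((1 - l) *: (y - x)).
  by apply/rowP => i'; rewrite !mxE; ring.
rewrite !enormN !enormZ (ger0_norm l0) ger0_norm ?subr_ge0//.
by rewrite -mulrDl subrKC mul1r enormB.
Qed.

End Cubes.

(** * Minimal energies *)

(* What the argument uses of [(X, mu)] at scales up to [srm].  Quantifying over such records allows
   all constants to be chosen before the space. *)
Record space {R : realType} {n : nat} (d : nat) (A lam : R) (osc : R -> R) := Space {
  sX : set 'rV[R]_n;
  smu : {measure set (borelRV R n) -> \bar R};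
  srm : R;
  s_closed : closed sX;
  s_fin : forall x r, (smu (ball_in sX x r) < +oo)%E;
  s_lo : forall x r, sX x -> 0 < r -> r <= srm -> A^-1 * r ^+ d <= fine (smu (ball_in sX x r));
  s_up : forall x r, sX x -> 0 < r -> r <= srm -> fine (smu (ball_in sX x r)) <= A * r ^+ d;
  s_osc : forall v rho (k : R) x r, one_lip v -> bfun rho ->
    (forall x, 0 <= rho x <= 1) -> (forall x, sX x -> lip_at v (rho x) x) ->
    0 < k <= 1 -> sX x -> 0 < r -> lam * r <= srm ->
    Rintegral smu (ball_in sX x (lam * r) : set (borelRV R n)) (fun y => rho y ^+ d) <= osc k * r ^+ d ->
    forall y, sX y -> eucl_dist x y <= r / 2 -> `|v y - v x| <= k * r }.

Section Energy.
Context {R : realType} {n d : nat} {A lam : R} {osc : R -> R}.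
Variables (S : @space R n d A lam osc) (o : 'rV[R]_n) (T sh : R).
Hypotheses (T0 : 0 < T) (n0 : (0 < n)%N).
Implicit Types (x y : 'rV[R]_n) (p s : node (n := n)) (e : 'rV[R]_n)
  (vr : ('rV[R]_n -> R) * ('rV[R]_n -> R)).

Local Notation X := (sX S).
(** All integrals are taken over this single set of finite mass, so every bounded Borel function is
    integrable. *)
Definition sdom : set 'rV[R]_n := ball_in X o (srm S).
Definition sL : ('rV[R]_n -> R) -> R := Lf (smu S) sdom.
Definition sm : set 'rV[R]_n -> R := msr (smu S) sdom.
Local Notation cube := (cube o T sh).
Local Notation icube := (icube o T sh).
Local Notation cell := (cell o T sh).
Local Notation adm := (admissible o T sh).
Local Notation side := (side T).

Lemma bset_sdom : bset sdom.
Proof. by apply: measurableI; [apply: closed_bset; exact: s_closed|exact: bset_cball]. Qed.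

Lemma fin_sdom : (smu S sdom < +oo)%E. Proof. exact: s_fin. Qed.

Hint Resolve bset_sdom fin_sdom : core.

Lemma bbm_rho e p vr : adm e p vr -> bbm vr.2.
Proof.
move=> [_ mr r01 _ _]; split => //; exists 1 => x; have /andP[h1 h2] := r01 x.
by rewrite ger0_norm.
Qed.

Definition dens_on vr (Q : set 'rV[R]_n) : 'rV[R]_n -> R := fun x => vr.2 x ^+ d * ind Q x.
Definition energy_on vr (Q : set 'rV[R]_n) : R := sL (dens_on vr Q).

Lemma bbm_dens e p vr Q : adm e p vr -> bset Q -> bbm (dens_on vr Q).
Proof. by move=> a mQ; apply: bbmM; [apply: bbmX; exact: bbm_rho a|exact: bbm_ind]. Qed.

Lemma dens_on_ge0 e p vr Q x : adm e p vr -> 0 <= dens_on vr Q x.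
Proof.
by move=> [_ _ r01 _ _]; rewrite mulr_ge0 ?ind_ge0// exprn_ge0//; case/andP: (r01 x).
Qed.

Lemma dens_on_le e p vr Q x : adm e p vr -> dens_on vr Q x <= ind Q x.
Proof.
move=> [_ _ r01 _ _]; rewrite ler_piMl ?ind_ge0//; have /andP[h1 h2] := r01 x.
exact: exprn_ile1.
Qed.

Lemma energy_on_ge0 e p vr Q : adm e p vr -> 0 <= energy_on vr Q.
Proof. by move=> a; apply: Lf_ge0 => // x _; exact: dens_on_ge0 a. Qed.

Lemma energy_on_le e p vr Q : adm e p vr -> bset Q -> energy_on vr Q <= sm Q.
Proof.
move=> a mQ; apply: Lf_le => //; [exact: bbm_dens a mQ|exact: bbm_ind|].
by move=> x _; exact: dens_on_le a.
Qed.

Definition glue e p N (V : node -> ('rV[R]_n -> R) * ('rV[R]_n -> R)) :=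
  (fun x => if x \in cube p then (V (cell (p.1 + N) x)).1 x else lin e x,
   fun x => if x \in cube p then (V (cell (p.1 + N) x)).2 x else 1).

Section Glue.
Variables (e : 'rV[R]_n) (p : node (n := n)) (N : nat).
Variable V : node (n := n) -> ('rV[R]_n -> R) * ('rV[R]_n -> R).
Hypotheses (e3 : enorm e <= 1 / 3) (aV : forall s, adm e s (V s)).
Let G := glue e p N V.

Lemma glue_in x s : s \in desc subnodes N p -> cube s x -> G.1 x = (V s).1 x /\ G.2 x = (V s).2 x.
Proof.
move=> sd sx; have px := desc_cube sd sx.
by rewrite /G /= mem_set// (cube_cell sx) (desc_level sd).
Qed.

Lemma glue_out x : ~ (exists2 s, s \in desc subnodes N p & icube s x) -> G.1 x = lin e x /\ G.2 x = 1.
Proof.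
move=> H; rewrite /G /=; case: ifPn => // /set_mem px.
have [_ _ _ out _] := aV (cell (p.1 + N) x).
by apply: out => ix; apply: H; exists (cell (p.1 + N) x) => //; exact: mem_desc.
Qed.

Lemma glue_lip : one_lip G.1.
Proof.
move=> x y.
  have [[s sd sx]|xout] := pselect (exists2 s, s \in desc subnodes N p & icube s x); last first.
    have [-> _] := glue_out xout.
    have [[s sd sy]|yout] := pselect (exists2 s, s \in desc subnodes N p & icube s y).
      have [-> _] := glue_in sd (icube_cube sy).
      have [vL _ _ out _] := aV s.
      have nsx : ~ icube s x by move=> sx; apply: xout; exists s.
      by rewrite -(out x nsx).1; exact: vL.
    by have [-> _] := glue_out yout; exact: lin_one_lip.
  have [-> _] := glue_in sd (icube_cube sx); have [vL _ _ out _] := aV s.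
  have [sy|nsy] := pselect (icube s y).
    by have [-> _] := glue_in sd (icube_cube sy); exact: vL.
  have [[s' s'd s'y]|yout] := pselect (exists2 s, s \in desc subnodes N p & icube s y); last first.
    by have [-> _] := glue_out yout; rewrite -(out y nsy).1; exact: vL.
  have [-> _] := glue_in s'd (icube_cube s'y); have [vL' _ _ out' _] := aV s'.
  have lv : s.1 = s'.1 by rewrite (desc_level sd) (desc_level s'd).
  have s'y' : icube (s.1, s'.2) y by rewrite lv.
  have zz' : s.2 != s'.2.
    apply/eqP => zz; apply: nsy; move: s'y'; by rewrite -zz.
  have sx' : icube (s.1, s.2) x := sx.
  have [q [q1 q2 <-]] := segment_out zz' sx' s'y'.
  have q2' : ~ icube s' q by move: q2; rewrite lv.
  have h1 := vL x q; have h2 := vL' q y.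
  by rewrite (out q q1).1 in h1; rewrite (out' q q2').1 in h2; lra.
Qed.

(** Where cells meet, the only slope bound for the glued function is its Lipschitz constant. This is
    why admissible pairs carry the bound [1] off the open cube. *)
Lemma glue_adm : adm e p G.
Proof.
split; first exact: glue_lip.
- have -> : G.2 = fun x => \sum_(s <- desc subnodes N p) (V s).2 x * ind (cube s) x + (1 + -1 * ind (cube p) x).
    apply/funext => x; rewrite /G/=; have [px|npx] := pselect (cube p x).
      by rewrite mem_set// (ind_in px) (big_desc_cell N (fun s => (V s).2 x) px); ring.
    by rewrite memNset// (ind_out npx) (big_desc_out N (fun s => (V s).2 x) npx); ring.
  suff [] : bbm (fun x => \sum_(s <- desc subnodes N p) (V s).2 x * ind (cube s) x +
     (1 + -1 * ind (cube p) x)) by [].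
  apply: bbmD.
    apply: bbm_sum => s; apply: bbmM; first exact: bbm_rho (aV s).
    by apply: bbm_ind; exact: bset_cube.
  by apply: bbmD; [exact: bbm_cst|apply: bbmZ; apply: bbm_ind; exact: bset_cube].
- move=> x; rewrite /G/=; case: ifP => _; last by rewrite ler01 lexx.
  by have [_ _ r01 _ _] := aV (cell (p.1 + N) x); exact: r01.
- move=> x npx; apply: glue_out => -[s sd sx]; apply: npx; exact: desc_icube sd sx.
- move=> x.
  have [[s sd sx]|xout] := pselect (exists2 s, s \in desc subnodes N p & icube s x).
    have [_ ->] := glue_in sd (icube_cube sx).
    have [r r0 rs] := icube_ball T0 sx.
    have [_ _ _ _ vl] := aV s.
    apply: lip_at_near r0 _ (vl x) => y /rs sy.
    by have [-> _] := glue_in sd (icube_cube sy).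
  by have [_ ->] := glue_out xout; exact: one_lip_at glue_lip.
Qed.

Lemma glue_energy : energy_on G (cube p) = \sum_(s <- desc subnodes N p) energy_on (V s) (cube s).
Proof.
rewrite /energy_on /sL -Lf_sum//; last first.
  by move=> s; apply: bbm_dens (aV s) _; exact: bset_cube.
apply: Lf_eq => x _; rewrite /dens_on.
rewrite (_ : \sum_(s <- _) _ = \sum_(s <- desc subnodes N p) (V s).2 x ^+ d * ind (cube s) x)//.
have [px|npx] := pselect (cube p x).
  by rewrite (ind_in px) mulr1 (big_desc_cell N (fun s => (V s).2 x ^+ d) px) /G/= mem_set.
by rewrite (ind_out npx) mulr0 (big_desc_out N (fun s => (V s).2 x ^+ d) npx).
Qed.

Lemma glue_near x : `|G.1 x - lin e x| <= 2 * side (p.1 + N).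
Proof.
rewrite /G/=; case: ifP => _; last by rewrite subrr normr0 mulr_ge0// ltW// side_gt0.
exact: admissible_near (aV (cell (p.1 + N) x)).
Qed.

End Glue.

Definition emin e p : R := inf [set energy_on vr (cube p) | vr in adm e p].
Definition cmass p : R := sm (cube p).

Section Emin.
Variable e : 'rV[R]_n.
Hypothesis e3 : enorm e <= 1 / 3.

Lemma emin_ge0 p : 0 <= emin e p.
Proof.
apply: lb_le_inf; first by exists (energy_on (lin e, fun=> 1) (cube p)), (lin e, fun=> 1) => //; exact: admissible_lin.
by move=> _ [vr a <-]; exact: energy_on_ge0 a.
Qed.

Lemma emin_le p vr : adm e p vr -> emin e p <= energy_on vr (cube p).
Proof.
by move=> a; apply: ge_inf; [exists 0 => _ [vr' a' <-]; exact: energy_on_ge0 a'|exists vr].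
Qed.

Lemma emin_le_mass p : emin e p <= cmass p.
Proof.
have a := admissible_lin o T sh p e3.
by apply: le_trans (emin_le a) _; apply: energy_on_le a _; exact: bset_cube.
Qed.

Lemma emin_adherent p (eps : R) : 0 < eps -> exists2 vr, adm e p vr & energy_on vr (cube p) < emin e p + eps.
Proof.
move=> eps0; have [|_ [vr a <-] h] := @inf_adherent _ [set energy_on vr (cube p) | vr in adm e p] _ eps0.
  split; last by exists 0 => _ [vr' a' <-]; exact: energy_on_ge0 a'.
  by exists (energy_on (lin e, fun=> 1) (cube p)), (lin e, fun=> 1) => //; exact: admissible_lin.
by exists vr.
Qed.

Lemma cmass_ge0 p : 0 <= cmass p. Proof. exact: msr_ge0. Qed.

Lemma cmass_sub p : cmass p = \sum_(s <- subnodes p) cmass s.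
Proof.
rewrite /cmass /sm /msr -Lf_sum//; last by move=> s; apply: bbm_ind; exact: bset_cube.
by apply: Lf_eq => x _; rewrite ind_subnodes.
Qed.

(* Minimising on the subcubes and gluing is a competitor on the whole cube. *)
Lemma near_minimizer (eps : R) : 0 < eps -> exists V, (forall s, adm e s (V s)) /\
  (forall s, energy_on (V s) (cube s) < emin e s + eps).
Proof.
move=> eps0; have H s : exists vr, adm e s vr /\ energy_on vr (cube s) < emin e s + eps.
  by have [vr a h] := emin_adherent s eps0; exists vr.
have [V HV] := choice H; exists V; split => s; by have [] := HV s.
Qed.

Lemma emin_desc p N : emin e p <= \sum_(s <- desc subnodes N p) emin e s.
Proof.
apply/ler_addgt0Pr => eps eps0.
pose K := (size (desc subnodes N p)).+1.
have K0 : 0 < K%:R :> R by rewrite ltr0n.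
have [V [aV hV]] := @near_minimizer (eps / K%:R) (divr_gt0 eps0 K0).
apply: le_trans (emin_le (glue_adm p N e3 aV)) _.
rewrite (glue_energy p N aV).
apply: (@le_trans _ _ (\sum_(s <- desc subnodes N p) (emin e s + eps / K%:R))).
  by apply: ler_sum => s _; exact: ltW.
rewrite big_split lerD2l/= big_const_seq count_predT iter_addr_0.
rewrite -[leLHS]mulr_natr mulrAC ler_pdivrMr//.
by apply: ler_wpM2l; [exact: ltW|rewrite ler_nat].
Qed.

Lemma emin_sub p : emin e p <= \sum_(s <- subnodes p) emin e s.
Proof.
apply: le_trans (emin_desc p 1) _.
by rewrite big_descS big_seq1.
Qed.

End Emin.
End Energy.

(** * Consequences of almost constant density *)

Section Goodness.
Context {R : realType} {n d : nat} {A lam : R} {osc : R -> R}.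
Variables (S : @space R n d A lam osc) (o : 'rV[R]_n).
Hypotheses (A1 : 1 <= A) (lam1 : 1 <= lam).
Implicit Types (x y : 'rV[R]_n).

Local Notation X := (sX S).
Local Notation m := (sm S o).

Lemma sm_ball x r : eucl_dist o x <= srm S / 2 -> r <= srm S / 2 ->
  m (cball x r) = fine (smu S (ball_in X x r)).
Proof.
move=> ox rs; rewrite /sm msrE; [|exact: bset_sdom|exact: bset_cball].
congr (fine (smu S _)); apply/seteqP; split => y; first by move=> [xy [Xy _]].
move=> [Xy xy]; split => //; split => //.
have xy' : eucl_dist x y <= r := xy.
by rewrite /cball/=; apply: le_trans (eucl_dist_tri x _ _) _; lra.
Qed.

Lemma sm_ball_ge x r : X x -> eucl_dist o x <= srm S / 2 -> 0 < r -> r <= srm S / 2 ->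
  A^-1 * r ^+ d <= m (cball x r).
Proof. by move=> Xx ox r0 rs; rewrite sm_ball//; apply: s_lo => //; lra. Qed.

Lemma sm_ball_le x r : X x -> eucl_dist o x <= srm S / 2 -> 0 < r -> r <= srm S / 2 ->
  m (cball x r) <= A * r ^+ d.
Proof. by move=> Xx ox r0 rs; rewrite sm_ball//; apply: s_up => //; lra. Qed.

Lemma sm_le (P Q : set 'rV[R]_n) : bset P -> bset Q -> (forall x, X x -> P x -> Q x) -> m P <= m Q.
Proof.
by move=> mP mQ PQ; apply: msr_le => //; [exact: bset_sdom|exact: fin_sdom|move=> x [Xx _]; exact: PQ].
Qed.

Lemma sm_ge0 (P : set 'rV[R]_n) : 0 <= m P.
Proof. exact: msr_ge0. Qed.

Lemma zone_osc v rho (k : R) x r : one_lip v -> bfun rho ->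
    (forall x, 0 <= rho x <= 1) -> (forall x, lip_at v (rho x) x) ->
    0 < k <= 1 -> X x -> eucl_dist o x <= srm S / 2 -> 0 < r -> lam * r <= srm S / 2 ->
    sL S o (fun y => rho y ^+ d * ind (cball x (lam * r)) y) <= osc k * r ^+ d ->
    forall y, X y -> eucl_dist x y <= r / 2 -> `|v y - v x| <= k * r.
Proof.
move=> vL mr r01 vr k01 Xx ox r0 lr H; have lr0 : 0 < lam * r by rewrite mulr_gt0// (lt_le_trans ltr01 lam1).
apply: (s_osc (s := S) vL mr r01) => //; first by lra.
apply: le_trans H; rewrite le_eqVlt; apply/orP; left; apply/eqP.
rewrite /sL /Lf (_ : ball_in X x (lam * r) = sdom S o `&` cball x (lam * r)); last first.
  apply/seteqP; split => y; last by move=> [[Xy _] xy].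
  move=> [Xy xy]; split => //; split => //.
  have xy' : eucl_dist x y <= lam * r := xy.
  by rewrite /cball/=; apply: le_trans (eucl_dist_tri x _ _) _; lra.
rewrite Rintegral_mkcondr; apply: eq_Rintegral => y _; rewrite patchE /ind.
by case: ifP => _; rewrite ?mulr1 ?mulr0.
Qed.

End Goodness.

Section GoodCubes.
Context {R : realType} {n d : nat} {A lam : R} {osc : R -> R}.
Variables (S : @space R n d A lam osc) (o : 'rV[R]_n) (T sh : R).
Hypotheses (T0 : 0 < T) (n0 : (0 < n)%N).
Implicit Types (x y : 'rV[R]_n) (p s : node (n := n)) (e : 'rV[R]_n).

Local Notation cube := (cube o T sh).
Local Notation icube := (icube o T sh).
Local Notation adm := (admissible o T sh).
Local Notation side := (side T).
Local Notation M := (cmass S o T sh).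
Local Notation D := (emin S o T sh).

Definition cdens e p : R := dens M (D e) p.
Definition good e N (w : R) p : Prop :=
  energy2 subnodes M (D e) N p - M p * cdens e p ^+ 2 <= w ^+ 2 * M p.

Variable e : 'rV[R]_n.
Hypothesis e3 : enorm e <= 1 / 3.

Let M0 := @cmass_ge0 R n d A lam osc S o T sh.
Let D0 := emin_ge0 S o T sh e3.
Let DM := emin_le_mass S o sh T0 e3.
Let Madd := cmass_sub S o sh T0.
Let Dsub := emin_sub S o sh T0 e3.

Lemma cdensE p : M p * cdens e p = D e p. Proof. exact: (densE D0 DM). Qed.
Lemma cdens_ge0 p : 0 <= cdens e p. Proof. exact: (dens_ge0 M0 D0). Qed.
Lemma cdens_le1 p : cdens e p <= 1. Proof. exact: (dens_le1 M0 DM). Qed.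

(** Young's inequality [|t| <= t ^ 2 / (2 * w) + w / 2] turns the second-moment bound [w ^ 2] into
    the first-moment bound [w]. *)
Lemma good_deviation N w p : 0 < w -> good e N w p ->
  \sum_(s <- desc subnodes N p) M s * `|cdens e s - cdens e p| <= w * M p.
Proof.
move=> w0 g; have h := dens_deviation M0 D0 DM Madd Dsub N p.
apply: (@le_trans _ _ (\sum_(s <- desc subnodes N p)
   ((2 * w)^-1 * (M s * (cdens e s - cdens e p) ^+ 2) + w / 2 * M s))).
  apply: ler_sum => s _; set t := cdens e s - cdens e p.
  have -> : (2 * w)^-1 * (M s * t ^+ 2) + w / 2 * M s = M s * ((2 * w)^-1 * t ^+ 2 + w / 2) by ring.
  rewrite ler_wpM2l ?M0// -subr_ge0.
  have -> : (2 * w)^-1 * t ^+ 2 + w / 2 - `|t| = (2 * w)^-1 * (`|t| - w) ^+ 2.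
    have <- : `|t| ^+ 2 = t ^+ 2 by rewrite real_normK ?num_real.
    by field; rewrite gt_eqF.
  by rewrite mulr_ge0 ?sqr_ge0// invr_ge0 mulr_ge0// ltW.
rewrite big_split /= -!mulr_sumr (desc_mass Madd).
have h2 := le_trans h g.
have -> : w * M p = (2 * w)^-1 * (w ^+ 2 * M p) + w / 2 * M p by field; rewrite gt_eqF.
by rewrite lerD2r ler_pM2l// invr_gt0 mulr_gt0.
Qed.

Lemma good_energy N w p : 0 < w -> good e N w p ->
  \sum_(s <- desc subnodes N p) D e s <= D e p + w * M p.
Proof.
move=> w0 g; apply: (le_trans _ (lerD (lexx (D e p)) (good_deviation w0 g))).
rewrite -(cdensE p) -(desc_mass Madd N p) mulr_suml -big_split; apply: ler_sum => s _ /=.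
rewrite -cdensE -mulrDr ler_wpM2l ?M0//.
have := ler_norm (cdens e s - cdens e p); lra.
Qed.

(** The function to which both sides of the dichotomy are applied. Its distance to [lin e] is
    controlled by the size of the small cells; in a good cube [good_energy] makes its energy almost
    minimal; and on each single cell it spends at least the minimal energy, which bounds from below
    what a truncation can save. *)
Lemma glued_minimizer N p (del : R) : 0 < del -> exists G,
  [/\ adm e p G, forall x, `|G.1 x - lin e x| <= 2 * side (p.1 + N),
      energy_on S o G (cube p) <= \sum_(s <- desc subnodes N p) D e s + del &
      {in desc subnodes N p, forall s, D e s <= energy_on S o G (cube s)}].
Proof.
move=> del0; pose K := (size (desc subnodes N p)).+1.
have K0 : 0 < K%:R :> R by rewrite ltr0n.
have [V [aV hV]] := near_minimizer S o T sh e3 (divr_gt0 del0 K0).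
exists (glue o T sh e p N V); split.
- exact: glue_adm.
- by move=> x; exact: glue_near.
- rewrite (glue_energy S T0 p N aV).
  apply: (@le_trans _ _ (\sum_(s <- desc subnodes N p) (D e s + del / K%:R))).
    by apply: ler_sum => s _; exact: ltW.
  rewrite big_split lerD2l/= big_const_seq count_predT iter_addr_0.
  rewrite -[leLHS]mulr_natr mulrAC ler_pdivrMr//.
  by apply: ler_wpM2l; [exact: ltW|rewrite ler_nat].
move=> s sd; apply: le_trans (emin_le S (aV s)) _.
rewrite le_eqVlt; apply/orP; left; apply/eqP; apply: Lf_eq => x _.
rewrite /dens_on; have [sx|nsx] := pselect (cube s x); last by rewrite (ind_out nsx) !mulr0.
by have [_ ->] := glue_in e V sd sx.
Qed.

End GoodCubes.

Section Strip.
Context {R : realType} (n d : nat) (A lam : R) (osc : R -> R).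
Hypotheses (n0 : (0 < n)%N) (A1 : 1 <= A) (lam1 : 1 <= lam) (osc0 : forall k : R, 0 < k -> 0 < osc k).

(** The root cube has diameter at most [n * T]. The factor [100] keeps the balls around its points
    within the range [srm S] of the regularity and oscillation bounds. *)
Definition zone (S : @space R n d A lam osc) (o : 'rV[R]_n) (T : R) :=
  0 < T /\ 100 * n%:R * T <= srm S.

Definition deep (o : 'rV[R]_n) (T sh th : R) (p : node (n := n)) (x : 'rV[R]_n) :=
  forall y, eucl_dist x y <= th * side T p.1 -> icube o T sh p y.

Lemma half_pow_le (k : R) : 0 < k -> exists N0 : nat, forall N, (N0 <= N)%N -> (2 ^+ N)^-1 <= k.
Proof.
move=> k0; exists (Num.truncn k^-1) => N hN.
rewrite -(invrK k) lef_pV2 ?posrE ?invr_gt0 ?exprn_gt0//.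
apply: le_trans (ltW (truncnS_gt _)) _.
rewrite -natrX ler_nat; apply: leq_trans (ltn_expl N (isT : 1 < 2)%N).
by rewrite ltnS.
Qed.

Lemma side_le (T : R) (j : nat) : 0 < T -> side T j <= T.
Proof. by move=> T0; rewrite /side ler_pdivrMr ?exprn_gt0// ler_peMr ?(ltW T0)// exprn_ege1// ler1n. Qed.

Lemma sideD (T : R) (i j : nat) : side T (i + j) = side T i * (2 ^+ j)^-1.
Proof. by rewrite /side exprD invfM mulrA. Qed.

(** The oscillation bound is applied to the glued minimiser, whose energy is small together with the
    density. For large [N] it is uniformly close to [lin e], which therefore oscillates little on
    [X] as well. *)
Lemma strip (th k : R) : 0 < th <= 1 -> 0 < k <= 1 -> exists alp w0 (N0 : nat), [/\ 0 < alp, 0 < w0 &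
  forall (S : @space R n d A lam osc) o T sh p x0 e N w, zone S o T ->
  sX S x0 -> eucl_dist o x0 <= srm S / 2 -> deep o T sh th p x0 -> enorm e <= 1 / 3 ->
  (N0 <= N)%N -> 0 < w <= w0 -> good S o T sh e N w p -> cdens S o T sh e p < alp ->
  forall y, sX S y -> eucl_dist x0 y <= th / (2 * lam) * side T p.1 ->
    `|lin e y - lin e x0| <= k * side T p.1].
Proof.
move=> /andP[th0 th1] /andP[k0 k1].
have A0 : 0 < A by apply: lt_le_trans A1.
have lam0 : 0 < lam by apply: lt_le_trans lam1.
have nn0 : 0 < n%:R :> R by rewrite ltr0n.
(* The energy per unit mass is at most [3 * alp]: the density, the deviation [w] and the gluing
   error [w], with [w <= alp]. Multiplied by the mass bound [A * (n * t) ^ d], it equals the energy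
   allowed at radius [th * t / lam]. *)
pose alp := osc (k / 2) * (th / lam) ^+ d / (3 * (A * n%:R ^+ d)).
have k20 : 0 < k / 2 by rewrite divr_gt0.
have den0 : 0 < 3 * (A * n%:R ^+ d) by rewrite !mulr_gt0// exprn_gt0.
have alp0 : 0 < alp.
  by rewrite divr_gt0 ?den0// mulr_gt0 ?osc0// exprn_gt0// divr_gt0.
have [N0 HN0] := @half_pow_le (k / 8) (divr_gt0 k0 (ltr0n _ 8)).
exists alp, alp, N0; split => //.
move=> S o T sh p x0 e N w [T0 Tn] Xx0 ox0 dp e3 N0N /andP[w0 wa] g qa y Xy x0y.
set t := side T p.1; have t0 : 0 < t by exact: side_gt0.
have tT : t <= T by exact: side_le.
have n1 : 1 <= n%:R :> R by rewrite ler1n.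
have ntT : n%:R * t <= srm S / 100.
  by rewrite ler_pdivlMr//; apply: le_trans Tn; rewrite mulrC mulrA ler_wpM2l// mulr_ge0.
have tnt : t <= n%:R * t by rewrite ler_peMl// ltW.
have srm0 : 0 < srm S by apply: lt_le_trans Tn; rewrite !mulr_gt0.
have Mle : cmass S o T sh p <= A * (n%:R * t) ^+ d.
  apply: le_trans (sm_ball_le Xx0 ox0 _ _); [|by rewrite mulr_gt0|by lra].
  apply: sm_le; [exact: bset_cube|exact: bset_cball|].
  move=> z Xz pz; rewrite /cball/=; apply: cube_diam pz => //.
  by apply: icube_cube; apply: dp; rewrite eucl_dist0 mulr_ge0// ltW.
have Mpos : 0 < cmass S o T sh p.
  have tht : th * t <= t by rewrite ler_piMl// ltW.
  apply: lt_le_trans (_ : A^-1 * (th * t) ^+ d <= _).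
    by rewrite mulr_gt0 ?invr_gt0// exprn_gt0// mulr_gt0.
  apply: le_trans (sm_ball_ge Xx0 ox0 _ _) _; [by rewrite mulr_gt0|by lra|].
  apply: sm_le; [exact: bset_cball|exact: bset_cube|].
  by move=> z Xz xz; apply: icube_cube; apply: dp.
have [G [aG nearG enG _]] := glued_minimizer S o sh T0 n0 e3 N p (mulr_gt0 w0 Mpos).
have [vL mr r01 _ vl] := aG.
have r0 : 0 < th * t / lam by rewrite divr_gt0// mulr_gt0.
have lr : lam * (th * t / lam) = th * t by rewrite mulrC divfK ?gt_eqF.
have k2 : 0 < k / 2 <= 1 by lra.
have lrs : lam * (th * t / lam) <= srm S / 2.
  have : th * t <= t by rewrite ler_piMl// ltW.
  rewrite lr; lra.
have := zone_osc lam1 vL mr r01 vl k2 Xx0 ox0 r0 lrs.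
have -> : sL S o (fun z => G.2 z ^+ d * ind (cball x0 (lam * (th * t / lam))) z) <=
    osc (k / 2) * (th * t / lam) ^+ d.
  apply: (@le_trans _ _ (energy_on S o G (cube o T sh p))).
    apply: Lf_le; [exact: bset_sdom|exact: fin_sdom|apply: bbm_dens aG _; exact: bset_cball|apply: bbm_dens aG _; exact: bset_cube|].
    move=> z _; apply: ler_wpM2l; first by rewrite exprn_ge0//; case/andP: (r01 z).
    have [xz|nxz] := pselect (cball x0 (lam * (th * t / lam)) z); last by rewrite (ind_out nxz) ind_ge0.
    by rewrite !ind_in//; apply: icube_cube; apply: dp; move: xz; rewrite lr.
  apply: le_trans enG _.
  apply: (@le_trans _ _ (3 * alp * cmass S o T sh p)).
    have := good_energy T0 e3 w0 g; have := cdensE S o sh T0 e3 p.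
    have := ler_wpM2r (ltW Mpos) wa; have := ler_wpM2l (ltW Mpos) (ltW qa); lra.
  apply: le_trans (ler_wpM2l _ Mle) _; first by rewrite mulr_ge0// ltW.
  rewrite le_eqVlt; apply/orP; left; apply/eqP; rewrite /alp !exprMn.
  by field; rewrite ?expf_neq0 ?gt_eqF.
move=> /(_ isT y Xy) H.
have {}H : `|G.1 y - G.1 x0| <= k / 2 * (th * t / lam).
  apply: H; apply: le_trans x0y _; rewrite -/t le_eqVlt; apply/orP; left; apply/eqP.
  by field; rewrite gt_eqF.
have H2 : k / 2 * (th * t / lam) <= k / 2 * t.
  rewrite ler_pM2l// ler_pdivrMr// mulrC; apply: ler_pM => //; [exact: ltW|exact: ltW|].
  by apply: le_trans lam1.
have N2 : 2 * side T (p.1 + N) <= k / 4 * t.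
  by have := ler_wpM2l (ltW t0) (HN0 N N0N); rewrite sideD -/t; lra.
have := nearG y; have := nearG x0.
have -> : lin e y - lin e x0 = (G.1 y - G.1 x0) - (G.1 y - lin e y) + (G.1 x0 - lin e x0) by ring.
have := ler_normD ((G.1 y - G.1 x0) - (G.1 y - lin e y)) (G.1 x0 - lin e x0).
have := ler_normB (G.1 y - G.1 x0) (G.1 y - lin e y); lra.
Qed.

End Strip.

(** * Truncation by a barrier *)

Section MinTruncation.
Context {R : realType} {n : nat}.
Implicit Types (x y z : 'rV[R]_n) (v u : 'rV[R]_n -> R).

Lemma min_sub_le (a b a' b' c : R) : a - a' <= c -> b - b' <= c -> Num.min a b - Num.min a' b' <= c.
Proof. by move=> h1 h2; rewrite !minElt; do ![case: ltP => ?]; lra. Qed.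

Lemma one_lip_min v u : one_lip v -> one_lip u -> one_lip (fun x => Num.min (v x) (u x)).
Proof. by move=> vL uL x y; apply: min_sub_le; [exact: vL|exact: uL]. Qed.

Lemma lip_at_min v u (c c' : R) x : lip_at v c x -> lip_at u c' x ->
  lip_at (fun x => Num.min (v x) (u x)) (Num.max c c') x.
Proof.
move=> vc uc e e0; have [r r0 Hr] := vc e e0; have [r' r'0 Hr'] := uc e e0.
exists (Num.min r r'); first by rewrite lt_min r0.
move=> y z; rewrite !lt_min => /andP[yr yr'] /andP[zr zr'].
have d0 := eucl_dist_ge0 y z.
have h1 : `|v y - v z| <= (Num.max c c' + e) * eucl_dist y z.
  by apply: le_trans (Hr _ _ yr zr) _; rewrite ler_wpM2r// lerD2r le_max lexx.
have h2 : `|u y - u z| <= (Num.max c c' + e) * eucl_dist y z.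
  by apply: le_trans (Hr' _ _ yr' zr') _; rewrite ler_wpM2r// lerD2r le_max lexx orbT.
move: h1 h2; rewrite !ler_norml => /andP[h1 h2] /andP[h3 h4]; apply/andP; split.
  by rewrite lerNl opprB; apply: min_sub_le; lra.
exact: min_sub_le.
Qed.

Lemma cont_lt_near v u x : one_lip v -> one_lip u -> v x < u x ->
  exists2 r : R, 0 < r & forall y, eucl_dist y x < r -> v y < u y.
Proof.
move=> vL uL vu; exists ((u x - v x) / 2); first by rewrite divr_gt0// subr_gt0.
by move=> y yx; have := vL y x; have := uL x y; rewrite (eucl_distC x y); lra.
Qed.

End MinTruncation.

Section Barrier.
Context {R : realType} {n : nat}.
Variables (x1 : 'rV[R]_n) (c sg r R' : R).
Implicit Types (x y z : 'rV[R]_n).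
Hypotheses (sg0 : 0 <= sg) (sg3 : sg <= 1 / 3).

Definition pos (t : R) : R := Num.max 0 t.
(** Constant up to radius [r], of slope [sg] up to [R'], and steeper than [2 / 3] or equal to it
    beyond. There it outgrows [lin e], whose slope is at most [1 / 3], while [sg <= 1 / 3] keeps the
    total slope at most [1]. *)
Definition barrier y : R := c + sg * pos (eucl_dist y x1 - r) + 2 / 3 * pos (eucl_dist y x1 - R').

Lemma pos_ge0 t : 0 <= pos t. Proof. by rewrite le_max lexx. Qed.
Lemma pos_ge t : t <= pos t. Proof. by rewrite le_max lexx orbT. Qed.
Lemma pos_le0 t : t <= 0 -> pos t = 0. Proof. by move=> t0; rewrite /pos (max_idPl t0). Qed.

Lemma pos_lip t t' : pos t - pos t' <= `|t - t'|.
Proof.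
rewrite /pos !maxElt; have := ler_norm (t - t'); have := normr_ge0 (t - t').
by do ![case: ltP => ?]; lra.
Qed.

Lemma pos_dist_lip (q : R) x y : pos (eucl_dist x x1 - q) - pos (eucl_dist y x1 - q) <= eucl_dist x y.
Proof.
apply: le_trans (pos_lip _ _) _; rewrite ler_norml; apply/andP; split.
  by have := eucl_dist_tri x y x1; rewrite (eucl_distC y x); lra.
by have := eucl_dist_tri y x x1; lra.
Qed.

Lemma barrier_lip : one_lip barrier.
Proof.
move=> x y; have h1 := pos_dist_lip r x y; have h2 := pos_dist_lip R' x y.
have d0 := eucl_dist_ge0 x y; have s0 := sg0; have s3 := sg3.
have := ler_wpM2l s0 h1; have : sg * eucl_dist x y <= 1 / 3 * eucl_dist x y by rewrite ler_wpM2r.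
rewrite /barrier; lra.
Qed.

Lemma barrier_lip_at x : eucl_dist x x1 < R' -> lip_at barrier sg x.
Proof.
move=> xR e e0; exists (R' - eucl_dist x x1); first by rewrite subr_gt0.
move=> y z yx zx.
have h w : eucl_dist w x < R' - eucl_dist x x1 -> pos (eucl_dist w x1 - R') = 0.
  by move=> wx; apply: pos_le0; have := eucl_dist_tri x w x1; lra.
rewrite /barrier !h// !mulr0 !addr0.
have -> : c + sg * pos (eucl_dist y x1 - r) - (c + sg * pos (eucl_dist z x1 - r)) =
   sg * (pos (eucl_dist y x1 - r) - pos (eucl_dist z x1 - r)) by ring.
rewrite normrM (ger0_norm sg0); apply: (@le_trans _ _ (sg * eucl_dist y z)).
  rewrite ler_wpM2l// ler_norml pos_dist_lip andbT lerNl opprB (eucl_distC y z).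
  exact: pos_dist_lip.
by rewrite ler_wpM2r ?eucl_dist_ge0// lerDl ltW.
Qed.

Lemma barrier_inner y : eucl_dist y x1 <= r -> r <= R' -> barrier y = c.
Proof. by move=> yr rR; rewrite /barrier !pos_le0 ?mulr0 ?addr0//; lra. Qed.

Lemma barrier_ge y : c <= barrier y.
Proof. by rewrite /barrier -addrA lerDl addr_ge0// mulr_ge0 ?pos_ge0. Qed.

Lemma barrier_outer y : r <= R' -> R' <= eucl_dist y x1 ->
  c + sg * (R' - r) + 2 / 3 * (eucl_dist y x1 - R') <= barrier y.
Proof.
move=> rR yR; rewrite /barrier lerD//; last by rewrite ler_wpM2l// pos_ge.
rewrite lerD2l ler_wpM2l//; apply: le_trans (pos_ge _); lra.
Qed.

End Barrier.

Section LevelSets.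
Context {R : realType} {n : nat}.
Implicit Types (x y z : 'rV[R]_n).

Lemma bset_lt (f g : 'rV[R]_n -> R) : bfun f -> bfun g -> bset [set x | f x < g x].
Proof.
move=> mf mg; have mh : bfun (fun x => g x - f x) by exact: measurable_funB.
have -> : [set x | f x < g x] = (fun x => g x - f x) @^-1` `]0, +oo[.
  by apply/seteqP; split => x; rewrite /= in_itv/= andbT subr_gt0.
by have := mh measurableT _ (measurable_itv `]0, +oo[); rewrite setTI.
Qed.

Lemma ind_bool (P : 'rV[R]_n -> bool) y : ind [set y | P y] y = (P y)%:R.
Proof. by case: (boolP (P y)) => Py; [rewrite ind_in|rewrite ind_out//; apply/negP]. Qed.

Definition level (e x1 : 'rV[R]_n) (s r : R) : set 'rV[R]_n :=
  [set y | eucl_dist y x1 <= r /\ lin e x1 - s <= lin e y].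

Lemma bset_level e x1 s r : enorm e <= 1 / 3 -> bset (level e x1 s r).
Proof.
move=> e3; have -> : level e x1 s r = cball x1 r `&` ~` [set y | lin e y < lin e x1 - s].
  apply/seteqP; split => y [h1 h2]; split.
  - by rewrite /cball/= eucl_distC.
  - by apply/negP; rewrite -leNgt.
  - by move: h1; rewrite /cball/= eucl_distC.
  - by rewrite leNgt; apply/negP.
apply: measurableI; first exact: bset_cball.
apply: measurableC; apply: bset_lt; last exact: measurable_cst.
by apply: one_lip_bfun; exact: lin_one_lip.
Qed.

End LevelSets.

(* The competitor [min (glued minimiser) barrier] has slope at most [s / (R' - r)] where the barrier
   is active, while the minimality of the cells forces energy at least [alp] per unit mass there. *)
Lemma truncation_step {R : realType} {n d : nat} {A lam : R} {osc : R -> R} (S : @space R n d A lam osc)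
    (o : 'rV[R]_n) (T sh : R) (e x1 : 'rV[R]_n) (p : node (n := n)) (N : nat)
    (w h s r R' Rr s1 r1 alp : R) (sd := side T (p.1 + N)) (del := n%:R * sd + 2 * sd) :
  0 < T -> (0 < n)%N -> (0 < d)%N -> enorm e <= 1 / 3 -> 0 < w ->
  good S o T sh e N w p -> 0 < cmass S o T sh p ->
  (forall y, eucl_dist y x1 <= 2 * Rr -> icube o T sh p y) -> 0 <= h ->
  (forall y, sX S y -> eucl_dist y x1 <= 2 * Rr -> lin e y <= lin e x1 + h) ->
  0 <= r -> r < R' -> R' <= Rr -> 0 < s -> s <= (R' - r) / 3 -> r1 + del <= r -> s1 + h + 3 * del < s ->
  alp <= cdens S o T sh e p ->
  alp * sm S o (level e x1 s1 r1) <=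
    (s / (R' - r)) ^+ d * sm S o (level e x1 s R') + 3 * (w * cmass S o T sh p).
Proof.
move=> T0 n0 d0 e3 w0 g Mp0 inner h0 below r0 rR' R'R s0 sR r1r s1s alpq.
have sd0 : 0 < sd by exact: side_gt0.
have nsd : 0 <= n%:R * sd by rewrite mulr_ge0 ?ler0n// ltW.
have del0 : 0 < del by rewrite /del; lra.
have [G [aG nearG enG lowG]] := glued_minimizer S o sh T0 n0 e3 N p (mulr_gt0 w0 Mp0).
have {}nearG z : lin e z - 2 * sd <= G.1 z <= lin e z + 2 * sd.
  by have := nearG z; rewrite -/sd ler_norml => /andP[h1 h2]; apply/andP; split; lra.
have [vL mr r01 Gout vl] := aG.
pose a := lin e x1; pose M0 := a + h + 2 * del.
pose sg := s / (R' - r).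
have Rr0 : 0 < R' - r by rewrite subr_gt0.
have sg0 : 0 <= sg by rewrite divr_ge0// ltW.
have sg3 : sg <= 1 / 3 by rewrite ler_pdivrMr//; lra.
have sgE : sg * (R' - r) = s by rewrite /sg divfK// gt_eqF.
pose psi := barrier x1 (M0 - s) sg r R'.
have psiL : one_lip psi by exact: barrier_lip.
pose A1 := [set y | G.1 y < psi y]; pose A2 := [set y | eucl_dist y x1 < R'].
pose A3 := [set y | psi y < G.1 y].
have mG := one_lip_bfun vL; have mpsi := one_lip_bfun psiL.
have mA1 : bset A1 by exact: bset_lt.
have mA3 : bset A3 by exact: bset_lt.
have mA2 : bset A2 by apply: open_bset; exact: open_eball.
pose u y := Num.min (G.1 y) (psi y).
(* Where the two functions agree, the minimum has only the larger of the two slope bounds; from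
   radius [R'] on, the steep part of the barrier leaves just the bound [1]. *)
pose rho y := if G.1 y < psi y then G.2 y else if eucl_dist y x1 < R' then
  (if psi y < G.1 y then sg else Num.max (G.2 y) sg) else 1.
have mrho : bfun rho.
  suff [] : bbm rho by [].
  have bG : bbm G.2 by exact: bbm_rho aG.
  have bmax : bbm (fun y => Num.max (G.2 y) sg).
    split; first by apply: measurable_maxr => //; exact: measurable_cst.
    exists 1 => y; have /andP[g0 g1] := r01 y.
    by rewrite ger0_norm ?le_max ?g0// ge_max g1/=; lra.
  rewrite (_ : rho = fun y => G.2 y * ind A1 y + (1 + -1 * ind A1 y) * ((1 + -1 * ind A2 y) +
     ind A2 y * (sg * ind A3 y + (1 + -1 * ind A3 y) * Num.max (G.2 y) sg))).
    have b1 := bbm_ind mA1; have b2 := bbm_ind mA2; have b3 := bbm_ind mA3.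
    have b1' : bbm (fun y => 1 + -1 * ind A1 y) by apply: bbmD; [exact: bbm_cst|exact: bbmZ].
    have b2' : bbm (fun y => 1 + -1 * ind A2 y) by apply: bbmD; [exact: bbm_cst|exact: bbmZ].
    have b3' : bbm (fun y => 1 + -1 * ind A3 y) by apply: bbmD; [exact: bbm_cst|exact: bbmZ].
    apply: bbmD; first exact: bbmM.
    apply: bbmM => //; apply: bbmD => //; apply: bbmM => //; apply: bbmD; first exact: bbmZ.
    exact: bbmM.
  apply/funext => y; rewrite /rho /A1 /A2 /A3 !ind_bool.
  by case: (G.1 y < psi y); case: (eucl_dist y x1 < R'); case: (psi y < G.1 y) => /=; ring.
have far y : R' <= eucl_dist y x1 -> M0 + 2 / 3 * (eucl_dist y x1 - R') <= psi y.
  move=> yR; apply: (le_trans _ (barrier_outer (M0 - s) sg0 (ltW rR') yR)).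
  by rewrite sgE; lra.
have uadm : admissible o T sh e p (u, rho).
  split => /=.
  - exact: one_lip_min.
  - exact: mrho.
  - move=> y; rewrite /rho; case: ifP => _; first exact: r01.
    case: ifP => _; last by rewrite ler01 lexx.
    have /andP[g0 g1] := r01 y; case: ifP => _; first by move: sg0 sg3; clear -R => *; apply/andP; split; lra.
    by rewrite le_max g0 ge_max g1/=; lra.
  - move=> y ny; have [Gl G1] := Gout y ny.
    have y2R : 2 * Rr < eucl_dist y x1.
      by rewrite ltNge; apply/negP => /inner; exact: ny.
    have Rr0' : 0 <= Rr by lra.
    have yR' : R' <= eucl_dist y x1 by lra.
    have lpsi : lin e y <= psi y.
      have h1 := far y yR'; have := lin_lip y x1 e3; rewrite -/a /M0 in h1 *; lra.
    split; first by rewrite /u Gl; apply/min_idPl.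
    by rewrite /rho G1; case: ifP => // _; rewrite ltNge yR'.
  - move=> y; rewrite /rho; case: ltP => c1.
      have [q q0 Hq] := cont_lt_near vL psiL c1.
      apply: lip_at_near q0 _ (vl y) => z /Hq zz; rewrite /u; apply/esym/min_idPl; exact: ltW.
    case: ltP => c2; last by apply: one_lip_at; exact: one_lip_min.
    have pl : lip_at psi sg y by exact: barrier_lip_at.
    case: ltP => c3; last exact: lip_at_min.
    have [q q0 Hq] := cont_lt_near psiL vL c3.
    apply: lip_at_near q0 _ pl => z /Hq zz; rewrite /u; apply/esym/min_idPr; exact: ltW.
have active y : sX S y -> psi y <= G.1 y -> eucl_dist y x1 < R' /\ level e x1 s R' y.
  move=> Xy pG; have /andP[_ Gy] := nearG y.
  have yR : eucl_dist y x1 < R'.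
    rewrite ltNge; apply/negP => yR; have h1 := far y yR.
    have [y2|y2] := leP (eucl_dist y x1) (2 * Rr).
      have := below y Xy y2; rewrite -/a; rewrite /M0 /del in h1; lra.
    by have := lin_lip y x1 e3; rewrite -/a; rewrite /M0 /del in h1; lra.
  split => //; split; first exact: ltW.
  have := barrier_ge x1 (M0 - s) r R' sg0 y; rewrite -/psi -/a /M0 /del; lra.
pose f1 y := dens_on (d := d) G ((cube o T sh) p) y * (1 + -1 * ind A3 y).
pose f2 y := dens_on (d := d) G ((cube o T sh) p) y * ind A3 y.
have mlev : bset (level e x1 s R') by exact: bset_level.
have mQ : bset ((cube o T sh) p) by exact: bset_cube.
have bG : bbm (dens_on (d := d) G ((cube o T sh) p)) by exact: bbm_dens aG mQ.
have bf1 : bbm f1.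
  by apply: bbmM => //; apply: bbmD; [exact: bbm_cst|apply: bbmZ; exact: bbm_ind].
have bf2 : bbm f2 by apply: bbmM => //; exact: bbm_ind.
have mD := bset_sdom S o; have fD := fin_sdom S o.
have E1 : emin S o T sh e p <= sL S o f1 + sg ^+ d * (sm S o) (level e x1 s R').
  apply: le_trans (emin_le S uadm) _.
  rewrite /sm /msr -LfZ//; last exact: bbm_ind.
  rewrite /sL -LfD//; last by apply: bbmZ; exact: bbm_ind.
  apply: Lf_le => //; first exact: bbm_dens uadm mQ.
    by apply: bbmD => //; apply: bbmZ; exact: bbm_ind.
  move=> y [Xy _]; rewrite /f1 /dens_on /=.
  have iQ0 := ind_ge0 ((cube o T sh) p) y; have iQ1 := ind_le1 ((cube o T sh) p) y.
  have /andP[g0 g1] := r01 y.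
  have gd0 : 0 <= G.2 y ^+ d by rewrite exprn_ge0.
  have sgd0 : 0 <= sg ^+ d by rewrite exprn_ge0.
  have il0 := ind_ge0 (level e x1 s R') y.
  rewrite /rho /A3 ind_bool; case: (ltP (G.1 y) (psi y)) => c1.
    rewrite ltNge (ltW c1) /= mulr0 addr0 mulr1 lerDl mulr_ge0//.
  have [yR yl] := active y Xy c1; rewrite yR (ind_in yl) mulr1.
  case: ltP => c2 /=.
    by rewrite mulr1 subrr mulr0 add0r ler_piMr.
  rewrite mulr0 addr0 mulr1.
  have mx : Num.max (G.2 y) sg ^+ d <= G.2 y ^+ d + sg ^+ d.
    by rewrite maxElt; case: ifP => _; rewrite ?lerDl ?lerDr.
  apply: le_trans (ler_wpM2r iQ0 mx) _; rewrite mulrDl lerD2l ler_piMr//.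
have E2 : energy_on S o G ((cube o T sh) p) = sL S o f1 + sL S o f2.
  rewrite /sL -LfD//; apply: Lf_eq => y _; rewrite /f1 /f2; ring.
have E3 : sL S o f2 <= sg ^+ d * (sm S o) (level e x1 s R') + 2 * (w * (cmass S o T sh) p).
  have := good_energy T0 e3 w0 g; move: E1 enG; rewrite E2; lra.
(* Minimality is available cell by cell, so only cells contained in the active set are counted. The
   cell of every point of the smaller level set is among them, because [del] pays for the variation
   of [lin e] over a cell and for the distance to the minimiser. *)
pose F (q : node (n := n)) : R := `[< (cube o T sh) q `<=` A3 >]%:R.
have F01 q : 0 <= F q <= 1 by rewrite /F; case: asbool; rewrite ?lexx ?ler01.
have E4 : \sum_(q <- desc subnodes N p) F q * emin S o T sh e q <= sL S o f2.
  apply: (@le_trans _ _ (\sum_(q <- desc subnodes N p) sL S o (fun y => F q * dens_on (d := d) G ((cube o T sh) q) y))).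
    rewrite big_seq [leRHS]big_seq; apply: ler_sum => q qd.
    rewrite /sL LfZ//; last by apply: bbm_dens aG _; exact: bset_cube.
    by apply: ler_wpM2l; [case/andP: (F01 q)|exact: lowG].
  have bb q : bbm (fun y => F q * dens_on (d := d) G ((cube o T sh) q) y).
    by apply: bbmZ; apply: bbm_dens aG _; exact: bset_cube.
  rewrite /sL -Lf_sum//; apply: Lf_le => //; first exact: bbm_sum.
  move=> y _; rewrite /f2 /dens_on.
  rewrite (eq_bigr (fun q => (F q * G.2 y ^+ d) * ind ((cube o T sh) q) y)); last by move=> q _; rewrite mulrA.
  have gd0 : 0 <= G.2 y ^+ d by rewrite exprn_ge0//; case/andP: (r01 y).
  have [py|npy] := pselect ((cube o T sh) p y).
    rewrite (big_desc_cell N (fun q => F q * G.2 y ^+ d) py) (ind_in py) mulr1 mulrC ler_wpM2l//.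
    rewrite /F; case: asboolP => [sub|_]; last exact: ind_ge0.
    by rewrite ind_in//; apply: sub; apply: cell_cube => i; exact: cube_ge0 py.
  by rewrite (big_desc_out N (fun q => F q * G.2 y ^+ d) npy) (ind_out npy) mulr0 mul0r.
have M0' := @cmass_ge0 R n d A lam osc S o T sh.
have E5 : alp * \sum_(q <- desc subnodes N p) F q * (cmass S o T sh) q - w * (cmass S o T sh) p <=
    \sum_(q <- desc subnodes N p) F q * emin S o T sh e q.
  have := good_deviation T0 e3 w0 g.
  suff : alp * \sum_(q <- desc subnodes N p) F q * (cmass S o T sh) q -
     \sum_(q <- desc subnodes N p) (cmass S o T sh) q * `|cdens S o T sh e q - cdens S o T sh e p| <=
     \sum_(q <- desc subnodes N p) F q * emin S o T sh e q by lra.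
  rewrite mulr_sumr -sumrB; apply: ler_sum => q _.
  rewrite -(cdensE S o sh T0 e3 q).
  have /andP[F0 F1] := F01 q; have Mq := M0' q.
  set Dl := `|_|.
  have Dl1 : cdens S o T sh e p - Dl <= cdens S o T sh e q.
    have := ler_norm (cdens S o T sh e p - cdens S o T sh e q); rewrite distrC -/Dl; clear -R; lra.
  have FM : 0 <= F q * (cmass S o T sh) q by rewrite mulr_ge0.
  have Dl0 : 0 <= Dl by exact: normr_ge0.
  have h1 : F q * (cmass S o T sh) q * (alp - Dl) <= F q * (cmass S o T sh) q * cdens S o T sh e q by rewrite ler_wpM2l//; move: Dl1 alpq; clear -R; lra.
  have h2 : F q * (cmass S o T sh) q * Dl <= (cmass S o T sh) q * Dl by rewrite ler_wpM2r// ler_piMl.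
  rewrite mulrA; move: h1 h2; clear -R; lra.
have E6 : (sm S o) (level e x1 s1 r1) <= \sum_(q <- desc subnodes N p) F q * (cmass S o T sh) q.
  rewrite /sm /msr (eq_bigr (fun q => Lf (smu S) (sdom S o) (fun y => F q * ind ((cube o T sh) q) y))); last first.
    by move=> q _; rewrite LfZ//; apply: bbm_ind; exact: bset_cube.
  have bb q : bbm (fun y => F q * ind ((cube o T sh) q) y).
    by apply: bbmZ; apply: bbm_ind; exact: bset_cube.
  rewrite -Lf_sum//; apply: Lf_le => //; [by apply: bbm_ind; exact: bset_level|exact: bbm_sum|].
  move=> y [Xy _].
  have [[yr yl]|nl] := pselect (level e x1 s1 r1 y); last first.
    by rewrite (ind_out nl); apply: sumr_ge0 => q _; rewrite mulr_ge0 ?ind_ge0.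
  have Rr1 : r1 <= 2 * Rr by move: r0 rR' R'R r1r del0; clear -R; lra.
  have py : (cube o T sh) p y by apply: icube_cube; apply: inner; exact: le_trans yr Rr1.
  rewrite (big_desc_cell N F py) (ind_in (conj yr yl)) /F.
  have qy : (cube o T sh) ((cell o T sh) (p.1 + N) y) y by apply: cell_cube => i; exact: cube_ge0 py.
  case: asboolP => [_|[]]; first by rewrite lexx.
  move=> z qz; rewrite /A3 /=.
  have zy : eucl_dist z y <= n%:R * sd by exact: cube_diam qz qy.
  have zx : eucl_dist z x1 <= r.
    by have := eucl_dist_tri y z x1; rewrite /del in r1r; lra.
  rewrite /psi (barrier_inner (M0 - s) sg zx (ltW rR')).
  have := lin_lip y z e3; rewrite (eucl_distC y z) => l1.
  have /andP[Gz _] := nearG z.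
  rewrite -/a in yl; rewrite /del in s1s; rewrite /M0 /del; lra.
have : alp * (sm S o) (level e x1 s1 r1) <= alp * \sum_(q <- desc subnodes N p) F q * (cmass S o T sh) q \/ alp < 0.
  by have [a0|a0] := leP 0 alp; [left; rewrite ler_wpM2l|right].
have P1 : 0 <= sg ^+ d * (sm S o) (level e x1 s R') by rewrite mulr_ge0 ?exprn_ge0// msr_ge0.
have P2 : 0 <= w * (cmass S o T sh) p by rewrite mulr_ge0// ltW.
case=> [Hm|a0]; first by rewrite -/sg; lra.
have : alp * (sm S o) (level e x1 s1 r1) <= 0 by rewrite mulr_le0_ge0 ?(ltW a0)// msr_ge0.
by rewrite -/sg; lra.
Qed.

(* Iterating the truncation step twice shrinks the mass of a thin level set at [x1] by a factor
   [~ sigma^(2d)], which beats the lower regularity bound [~ sigma^d]. *)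
Lemma not_one_sided {R : realType} (n d : nat) (A lam : R) (osc : R -> R) (alp : R) :
  (0 < n)%N -> (0 < d)%N -> 1 <= A -> 0 < alp <= 1 -> exists2 om : R, 0 < om <= 1 &
  forall tau : R, 0 < tau <= 1 -> exists w0 (N0 : nat), 0 < w0 /\
  forall (S : @space R n d A lam osc) o T sh p x1 e N w, zone S o T ->
  sX S x1 -> eucl_dist o x1 <= srm S / 2 ->
  (forall y, eucl_dist y x1 <= 2 * (tau * side T p.1) -> icube o T sh p y) ->
  enorm e <= 1 / 3 -> (N0 <= N)%N -> 0 < w <= w0 -> good S o T sh e N w p ->
  alp <= cdens S o T sh e p ->
  ~ (forall y, sX S y -> eucl_dist y x1 <= 2 * (tau * side T p.1) ->
       lin e y <= lin e x1 + om * (tau * side T p.1)).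
Proof.
move=> n0 d0 A1 /andP[alp0 alp1].
have absurd (x : R) : 0 < x -> x <= x / 4 + x / 4 -> False by move=> *; lra.
have A0 : 0 < A by apply: lt_le_trans A1.
have nn0 : 0 < n%:R :> R by rewrite ltr0n.
(* Each of the two truncations has slope [32 / 3 * sg <= 11 * sg]. Since [B ^ 2 * sg = alp ^ 2], the
   product [121 * sg * A] is [alp ^ 2 / (4 * A)], so the main term is at most a quarter of the lower
   mass bound. *)
pose B := 22 * A; have B0 : 0 < B by rewrite mulr_gt0.
have B22 : 22 <= B by rewrite ler_peMr.
pose sg := (alp / B) ^+ 2.
have alp2 : 0 < alp ^+ 2 by rewrite exprn_gt0.
have sg0 : 0 < sg by rewrite exprn_gt0// divr_gt0.
have sgE : B ^+ 2 * sg = alp ^+ 2 by rewrite /sg -exprMn mulrC divfK// gt_eqF.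
have sg1 : 22 * (22 * sg) <= 1.
  have h : alp / B <= 22^-1.
    by rewrite -(mul1r 22^-1); apply: ler_pM => //; [exact: ltW|rewrite invr_ge0 ltW|rewrite lef_pV2 ?posrE].
  have h0 : 0 <= alp / B by rewrite ltW// divr_gt0.
  have h1 : sg <= 22^-1 * 22^-1 by rewrite /sg expr2; apply: ler_pM.
  lra.
exists (sg / 4) => [|tau /andP[tau0 tau1]]; first by apply/andP; split; lra.
(* The deviation errors of the two steps get another quarter of the lower mass bound; [24] is
   [6 * 4]. *)
pose w0 := alp ^+ 2 * (sg * tau) ^+ d / (24 * (A ^+ 2 * n%:R ^+ d)).
have den0 : 0 < 24 * (A ^+ 2 * n%:R ^+ d) by rewrite !mulr_gt0 ?exprn_gt0.
have w00 : 0 < w0 by rewrite divr_gt0// mulr_gt0// exprn_gt0// mulr_gt0.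
have [N0 HN0] := @half_pow_le R (sg * tau / (100 * (n%:R + 2)))
  (divr_gt0 (mulr_gt0 sg0 tau0) (mulr_gt0 (ltr0n _ 100) (addr_gt0 nn0 (ltr0n _ 2)))).
exists w0, N0; split => // S o T sh p x1 e N w [T0 Tn] Xx1 ox1 inner e3 N0N /andP[w_0 ww0] g qa below.
set t := side T p.1; have t0 : 0 < t by exact: side_gt0.
have tT : t <= T by exact: side_le.
have n1 : 1 <= n%:R :> R by rewrite ler1n.
have ntT : n%:R * t <= srm S / 100.
  by rewrite ler_pdivlMr//; apply: le_trans Tn; rewrite mulrC mulrA ler_wpM2l// mulr_ge0.
have tnt : t <= n%:R * t by rewrite ler_peMl// ltW.
pose Rr := tau * t; have Rr0 : 0 < Rr by rewrite mulr_gt0.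
have Rrt : Rr <= t by rewrite ler_piMl// ltW.
have srm0 : 0 < srm S by apply: lt_le_trans Tn; rewrite !mulr_gt0.
have Mle : cmass S o T sh p <= A * (n%:R * t) ^+ d.
  apply: le_trans (sm_ball_le Xx1 ox1 _ _); [|by rewrite mulr_gt0|by lra].
  apply: sm_le; [exact: bset_cube|exact: bset_cball|].
  move=> z Xz pz; rewrite /cball/=; apply: cube_diam pz => //.
  by apply: icube_cube; apply: inner; rewrite eucl_dist0 mulr_ge0// ltW// mulr_gt0.
have sgR : 0 < sg * Rr by rewrite mulr_gt0.
have sgR1 : 22 * (22 * (sg * Rr)) <= Rr.
  by have := ler_wpM2l (ltW Rr0) sg1; lra.
have Mpos : 0 < cmass S o T sh p.
  apply: lt_le_trans (_ : A^-1 * Rr ^+ d <= _).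
    by rewrite mulr_gt0 ?invr_gt0// exprn_gt0.
  apply: le_trans (sm_ball_ge Xx1 ox1 _ _) _ => //; first by lra.
  apply: sm_le; [exact: bset_cball|exact: bset_cube|].
  by move=> z Xz xz; apply: icube_cube; apply: inner; rewrite eucl_distC -/t -/Rr; apply: le_trans xz _; lra.
pose sd := side T (p.1 + N); pose del := n%:R * sd + 2 * sd.
have dele : del <= sg * Rr / 100.
  have n2 : 0 < n%:R + 2 :> R by lra.
  rewrite /del /sd sideD -/t.
  have -> : n%:R * (t * (2 ^+ N)^-1) + 2 * (t * (2 ^+ N)^-1) = (n%:R + 2) * t * (2 ^+ N)^-1 by ring.
  have h := ler_wpM2l (ltW (mulr_gt0 n2 t0)) (HN0 N N0N); apply: le_trans h _.
  rewrite le_eqVlt; apply/orP; left; apply/eqP; rewrite /Rr; by field; rewrite gt_eqF.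
pose h := sg / 4 * Rr.
have h0 : 0 <= h by rewrite /h ltW// mulr_gt0// divr_gt0.
have hE : h = sg * Rr / 4 by rewrite /h; ring.
set m := sm S o.
have b1 : Rr / 2 + del <= 5 / 8 * Rr by clear -dele sgR sgR1 hE Rr0; clearbody del h sg Rr; lra.
have b2 : 2 * (sg * Rr) + h + 3 * del < 4 * (sg * Rr) by clear -dele sgR sgR1 hE Rr0; clearbody del h sg Rr; lra.
have b3 : Rr / 4 + del <= 5 / 16 * Rr by clear -dele sgR sgR1 hE Rr0; clearbody del h sg Rr; lra.
have b4 : sg * Rr + h + 3 * del < 2 * (sg * Rr) by clear -dele sgR sgR1 hE Rr0; clearbody del h sg Rr; lra.
pose lv := level e x1.
have step1 : alp * m (lv (2 * (sg * Rr)) (Rr / 2)) <=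
    ((4 * (sg * Rr)) / (Rr - 5 / 8 * Rr)) ^+ d * m (lv (4 * (sg * Rr)) Rr) + 3 * (w * cmass S o T sh p).
  apply: (truncation_step (Rr := Rr) (h := h) T0 n0 d0 e3 w_0 g Mpos inner h0 below) => //;
    clear -sgR sgR1 Rr0; clearbody sg Rr; lra.
have step2 : alp * m (lv (sg * Rr) (Rr / 4)) <=
    ((2 * (sg * Rr)) / (Rr / 2 - 5 / 16 * Rr)) ^+ d * m (lv (2 * (sg * Rr)) (Rr / 2)) + 3 * (w * cmass S o T sh p).
  apply: (truncation_step (Rr := Rr) (h := h) T0 n0 d0 e3 w_0 g Mpos inner h0 below) => //;
    clear -sgR sgR1 Rr0; clearbody sg Rr; lra.
have q1 : 4 * (sg * Rr) / (Rr - 5 / 8 * Rr) = 32 / 3 * sg.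
  by clear -Rr0; clearbody Rr; field; rewrite gt_eqF//; lra.
have q2 : 2 * (sg * Rr) / (Rr / 2 - 5 / 16 * Rr) = 32 / 3 * sg.
  by clear -Rr0; clearbody Rr; field; rewrite gt_eqF//; lra.
have q3 : 0 <= 32 / 3 * sg <= 11 * sg by clear -sg0; clearbody sg; apply/andP; split; lra.
have weaken (q L : R) : 0 <= L -> q = 32 / 3 * sg -> q ^+ d * L <= (11 * sg) ^+ d * L.
  by move=> L0 ->; case/andP: q3 => q3 q4; rewrite ler_wpM2r// lerXn2r// nnegrE//; exact: le_trans q4.
have {}step1 := le_trans step1 (lerD (weaken _ _ (sm_ge0 _ _ _) q1) (lexx _)).
have {}step2 := le_trans step2 (lerD (weaken _ _ (sm_ge0 _ _ _) q2) (lexx _)).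
have low : A^-1 * (sg * Rr) ^+ d <= m (lv (sg * Rr) (Rr / 4)).
  apply: le_trans (sm_ball_ge Xx1 ox1 sgR _) _; first by lra.
  apply: sm_le; [exact: bset_cball|exact: bset_level|].
  move=> z Xz xz; have xz' : eucl_dist x1 z <= sg * Rr := xz.
  split; first by rewrite eucl_distC; lra.
  have := lin_lip x1 z e3; lra.
have up : m (lv (4 * (sg * Rr)) Rr) <= A * Rr ^+ d.
  apply: le_trans (sm_ball_le Xx1 ox1 Rr0 _); last by lra.
  apply: sm_le; [exact: bset_level|exact: bset_cball|].
  by move=> z Xz [xz _]; rewrite /cball/= eucl_distC.
pose K := (11 * sg) ^+ d.
have K0 : 0 <= K by rewrite exprn_ge0// mulr_ge0// ltW.
have K1 : K <= 1 by clear -sg0 sg1; rewrite exprn_ile1//; clearbody sg; lra.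
have m1 : 0 <= m (lv (2 * (sg * Rr)) (Rr / 2)) by exact: sm_ge0.
pose W := w * cmass S o T sh p.
have W0 : 0 <= W by rewrite mulr_ge0// ltW.
have final : alp ^+ 2 * (A^-1 * (sg * Rr) ^+ d) <= K * (K * (A * Rr ^+ d)) + 6 * W.
  have h1 : alp * (alp * (A^-1 * (sg * Rr) ^+ d)) <= alp * (K * m (lv (2 * (sg * Rr)) (Rr / 2)) + 3 * W).
    rewrite ler_pM2l//; apply: le_trans step2; by rewrite ler_pM2l.
  have h2 : K * (alp * m (lv (2 * (sg * Rr)) (Rr / 2))) <= K * (K * (A * Rr ^+ d) + 3 * W).
    by apply: ler_wpM2l => //; apply: le_trans step1 _; rewrite lerD2r; exact: ler_wpM2l.
  have h3 : K * W <= W by rewrite ler_piMl.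
  have h4 : alp * W <= W by rewrite ler_piMl.
  rewrite expr2 -mulrA; lra.
have Wle : 6 * W <= alp ^+ 2 / 4 * (A^-1 * (sg * Rr) ^+ d).
  apply: (@le_trans _ _ (6 * (w0 * (A * (n%:R * t) ^+ d)))).
    by rewrite ler_pM2l// ler_pM// ltW.
  rewrite le_eqVlt; apply/orP; left; apply/eqP; rewrite /w0 /Rr !exprMn.
  by field; rewrite ?expf_neq0 ?gt_eqF.
have Kle : K * (K * (A * Rr ^+ d)) <= alp ^+ 2 / 4 * (A^-1 * (sg * Rr) ^+ d).
  have KK : K * K <= sg ^+ d * (11 * (11 * sg)).
    rewrite /K -exprMn.
    have -> : 11 * sg * (11 * sg) = sg * (11 * (11 * sg)) by ring.
    rewrite exprMn (ler_pM2l (exprn_gt0 _ sg0)).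
    have x0 : 0 <= 11 * (11 * sg) by clear -sg0; clearbody sg; lra.
    have x1' : 11 * (11 * sg) <= 1 by clear -sg0 sg1; clearbody sg; lra.
    by rewrite -(prednK d0) exprS ler_piMr// exprn_ile1.
  have AR : 0 <= A * Rr ^+ d by rewrite mulr_ge0 ?exprn_ge0// ltW.
  have -> : K * (K * (A * Rr ^+ d)) = K * K * (A * Rr ^+ d) by ring.
  apply: le_trans (ler_wpM2r AR KK) _.
  rewrite le_eqVlt; apply/orP; left; apply/eqP; rewrite -sgE /B [(sg * Rr) ^+ d]exprMn [(22 * A) ^+ 2]exprMn.
  by field; rewrite ?expf_neq0 ?gt_eqF.
have pos : 0 < alp ^+ 2 * (A^-1 * (sg * Rr) ^+ d).
  by rewrite mulr_gt0// mulr_gt0 ?invr_gt0// exprn_gt0.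
have := le_trans final (lerD Kle Wle).
have -> : alp ^+ 2 / 4 * (A^-1 * (sg * Rr) ^+ d) = alp ^+ 2 * (A^-1 * (sg * Rr) ^+ d) / 4 by rewrite mulrAC.
exact: absurd.
Qed.

(** * Strips, holes and touching hyperplanes *)

Section Frames.
Context {R : realType} {n : nat}.
Implicit Types (u v : 'rV[R]_n).

Definition orthonormal_rows k (F : 'M[R]_(k, n)) : Prop := F *m F^T = 1%:M.

Lemma dotp_mx u v : dotp u v = (u *m v^T) ord0 ord0.
Proof. by rewrite mxE; apply: eq_bigr => i _; rewrite !mxE. Qed.

Lemma coef_dotp k (F : 'M[R]_(k, n)) u i : (u *m F^T) ord0 i = dotp (row i F) u.
Proof. by rewrite mxE; apply: eq_bigr => j _; rewrite !mxE mulrC. Qed.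

End Frames.

Section FrameTheory.
Context {R : realType}.

Lemma dotp_adjE n k (F : 'M[R]_(k, n)) (a : 'rV[R]_k) (u : 'rV[R]_n) :
  dotp (a *m F) u = dotp a (u *m F^T).
Proof. by rewrite !dotp_mx trmx_mul trmxK mulmxA. Qed.

Lemma enorm_frame n k (F : 'M[R]_(k, n)) (a : 'rV[R]_k) : orthonormal_rows F ->
  enorm (a *m F) = enorm a.
Proof. by move=> oF; rewrite /enorm dotp_adjE -mulmxA oF mulmx1. Qed.

Lemma bessel n k (F : 'M[R]_(k, n)) (u : 'rV[R]_n) : orthonormal_rows F ->
  enorm (u *m F^T) <= enorm u.
Proof.
move=> oF; have [->|h] := eqVneq (enorm (u *m F^T)) 0; first exact: enorm_ge0.
have h0 : 0 < enorm (u *m F^T) by rewrite lt_neqAle eq_sym h enorm_ge0.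
rewrite -(ler_pM2l h0) -expr2 enorm_sqr -dotp_adjE.
by apply: le_trans (dotp_le _ _) _; rewrite enorm_frame.
Qed.

Lemma frame_extension n k (F : 'M[R]_(k, n)) : (k < n)%N ->
  exists2 nu : 'rV[R]_n, enorm nu = 1 & nu *m F^T = 0.
Proof.
move=> kn; have : kermx F^T != 0.
  by rewrite kermx_eq0 /row_free mxrank_tr; apply: contraTneq kn => <-; rewrite -leqNgt rank_leq_row.
case/rowV0Pn => v /sub_kermxP vF v0.
have nv : enorm v != 0 by rewrite enorm_eq0.
exists ((enorm v)^-1 *: v); last by rewrite -scalemxAl vF scaler0.
by rewrite enormZ ger0_norm ?invr_ge0 ?enorm_ge0// mulVf.
Qed.

Lemma orthonormal_col_mx n k l (F : 'M[R]_(k, n)) (G : 'M[R]_(l, n)) :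
  orthonormal_rows F -> orthonormal_rows G -> G *m F^T = 0 -> orthonormal_rows (col_mx F G).
Proof.
move=> oF oG GF; rewrite /orthonormal_rows tr_col_mx mul_col_row oF oG GF.
have -> : F *m G^T = 0 by rewrite -[LHS]trmxK trmx_mul trmxK GF trmx0.
by rewrite scalar_mx_block.
Qed.

Lemma orthonormal_unit n (nu : 'rV[R]_n) : enorm nu = 1 -> orthonormal_rows nu.
Proof.
by move=> h; apply/matrixP => i j; rewrite !ord1 -dotp_mx -enorm_sqr h expr1n mxE.
Qed.

Lemma frame_complement n k m (F : 'M[R]_(k, n)) : orthonormal_rows F -> (k + m <= n)%N ->
  exists2 G : 'M[R]_(m, n), orthonormal_rows G & G *m F^T = 0.
Proof.
move=> oF; elim: m => [|m ih] km.
  by exists 0; [apply/matrixP => -[]|exact: mul0mx].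
have [|G oG GF] := ih; first by rewrite -ltnS -addnS ltnW.
have [|nu nu1] := @frame_extension _ _ (col_mx F G); first by rewrite -addnS.
rewrite tr_col_mx mul_mx_row -row_mx0 => /eq_row_mx[nuF nuG].
exists (col_mx nu G : 'M[R]_(1 + m, n)).
  have Gnu : G *m nu^T = 0 by rewrite -[LHS]trmxK trmx_mul trmxK nuG trmx0.
  exact: (orthonormal_col_mx (orthonormal_unit nu1) oG Gnu).
by have : col_mx nu G *m F^T = 0 by rewrite mul_col_mx nuF GF col_mx0.
Qed.

Lemma parseval n k m (F : 'M[R]_(k, n)) (G : 'M[R]_(m, n)) (u : 'rV[R]_n) : (k + m = n)%N ->
  orthonormal_rows F -> orthonormal_rows G -> G *m F^T = 0 ->
  enorm u ^+ 2 = enorm (u *m F^T) ^+ 2 + enorm (u *m G^T) ^+ 2.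
Proof.
move=> e; subst n => oF oG GF; rewrite !enorm_sqr.
have oB := orthonormal_col_mx oF oG GF.
have E : u = u *m (col_mx F G)^T *m col_mx F G by rewrite -mulmxA (mulmx1C oB) mulmx1.
rewrite {1}E dotp_adjE tr_col_mx mul_mx_row /dotp big_split_ord /=.
by congr (_ + _); apply: eq_bigr => i _; rewrite ?row_mxEl ?row_mxEr.
Qed.

Lemma parseval_le n k m (F : 'M[R]_(k, n)) (G : 'M[R]_(m, n)) (u : 'rV[R]_n) : (k + m = n)%N ->
  orthonormal_rows F -> orthonormal_rows G -> G *m F^T = 0 ->
  enorm u <= enorm (u *m F^T) + enorm (u *m G^T).
Proof.
move=> kmn oF oG GF; rewrite -(ler_pXn2r (ltn0Sn 1)) ?nnegrE ?enorm_ge0 ?addr_ge0 ?enorm_ge0//.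
rewrite (parseval u kmn oF oG GF) sqrrD addrAC lerDl.
by rewrite mulrn_wge0// mulr_ge0 ?enorm_ge0.
Qed.

End FrameTheory.

Lemma sm_cover {R : realType} (n d : nat) (A lam : R) (osc : R -> R) (S : @space R n d A lam osc) o
    (I : finType) (P : pred I) (B : set 'rV[R]_n) (F : I -> set 'rV[R]_n) :
  bset B -> (forall i, bset (F i)) -> (forall x, sX S x -> B x -> exists2 i, P i & F i x) ->
  sm S o B <= \sum_(i | P i) sm S o (F i).
Proof.
move=> mB mF cov; rewrite -big_filter -/(index_enum I).
apply: msr_cover; [exact: bset_sdom|exact: fin_sdom|exact: mB|exact: mF|].
move=> x [Xx _] Bx; have [i Pi Fi] := cov x Xx Bx.
have ir : i \in [seq i <- index_enum I | P i] by rewrite mem_filter Pi mem_index_enum.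
by exists (index i [seq i <- index_enum I | P i]); [rewrite index_mem|exists i; rewrite nth_index].
Qed.

Lemma cell_diam {R : realType} (m K : nat) (rho : R) (a b : 'rV[R]_m) : 0 < rho ->
  (forall i, `|a ord0 i| <= rho) -> (forall i, `|b ord0 i| <= rho) ->
  (forall i, Num.truncn ((a ord0 i / rho + 1) * K.+1%:R) = Num.truncn ((b ord0 i / rho + 1) * K.+1%:R)) ->
  enorm (a - b) <= m%:R * (rho / K.+1%:R).
Proof.
move=> rho0 ha hb ab; apply: enorm_le_sup => i; rewrite !mxE.
have K0 : 0 < K.+1%:R :> R by rewrite ltr0n.
have pos (c : R) : `|c| <= rho -> 0 <= (c / rho + 1) * K.+1%:R.
  rewrite ler_norml => /andP[h _]; apply: mulr_ge0 => //.
  have : -1 <= c / rho by rewrite ler_pdivlMr// mulN1r.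
  lra.
have h1 := truncn_itv (pos _ (ha i)); have h2 := truncn_itv (pos _ (hb i)).
move: h1 h2; rewrite ab; set q := Num.truncn _; rewrite -[q.+1%:R]natr1 => /andP[h1 h2] /andP[h3 h4].
have E : a ord0 i - b ord0 i = ((a ord0 i / rho + 1) * K.+1%:R - (b ord0 i / rho + 1) * K.+1%:R) * (rho / K.+1%:R).
  by field; rewrite gt_eqF//= gt_eqF.
have q0 : 0 <= rho / K.+1%:R by rewrite divr_ge0// ltW.
rewrite E normrM [X in _ * X]ger0_norm//; apply: ler_piMl => //; rewrite ler_norml.
move: h1 h2 h3 h4; move: ((a _ _ / _ + 1) * _) ((b _ _ / _ + 1) * _) (q%:R : R) => x y z h1 h2 h3 h4.
by apply/andP; split; lra.
Qed.

Lemma natr_gt {R : realType} (x : R) : exists K : nat, x < K.+1%:R.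
Proof. by exists (Num.truncn x); exact: truncnS_gt. Qed.

(* A neighbourhood of an [m]-plane is covered by [~ K ^ m] balls of radius [rho / K], which carry mass
   at most [~ K ^ m * (rho / K) ^ d]. *)
Lemma not_in_strip {R : realType} (n d k m : nat) (A lam : R) (osc : R -> R) :
  1 <= A -> (k + m = n)%N -> (m < d)%N -> exists2 bet : R, 0 < bet &
  forall (S : @space R n d A lam osc) o x0 rho (F : 'M[R]_(k, n)), orthonormal_rows F ->
  sX S x0 -> eucl_dist o x0 <= srm S / 4 -> 0 < rho <= srm S / 4 ->
  ~ (forall y, sX S y -> eucl_dist x0 y <= rho -> enorm ((y - x0) *m F^T) <= bet * rho).
Proof.
move=> A1 kmn md; have A0 : 0 < A by apply: lt_le_trans A1.
(* At most [3 ^ d * K.+1 ^ m] balls are needed, each of mass at most [A * r ^ d]. As [m < d], for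
   this [K] the total is below [A^-1 * rho ^ d]. *)
have [K hK] := natr_gt (A ^+ 2 * (3 * (m%:R + 2)) ^+ d).
have K0 : 0 < K.+1%:R :> R by rewrite ltr0n.
have m2 : 2 <= m%:R + 2 :> R by rewrite lerDr.
exists K.+1%:R^-1; first by rewrite invr_gt0.
move=> S o x0 rho F oF Xx0 ox0 /andP[rho0 rhos] H.
have [|G oG GF] := @frame_complement R n k m F oF; first by rewrite kmn.
pose c y := (y - x0) *m G^T.
have cle y i : eucl_dist x0 y <= rho -> `|c y ord0 i| <= rho.
  move=> xy; apply: le_trans (coord_le_enorm _ _) _; apply: le_trans (bessel _ oG) _.
  by rewrite -eucl_distE eucl_distC.
pose code y : {ffun 'I_m -> 'I_(2 * K.+1).+1} :=
  [ffun i => inord (Num.truncn ((c y ord0 i / rho + 1) * K.+1%:R))].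
(* Two points with the same code differ by at most [rho / K.+1] in each of the [m] coordinates along
   the plane, and their deviations from it add at most [2 * rho / K.+1]. *)
pose r := (m%:R + 2) * (rho / K.+1%:R).
have r0 : 0 < r by rewrite mulr_gt0 ?divr_gt0//; apply: lt_le_trans m2.
have codeP y z : sX S y -> sX S z -> eucl_dist x0 y <= rho -> eucl_dist x0 z <= rho ->
    code y = code z -> eucl_dist y z <= r.
  move=> Xy Xz xy xz /ffunP yz.
  have -> : y = x0 + (y - x0) by rewrite addrC subrK.
  have -> : z = x0 + (z - x0) by rewrite addrC subrK.
  rewrite eucl_distE opprD addrACA subrr add0r.
  apply: le_trans (parseval_le _ kmn oF oG GF) _; rewrite !(mulmxBl (y - x0) (z - x0)).
  have h1 : enorm ((y - x0) *m F^T - (z - x0) *m F^T) <= 2 * (rho / K.+1%:R).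
    apply: le_trans (enormD _ _) _; rewrite enormN.
    by rewrite mulr_natl mulr2n; apply: lerD; rewrite (mulrC rho); exact: H.
  rewrite /r mulrDl [leRHS]addrC; apply: lerD => //; apply: (@cell_diam _ _ _ _ (c y) (c z) rho0) => i; try exact: cle.
  have := yz i; rewrite !ffunE => /(congr1 val) /=.
  have tr w : eucl_dist x0 w <= rho -> (Num.truncn ((c w ord0 i / rho + 1) * K.+1%:R) < (2 * K.+1).+1)%N.
    move=> xw; have := cle w i xw; rewrite ler_norml => /andP[q1 q2].
    have q3 : c w ord0 i / rho + 1 <= 2.
      have : c w ord0 i / rho <= 1 by rewrite ler_pdivrMr// mul1r.
      lra.
    have q4 := ler_wpM2r (ltW K0) q3.
    rewrite -(ltr_nat R); apply: (@le_lt_trans _ _ (2 * K.+1%:R)); last by rewrite -natrM ltr_nat.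
    apply: le_trans q4.
    have q5 : 0 <= (c w ord0 i / rho + 1) * K.+1%:R.
      apply: mulr_ge0 => //; have : -1 <= c w ord0 i / rho by rewrite ler_pdivlMr// mulN1r.
      lra.
    by case/andP: (truncn_itv q5).
  by rewrite !inordK ?tr.
pose P a y := [/\ sX S y, eucl_dist x0 y <= rho & code y = a].
have pickP a : exists y, (exists z, P a z) -> P a y.
  by have [[z Pz]|N] := pselect (exists z, P a z); [exists z|exists x0].
have [pt hpt] := choice pickP.
have rs : r <= srm S / 2.
  have : (m%:R + 2) / K.+1%:R <= 1 :> R.
    rewrite ler_pdivrMr// mul1r; apply: le_trans (ltW hK).
    have e1 : 1 <= A ^+ 2 by rewrite exprn_ege1.
    have e2 : m%:R + 2 <= (3 * (m%:R + 2) :> R) ^+ d.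
      have h1 : 1 <= 3 * (m%:R + 2) :> R by lra.
      have h2 := ler_weXn2l h1 (leq_ltn_trans (leq0n m) md); rewrite expr1 in h2; lra.
    by apply: le_trans e2 _; rewrite ler_peMl// exprn_ge0//; lra.
  move=> h; have := ler_wpM2r (ltW rho0) h.
  have -> : (m%:R + 2) / K.+1%:R * rho = r by rewrite /r; ring.
  lra.
have cov : sm S o (cball x0 rho) <= ((2 * K.+1).+1%:R ^+ m * (A * r ^+ d))%R.
  apply: (@le_trans _ _ (\sum_(a : {ffun 'I_m -> 'I_(2 * K.+1).+1} | `[< exists z, P a z >]) sm S o (cball (pt a) r))).
    apply: sm_cover; [exact: bset_cball|by move=> a; exact: bset_cball|].
    move=> y Xy xy; have Py : P (code y) y by [].
    exists (code y); first by apply/asboolP; exists y.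
    have [Xp xp cp] := hpt (code y) (ex_intro _ y Py).
    by apply: codeP => //; exact: xy.
  apply: (@le_trans _ _ (\sum_(a : {ffun 'I_m -> 'I_(2 * K.+1).+1}) A * r ^+ d)).
    rewrite [leRHS](bigID (fun a => `[< exists z, P a z >])) /=.
    rewrite -[leLHS]addr0 lerD// ?sumr_ge0//; last by move=> a _; rewrite mulr_ge0 ?exprn_ge0 ?ltW.
    apply: ler_sum => a /asboolP/hpt [Xp xp _]; apply: sm_ball_le => //.
    have := eucl_dist_tri x0 o (pt a); lra.
  by rewrite sumr_const card_ffun !card_ord -(mulr_natl (A * r ^+ d)) natrX.
have ox0' : eucl_dist o x0 <= srm S / 2 by have := eucl_dist_ge0 o x0; lra.
have rhos' : rho <= srm S / 2 by lra.
have {cov} := le_trans (sm_ball_ge Xx0 ox0' rho0 rhos') cov.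
have rd0 : 0 < A^-1 * rho ^+ d by rewrite mulr_gt0 ?invr_gt0 ?exprn_gt0.
have E1 : (2 * K.+1).+1%:R ^+ m <= 3 ^+ d * K.+1%:R ^+ m :> R.
  apply: (@le_trans _ _ ((3 * K.+1%:R) ^+ m)).
    rewrite lerXn2r ?nnegrE// ?mulr_ge0//.
    by rewrite -natrM ler_nat -add1n (mulnDl 1 2) mul1n leq_add2r.
  by rewrite exprMn ler_wpM2r ?exprn_ge0//; apply: ler_weXn2l; [lra|exact: ltnW].
have E2 : K.+1%:R ^+ m * K.+1%:R <= K.+1%:R ^+ d :> R.
  by rewrite -exprSr; apply: ler_weXn2l => //; rewrite ler1n.
have E3 : 3 ^+ d * K.+1%:R ^+ m * (A * r ^+ d) < A^-1 * rho ^+ d.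
  have -> : 3 ^+ d * K.+1%:R ^+ m * (A * r ^+ d) =
    A^-1 * rho ^+ d * (K.+1%:R ^+ m * (A ^+ 2 * (3 * (m%:R + 2)) ^+ d) / K.+1%:R ^+ d).
    rewrite /r !exprMn exprVn; field; rewrite ?expf_neq0 ?gt_eqF//.
  rewrite -[ltRHS]mulr1 ltr_pM2l// ltr_pdivrMr ?exprn_gt0// mul1r.
  by apply: lt_le_trans E2; rewrite ltr_pM2l ?exprn_gt0.
move=> E4; have := le_lt_trans (le_trans E4 (ler_wpM2r _ E1)) E3.
have -> : 0 <= A * r ^+ d by rewrite mulr_ge0 ?exprn_ge0// ltW.
by rewrite ltxx => /(_ isT).
Qed.

Lemma sm_packing {R : realType} (n d : nat) (A lam : R) (osc : R -> R) (S : @space R n d A lam osc) o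
    (I : finType) (P : pred I) (B : set 'rV[R]_n) (F : I -> set 'rV[R]_n) :
  bset B -> (forall i, bset (F i)) -> (forall i x, P i -> F i x -> B x) ->
  (forall i j x, P i -> P j -> F i x -> F j x -> i = j) ->
  \sum_(i | P i) sm S o (F i) <= sm S o B.
Proof.
move=> mB mF FB dF.
have bF i : bbm (ind (F i)) by exact: bbm_ind.
rewrite /sm /msr -big_filter -Lf_sum//; [|exact: bset_sdom|exact: fin_sdom].
apply: Lf_le => //; [exact: bset_sdom|exact: fin_sdom|exact: bbm_sum|exact: bbm_ind|].
move=> x _; rewrite big_filter.
have [[i Pi Fi]|N] := pselect (exists2 i, P i & F i x); last first.
  rewrite big1 ?ind_ge0// => i Pi; rewrite ind_out// => Fi; apply: N; by exists i.
rewrite (bigD1 i)//= big1 ?addr0 ?(ind_in (FB _ _ Pi Fi)) ?ind_le1// => j /andP[Pj ji].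
by rewrite ind_out// => Fj; move: ji; rewrite (dF j i x)// eqxx.
Qed.

(* More than [d] orthonormal directions leave room for a grid with too many points to be all close
   to the [d]-regular set. *)
Lemma hole {R : realType} (n d k : nat) (A lam : R) (osc : R -> R) :
  1 <= A -> (k + d < n)%N -> exists2 c : R, 0 < c <= 1 / 8 &
  forall (S : @space R n d A lam osc) o x0 rho (F : 'M[R]_(k, n)), orthonormal_rows F ->
  sX S x0 -> eucl_dist o x0 <= srm S / 4 -> 0 < rho <= srm S / 8 ->
  exists z, [/\ (z - x0) *m F^T = 0, eucl_dist x0 z <= rho / 8 &
    forall y, sX S y -> c * rho < eucl_dist z y].
Proof.
move=> A1 kdn; have A0 : 0 < A by apply: lt_le_trans A1.
have n0 : (0 < n)%N by apply: leq_trans kdn.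
have nn0 : 1 <= n%:R :> R by rewrite ler1n.
(* If every grid point had a point of [X] within [s / 4], the balls of radius [s / 8] around these
   points would be disjoint. This [K] makes the total mass of the [K.+1 ^ d.+1] balls exceed
   [A * rho ^ d]. *)
have [K hK] := natr_gt (A ^+ 2 * (8 * (8 * n%:R)) ^+ d).
have K1 : 1 <= K.+1%:R :> R by rewrite ler1n.
pose q : R := n%:R * K.+1%:R.
have q1 : 1 <= q by rewrite /q -[leLHS]mulr1; apply: ler_pM.
have q0 : 0 < q by apply: lt_le_trans q1.
exists (32 * q)^-1.
  rewrite invr_gt0 mulr_gt0//= mul1r lef_pV2 ?posrE//; [lra|by rewrite mulr_gt0].
move=> S o x0 rho F oF Xx0 ox0 /andP[rho0 rhos].
have [|G oG GF] := @frame_complement R n k d.+1 F oF; first by rewrite addnS.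
pose s := rho / (8 * q).
have s0 : 0 < s by rewrite divr_gt0// mulr_gt0.
have sq : s * q = rho / 8 by rewrite /s; field; rewrite gt_eqF.
pose v (a : {ffun 'I_d.+1 -> 'I_K.+1}) : 'rV[R]_d.+1 := \row_i (s * (a i)%:R).
pose z a := x0 + v a *m G.
have zx a : (z a - x0) *m F^T = 0 by rewrite /z addrC addrA addNr add0r -mulmxA GF mulmx0.
have zd a : eucl_dist x0 (z a) <= rho / 8.
  rewrite eucl_distE enormB /z addrC addrA addNr add0r enorm_frame//.
  have h : forall i, `|v a ord0 i| <= s * K.+1%:R.
    move=> i; rewrite mxE normrM (ger0_norm (ltW s0)) normr_nat; apply: ler_wpM2l; first exact: ltW.
    by rewrite ler_nat ltnW.
  apply: le_trans (enorm_le_sup h) _; rewrite -sq.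
  have -> : d.+1%:R * (s * K.+1%:R) = s * (d.+1%:R * K.+1%:R) by ring.
  rewrite ler_pM2l// ler_wpM2r// ler_nat.
  by apply: leq_trans kdn; rewrite ltnS leq_addl.
have zsep a b : a != b -> s <= eucl_dist (z a) (z b).
  move=> ab; have [i abi] : exists i, a i != b i.
    by apply/existsP; apply: contraR ab; rewrite negb_exists => /forallP H; apply/eqP/ffunP => i; apply/eqP; rewrite -[_ == _]negbK H.
  rewrite eucl_distE /z opprD addrACA subrr add0r -mulmxBl enorm_frame//.
  apply: le_trans (coord_le_enorm _ i); rewrite !mxE -mulrBr normrM ger0_norm ?(ltW s0)// ler_peMr ?(ltW s0)//.
  wlog h : a b {ab abi} / (b i < a i)%N => [W|].
    by move: abi; rewrite -val_eqE neq_ltn => /orP[h|h]; [rewrite distrC|]; exact: W.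
  by rewrite -natrB ?(ltnW h)// normr_nat ler1n subn_gt0.
have [[a Ha]|N] := pselect (exists a, forall y, sX S y -> s / 4 < eucl_dist (z a) y).
  exists (z a); split => // y Xy; suff -> : (32 * q)^-1 * rho = s / 4 by exact: Ha.
  by rewrite /s; field; rewrite gt_eqF.
have pickP a : exists y, sX S y /\ eucl_dist (z a) y <= s / 4.
  apply: contrapT => H; apply: N; exists a => y Xy; rewrite ltNge; apply/negP => h; apply: H; by exists y.
have [pt hpt] := choice pickP.
have ss : s <= rho / 8 by rewrite -sq ler_peMr// ltW.
have ox0' : eucl_dist o x0 <= srm S / 2 by have := eucl_dist_ge0 o x0; lra.
have ptx a : eucl_dist x0 (pt a) <= rho / 4.
  have [_ h] := hpt a; have := eucl_dist_tri (z a) x0 (pt a); have := zd a; lra.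
have low : \sum_(a : {ffun 'I_d.+1 -> 'I_K.+1}) A^-1 * (s / 8) ^+ d <= sm S o (cball x0 rho).
  apply: (@le_trans _ _ (\sum_(a : {ffun 'I_d.+1 -> 'I_K.+1}) sm S o (cball (pt a) (s / 8)))).
    apply: ler_sum => a _; have [Xp _] := hpt a; apply: sm_ball_ge => //; [|lra|lra].
    have := eucl_dist_tri x0 o (pt a); have := ptx a; lra.
  apply: sm_packing; [exact: bset_cball|by move=> a; exact: bset_cball| |].
    move=> a y _ ya; have ya' : eucl_dist (pt a) y <= s / 8 := ya.
    rewrite /cball/=; have := eucl_dist_tri (pt a) x0 y; have := ptx a; lra.
  move=> a b y _ _ ya yb; apply/eqP; rewrite -[_ == _]negbK; apply/negP => ab.
  have ya' : eucl_dist (pt a) y <= s / 8 := ya.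
  have yb' : eucl_dist (pt b) y <= s / 8 := yb.
  have h1 := zsep _ _ ab; have [_ h2] := hpt a; have [_ h3] := hpt b.
  have h4 := eucl_dist_tri (pt a) (z a) (z b); have h5 := eucl_dist_tri y (pt a) (z b).
  have h6 := eucl_dist_tri (pt b) y (z b); rewrite (eucl_distC y (pt b)) in h6; rewrite (eucl_distC (pt b) (z b)) in h6.
  lra.
have rhos' : rho <= srm S / 2 by lra.
have := le_trans low (sm_ball_le Xx0 ox0' rho0 rhos').
rewrite sumr_const card_ffun !card_ord -(mulr_natl (A^-1 * _)) natrX exprS => E.
have : A * rho ^+ d < K.+1%:R * K.+1%:R ^+ d * (A^-1 * (s / 8) ^+ d).
  have -> : K.+1%:R * K.+1%:R ^+ d * (A^-1 * (s / 8) ^+ d) = A^-1 * rho ^+ d * (K.+1%:R / (8 * (8 * n%:R)) ^+ d).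
    rewrite /s /q !exprMn !exprVn !exprMn; field; rewrite ?expf_neq0 ?gt_eqF//; lra.
  have -> : A * rho ^+ d = A^-1 * rho ^+ d * A ^+ 2 by field; rewrite gt_eqF.
  rewrite ltr_pM2l ?mulr_gt0 ?invr_gt0 ?exprn_gt0// ltr_pdivlMr//.
  by rewrite exprn_gt0//; apply: mulr_gt0 => //; apply: mulr_gt0 => //; exact: lt_le_trans nn0.
by rewrite ltNge E.
Qed.

(* A point of [X] almost nearest to the centre of a hole sees [X] on one side of a hyperplane. *)
Lemma touching {R : realType} (n d k : nat) (A lam : R) (osc : R -> R) (om : R) :
  1 <= A -> (k + d < n)%N -> 0 < om <= 1 -> exists tau kap : R, [/\ 0 < tau <= 1 / 4, 0 < kap &
  forall (S : @space R n d A lam osc) o x0 rho (F : 'M[R]_(k, n)), orthonormal_rows F ->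
  sX S x0 -> eucl_dist o x0 <= srm S / 4 -> 0 < rho <= srm S / 8 ->
  (forall y, sX S y -> eucl_dist x0 y <= rho -> enorm ((y - x0) *m F^T) <= kap * rho) ->
  exists x1 nu, [/\ sX S x1, eucl_dist x0 x1 <= rho / 2, enorm nu = 1, nu *m F^T = 0 &
    forall y, sX S y -> eucl_dist x1 y <= 2 * (tau * rho) -> dotp nu (y - x1) <= om * (tau * rho)]].
Proof.
move=> A1 kdn /andP[om0 om1].
have [c /andP[c0 c1] Hc] := hole lam osc A1 kdn.
(* With this [tau] the quadratic error [(2 * tau * rho) ^ 2 / (2 * (c * rho))] between a sphere and
   its tangent plane is an eighth of [om * tau * rho]. The choice of [kap] keeps the error from the
   component of the normal along the frame below the same amount. *)
pose tau := om * c / 16; pose kap := om * tau * c / 16.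
have tau0 : 0 < tau by rewrite !mulr_gt0// ?invr_gt0.
have kap0 : 0 < kap by rewrite /kap !mulr_gt0// ?invr_gt0.
have omc : om * c <= c by rewrite ler_piMl// ltW.
have tau1 : tau <= 1 / 4 by rewrite /tau; lra.
have omtau : om * tau <= tau by rewrite ler_piMl// ltW.
have kapc : kap <= c / 16.
  rewrite /kap ler_pM2r ?invr_gt0// ler_piMl// ?(ltW c0)//; lra.
exists tau, kap; split => //; first by rewrite tau0.
move=> S o x0 rho F oF Xx0 ox0 rhos strip; have /andP[rho0 rhos'] := rhos.
have [z [zF zx hz]] := Hc S o x0 rho F oF Xx0 ox0 rhos.
(* An almost nearest point is enough, so no compactness is involved; its defect [eps] is a third
   error of the same size. *)
pose eps := om * tau * rho / 8.
have eps0 : 0 < eps by rewrite /eps divr_gt0// !mulr_gt0.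
have epsr : eps <= rho / 8.
  rewrite /eps ler_pM2r ?invr_gt0// ler_piMl// ?(ltW rho0)//; lra.
have [x1 [Xx1 hx1]] : exists x1, sX S x1 /\ forall y, sX S y -> eucl_dist z x1 <= eucl_dist z y + eps.
  pose D := [set eucl_dist z y | y in sX S].
  have Dlb : has_lbound D by exists 0 => _ [y _ <-]; exact: eucl_dist_ge0.
  have [|_ [x1 Xx1 <-] h] := @inf_adherent _ D _ eps0.
    by split => //; exists (eucl_dist z x0), x0.
  exists x1; split => // y Xy; apply: le_trans (ltW h) _; rewrite lerD2r.
  by apply: ge_inf => //; exists y.
pose r := eucl_dist z x1.
have rlo : c * rho < r by exact: hz.
have cr0 : 0 < c * rho by rewrite mulr_gt0.
have r0 : 0 < r by lra.
have rup : r <= rho / 4 by have := hx1 x0 Xx0; rewrite (eucl_distC z x0); rewrite -/r; lra.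
have x01 : eucl_dist x0 x1 <= rho / 2 by have := eucl_dist_tri z x0 x1; rewrite -/r; lra.
pose nu0 := r^-1 *: (z - x1).
have nu01 : enorm nu0 = 1.
  by rewrite enormZ -eucl_distE -/r ger0_norm ?invr_ge0 ?(ltW r0)// mulVf// gt_eqF.
(* The normal has to be orthogonal to the frame. The centre [z] has no frame coordinates relative to
   [x0] and those of [x1] are small by the strip hypothesis, so removing the frame component changes
   little. *)
pose q := nu0 *m F^T; pose nu1 := nu0 - q *m F.
have nu1F : nu1 *m F^T = 0 by rewrite mulmxBl -mulmxA oF mulmx1 subrr.
have qle : enorm q <= kap / c.
  have zE : z - x1 = (z - x0) - (x1 - x0) by rewrite opprB addrA subrK.
  rewrite /q -scalemxAl zE mulmxBl zF sub0r scalerN enormN enormZ ger0_norm ?invr_ge0 ?(ltW r0)//.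
  rewrite mulrC ler_pdivrMr//.
  apply: le_trans (strip x1 Xx1 _) _; first by lra.
  have -> : kap * rho = kap / c * (c * rho) by field; rewrite gt_eqF.
  by apply: ler_wpM2l; [rewrite divr_ge0// ltW|exact: ltW].
have q16 : kap / c <= 1 / 16 by rewrite ler_pdivrMr//; lra.
have nu1lo : 1 / 2 <= enorm nu1.
  have : enorm nu0 <= enorm nu1 + enorm q.
    rewrite -(enorm_frame q oF); apply: le_trans (enormD _ _).
    by rewrite /nu1 subrK.
  rewrite nu01; lra.
have nu1pos : 0 < enorm nu1 by lra.
exists x1, ((enorm nu1)^-1 *: nu1); split => //.
- by rewrite enormZ ger0_norm ?invr_ge0 ?(ltW nu1pos)// mulVf// gt_eqF.
- by rewrite -scalemxAl nu1F scaler0.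
move=> y Xy x1y.
have tr0 : 0 < tau * rho by rewrite mulr_gt0.
have trr : tau * rho <= 1 / 4 * rho by rewrite ler_pM2r.
have x0y : eucl_dist x0 y <= rho by have := eucl_dist_tri x1 x0 y; lra.
rewrite dotpZl mulrC ler_pdivrMr//.
have main : dotp nu1 (y - x1) <= om * (tau * rho) / 2.
  have E : dotp nu1 (y - x1) = dotp nu0 (y - x1) - dotp q ((y - x1) *m F^T).
    by rewrite /nu1 dotpBl dotp_adjE.
  have h1 : - dotp q ((y - x1) *m F^T) <= kap / c * (2 * (kap * rho)).
    apply: le_trans (ler_norm _) _; rewrite normrN; apply: le_trans (dotp_abs _ _) _.
    apply: ler_pM => //; try exact: enorm_ge0.
    have -> : y - x1 = (y - x0) - (x1 - x0) by rewrite opprB addrA subrK.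
    rewrite mulmxBl; apply: le_trans (enormD _ _) _; rewrite enormN.
    have x01' : eucl_dist x0 x1 <= rho by lra.
    have := strip y Xy x0y; have := strip x1 Xx1 x01'; lra.
  have h2 : dotp nu0 (y - x1) <= (2 * (tau * rho)) ^+ 2 / (2 * (c * rho)) + eps.
    have hy := hx1 y Xy.
    have sq : r ^+ 2 - 2 * dotp (z - x1) (y - x1) + eucl_dist x1 y ^+ 2 = eucl_dist z y ^+ 2.
      have zE : z - y = (z - x1) - (y - x1) by rewrite opprB addrA subrK.
      rewrite /r !eucl_distE zE (enormB x1); move: (z - x1) (y - x1) => a b.
      by rewrite !enorm_sqr dotpBl !dotpBr (dotpC b a); ring.
    have le2 : (r - eps) ^+ 2 <= eucl_dist z y ^+ 2.
      have [re|re] := leP eps r.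
        by rewrite lerXn2r ?nnegrE ?subr_ge0 ?eucl_dist_ge0//; rewrite -/r in hy; lra.
      have : eps <= c * rho.
        have -> : eps = om * tau / 8 * rho by rewrite /eps; ring.
        apply: ler_wpM2r; first exact: ltW.
        have : tau <= c / 16 by rewrite /tau; lra.
        lra.
      lra.
    have le3 : eucl_dist x1 y ^+ 2 <= (2 * (tau * rho)) ^+ 2.
      by rewrite lerXn2r ?nnegrE ?eucl_dist_ge0// mulr_ge0// ltW.
    have e2 := sqr_ge0 eps.
    have le4 : dotp (z - x1) (y - x1) <= (2 * (tau * rho)) ^+ 2 / 2 + r * eps.
      have : (r - eps) ^+ 2 = r ^+ 2 - 2 * (r * eps) + eps ^+ 2 by ring.
      lra.
    rewrite /nu0 dotpZl mulrC ler_pdivrMr// mulrDl (mulrC eps).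
    apply: le_trans le4 _; rewrite lerD2r; move: (_ ^+ 2 : R) (sqr_ge0 (2 * (tau * rho))) => Q Q0.
    have -> : Q / (2 * (c * rho)) * r = Q / 2 * (r / (c * rho)) by field; rewrite !gt_eqF.
    by apply: ler_peMr; [rewrite divr_ge0|rewrite ler_pdivlMr// mul1r ltW].
  rewrite E; have h3 : (2 * (tau * rho)) ^+ 2 / (2 * (c * rho)) = om * (tau * rho) / 8.
    have -> : om * (tau * rho) / 8 = 2 * (om * c / 16) * (tau * rho) / c by field; rewrite gt_eqF.
    by rewrite -/tau; field; rewrite !gt_eqF.
  have h4 : kap / c * (2 * (kap * rho)) <= om * (tau * rho) / 8.
    have -> : kap / c * (2 * (kap * rho)) = om * (tau * rho) / 8 * kap by rewrite {1}/kap; field; rewrite gt_eqF.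
    rewrite ler_piMr//; [by rewrite divr_ge0// mulr_ge0// ltW|lra].
  have h5 : eps = om * (tau * rho) / 8 by rewrite /eps; ring.
  have otr : 0 < om * (tau * rho) by rewrite mulr_gt0.
  lra.
apply: le_trans main _; rewrite ler_pM2l ?mulr_gt0//; lra.
Qed.

Lemma enorm_row_mx {R : realType} k l (a : 'rV[R]_k) (b : 'rV[R]_l) :
  enorm (row_mx a b) <= enorm a + enorm b.
Proof.
rewrite -(ler_pXn2r (ltn0Sn 1)) ?nnegrE ?enorm_ge0 ?addr_ge0 ?enorm_ge0// sqrrD !enorm_sqr.
have -> : dotp (row_mx a b) (row_mx a b) = dotp a a + dotp b b.
  by rewrite /dotp big_split_ord; congr (_ + _); apply: eq_bigr => i _; rewrite ?row_mxEl ?row_mxEr.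
by rewrite addrAC lerDl mulrn_wge0// mulr_ge0 ?enorm_ge0.
Qed.

(* If two frames of maximal codimension disagreed, the set would lie in strips in too many directions. *)
Lemma frame_angle {R : realType} (n d c : nat) (A lam : R) (osc : R -> R) :
  1 <= A -> (0 < d)%N -> (c + d = n)%N -> exists2 bet : R, 0 < bet &
  forall (S : @space R n d A lam osc) o x0 rho (F F' : 'M[R]_(c, n)),
  orthonormal_rows F -> orthonormal_rows F' ->
  sX S x0 -> eucl_dist o x0 <= srm S / 4 -> 0 < rho <= srm S / 4 ->
  (forall y, sX S y -> eucl_dist x0 y <= rho -> enorm ((y - x0) *m F^T) <= bet * rho) ->
  (forall y, sX S y -> eucl_dist x0 y <= rho -> enorm ((y - x0) *m F'^T) <= bet * rho) ->
  forall u : 'rV[R]_n, enorm (u *m F'^T) <= enorm u / 4 -> enorm (u *m F^T) <= enorm u / 2.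
Proof.
move=> A1 d0 cdn; have cdn' : (1 + c + d.-1 = n)%N by rewrite add1n addSnnS prednK.
have dd : (d.-1 < d)%N by rewrite prednK.
have [bet0 b0 Hb] := not_in_strip lam osc A1 cdn' dd.
(* One ninth pays for the coordinates along [F'] and eight ninths for the additional direction
   [g]. *)
exists (bet0 / 9); first by rewrite divr_gt0.
move=> S o x0 rho F F' oF oF' Xx0 ox0 rhos sF sF' u uF'; have /andP[rho0 _] := rhos.
rewrite leNgt; apply/negP => uF.
pose a := u *m F^T; have aU : enorm a <= enorm u by exact: bessel.
have U0 : 0 < enorm u by have := enorm_ge0 u; rewrite -/a in uF; lra.
(* [g0] is the part orthogonal to [F'] of the projection of [u] to the span of [F]. When [u] is
   almost orthogonal to [F'] but not to [F], it is not small. Normalised and added to [F'], it gives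
   one more strip direction than [not_in_strip] permits. *)
pose w := a *m F; pose b := w *m F'^T; pose g0 := w - b *m F'.
have wa : enorm w = enorm a by exact: enorm_frame.
have ba : enorm b <= enorm a by rewrite -wa; exact: bessel.
have g0F : g0 *m F'^T = 0 by rewrite mulmxBl -[b *m F' *m _]mulmxA oF' mulmx1 subrr.
have g0E v : dotp g0 v = dotp a (v *m F^T) - dotp b (v *m F'^T).
  by rewrite /g0 dotpBl (dotp_adjE F a) (dotp_adjE F' b).
have h1 : dotp g0 u = enorm a ^+ 2 - dotp b (u *m F'^T).
  by rewrite g0E -/a enorm_sqr.
have h2 : dotp b (u *m F'^T) <= enorm a * (enorm u / 4).
  by apply: le_trans (dotp_le _ _) _; apply: ler_pM => //; exact: enorm_ge0.
have h3 : enorm a * (enorm u / 2) <= enorm a ^+ 2.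
  by rewrite expr2 ler_wpM2l ?enorm_ge0// ltW.
have h4 : dotp g0 u <= enorm g0 * enorm u by exact: dotp_le.
have g0lo : enorm a / 4 <= enorm g0.
  by rewrite -(ler_pM2r U0); move: h1 h2 h3 h4; lra.
have a0 : 0 < enorm a by rewrite -/a in uF; lra.
have g00 : 0 < enorm g0 by lra.
pose g := (enorm g0)^-1 *: g0.
have g1 : enorm g = 1 by rewrite enormZ ger0_norm ?invr_ge0 ?(ltW g00)// mulVf// gt_eqF.
have gF : F' *m g^T = 0.
  by rewrite -[LHS]trmxK trmx_mul trmxK /g -scalemxAl g0F scaler0 trmx0.
have oG := orthonormal_col_mx (orthonormal_unit g1) oF' gF.
apply: (Hb S o x0 rho _ oG Xx0 ox0 rhos) => y Xy xy.
rewrite tr_col_mx mul_mx_row; apply: le_trans (enorm_row_mx _ _) _.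
have s1 := sF y Xy xy; have s2 := sF' y Xy xy.
suff : enorm ((y - x0) *m g^T) <= 8 * (bet0 / 9 * rho) by lra.
have -> : enorm ((y - x0) *m g^T) = `|dotp g (y - x0)|.
  by rewrite dotpC dotp_mx; move: (_ *m g^T) => v; rewrite /enorm /dotp big_ord1 -expr2 sqrtr_sqr.
rewrite dotpZl normrM ger0_norm ?invr_ge0 ?(ltW g00)// mulrC ler_pdivrMr//.
rewrite g0E; apply: le_trans (ler_normB _ _) _.
have k1 := dotp_abs a ((y - x0) *m F^T); have k2 := dotp_abs b ((y - x0) *m F'^T).
have br0 : 0 <= bet0 / 9 * rho by rewrite mulr_ge0 ?(ltW rho0)// ltW// divr_gt0.
have k3 : enorm a * enorm ((y - x0) *m F^T) <= enorm a * (bet0 / 9 * rho) by rewrite ler_pM2l.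
have k4 : enorm b * enorm ((y - x0) *m F'^T) <= enorm a * (bet0 / 9 * rho).
  by apply: ler_pM => //; exact: enorm_ge0.
have k5 := ler_wpM2r br0 g0lo; lra.
Qed.

Lemma enorm_le_coord {R : realType} n (u v : 'rV[R]_n) :
  (forall i, `|u ord0 i| <= `|v ord0 i|) -> enorm u <= enorm v.
Proof.
move=> H; rewrite ler_sqrt ?dotpp_ge0//; apply: ler_sum => i _.
by rewrite -!expr2 -(real_normK (num_real (u _ _))) -(real_normK (num_real (v _ _))) lerXn2r ?nnegrE.
Qed.

(** Unit vectors are scaled by [1 / 3] to fit the bound on the boundary data [e]. *)
Definition net {R : realType} n (h : R) (Nt : seq 'rV[R]_n) : Prop :=
  (forall e, e \in Nt -> enorm e <= 1 / 3) /\
  forall u, enorm u = 1 -> exists2 e, e \in Nt & enorm (3^-1 *: u - e) <= h.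

(** The coordinates are rounded towards zero on a grid, with the sign stored separately; so rounding
    does not increase the norm. *)
Lemma net_exists {R : realType} n (h : R) : 0 < h -> exists Nt : seq 'rV[R]_n, net h Nt.
Proof.
move=> h0; pose s := h / n.+1%:R; have s0 : 0 < s by rewrite divr_gt0 ?ltr0n.
have [K hK] := natr_gt (1 / s).
pose vec (a : {ffun 'I_n -> 'I_K.+1 * bool}) : 'rV[R]_n := \row_i ((-1) ^+ (a i).2 * ((a i).1%:R * s)).
pose Nt := [seq e <- [seq vec a | a : {ffun 'I_n -> 'I_K.+1 * bool}] | enorm e <= 1 / 3].
exists Nt; split => [e|u u1]; first by rewrite mem_filter => /andP[].
pose v := 3^-1 *: u.
have v13 : enorm v = 3^-1 by rewrite enormZ u1 mulr1 ger0_norm// invr_ge0.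
pose a : {ffun 'I_n -> 'I_K.+1 * bool} := [ffun i => (inord (Num.truncn (`|v ord0 i| / s)), v ord0 i < 0)].
have tr i : [/\ (Num.truncn (`|v ord0 i| / s) < K.+1)%N, (Num.truncn (`|v ord0 i| / s))%:R * s <= `|v ord0 i|
    & `|v ord0 i| < (Num.truncn (`|v ord0 i| / s))%:R * s + s].
  have q0 : 0 <= `|v ord0 i| / s by rewrite divr_ge0// ltW.
  have /andP[q1 q2] := truncn_itv q0; split.
  - rewrite -(ltr_nat R); apply: le_lt_trans q1 _; apply: le_lt_trans hK.
    rewrite ler_pM2r ?invr_gt0//; apply: le_trans (coord_le_enorm _ _) _; rewrite v13; lra.
  - by rewrite -ler_pdivlMr.
  - by rewrite -[X in _ + X]mul1r -mulrDl natr1 -ltr_pdivrMr.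
have vE i : vec a ord0 i = (-1) ^+ (v ord0 i < 0)%R * ((Num.truncn (`|v ord0 i| / s))%:R * s).
  by have [h1 _ _] := tr i; rewrite mxE ffunE /= inordK.
have na i : `|vec a ord0 i| <= `|v ord0 i|.
  have [_ h1 _] := tr i; rewrite vE normrM normr_sign mul1r ger0_norm//.
  by rewrite mulr_ge0// ltW.
exists (vec a).
  rewrite mem_filter (le_trans (enorm_le_coord na)) ?v13 ?mul1r//=.
  by apply/mapP; exists a => //; rewrite mem_enum.
have -> : h = n.+1%:R * s by rewrite /s mulrC divfK// gt_eqF// ltr0n.
apply: (@le_trans _ _ (n%:R * s)); last by rewrite ler_pM2r// ler_nat.
apply: enorm_le_sup => i; rewrite -/v mxE [X in _ + X]mxE vE.
have [_ h1 h2] := tr i.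
have -> : v ord0 i - (-1) ^+ (v ord0 i < 0)%R * ((Num.truncn (`|v ord0 i| / s))%:R * s) =
   (-1) ^+ (v ord0 i < 0)%R * (`|v ord0 i| - (Num.truncn (`|v ord0 i| / s))%:R * s).
  by rewrite mulrBr [X in X - _ = _](numEsign (v ord0 i)).
by rewrite normrM normr_sign mul1r ger0_norm ?subr_ge0//; lra.
Qed.

Lemma enorm_coef_le {R : realType} n k (F : 'M[R]_(k, n)) (u : 'rV[R]_n) (b : R) :
  (k <= n)%N -> 0 <= b -> (forall i, `|dotp (row i F) u| <= b) -> enorm (u *m F^T) <= n%:R * b.
Proof.
move=> kn b0 H; have h : forall i, `|(u *m F^T) ord0 i| <= b by move=> i; rewrite coef_dotp.
by apply: le_trans (enorm_le_sup h) _; rewrite ler_wpM2r// ler_nat.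
Qed.

Lemma net_dotp {R : realType} n (f e u : 'rV[R]_n) (h b : R) :
  enorm (3^-1 *: f - e) <= h -> `|dotp e u| <= b -> `|dotp f u| <= 3 * b + 3 * (h * enorm u).
Proof.
move=> fe eu; have -> : dotp f u = 3 * dotp e u + 3 * dotp (3^-1 *: f - e) u.
  by rewrite dotpBl dotpZl; field.
apply: le_trans (ler_normD _ _) _; rewrite !normrM (ger0_norm (ler0n _ 3)).
have h1 := dotp_abs (3^-1 *: f - e) u.
have h2 := ler_wpM2r (enorm_ge0 u) fe; lra.
Qed.

(** The rows of an exact orthonormal frame are only approximated by net vectors: bad cubes are
    defined through finitely many directions, and only for those is the density controlled. *)
Definition null_frame_at {R : realType} {n d : nat} {A lam : R} {osc : R -> R}
    (S : @space R n d A lam osc) o T sh p (Nt : seq 'rV[R]_n) (h alp : R) k (F : 'M[R]_(k, n)) : Prop :=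
  orthonormal_rows F /\ forall i, exists e, [/\ e \in Nt, enorm (3^-1 *: row i F - e) <= h &
    cdens S o T sh e p < alp].

Lemma frame_strip {R : realType} (n d : nat) (A lam : R) (osc : R -> R) (th kap : R) :
  (0 < n)%N -> 1 <= A -> 1 <= lam -> (forall k : R, 0 < k -> 0 < osc k) -> 0 < th <= 1 -> 0 < kap <= 1 ->
  exists alp w0 h0 (N0 : nat), [/\ 0 < alp, 0 < w0, 0 < h0 &
  forall (S : @space R n d A lam osc) o T sh p x0 Nt h N w k (F : 'M[R]_(k, n)), (k <= n)%N ->
  zone S o T -> sX S x0 -> eucl_dist o x0 <= srm S / 2 -> deep o T sh th p x0 ->
  net h Nt -> h <= h0 -> (N0 <= N)%N -> 0 < w <= w0 ->
  (forall e, e \in Nt -> good S o T sh e N w p) -> null_frame_at S o T sh p Nt h alp F ->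
  forall y, sX S y -> eucl_dist x0 y <= th / (2 * lam) * side T p.1 ->
    enorm ((y - x0) *m F^T) <= kap * (th / (2 * lam) * side T p.1)].
Proof.
move=> n0 A1 lam1 osc0 th01 /andP[k0 k1]; have /andP[th0 th1] := th01.
have lam0 : 0 < lam by apply: lt_le_trans lam1.
have nn1 : 1 <= n%:R :> R by rewrite ler1n.
have nn0 : 0 < n%:R :> R by rewrite ltr0n.
pose c := th / (2 * lam).
have c0 : 0 < c by rewrite divr_gt0// mulr_gt0.
have c1 : c <= 1 by rewrite ler_pdivrMr ?mulr_gt0//; lra.
pose k1' := kap * c / (6 * n%:R).
have k10 : 0 < k1' by rewrite /k1' divr_gt0// mulr_gt0.
have k11 : k1' <= 1.
  rewrite ler_pdivrMr ?mulr_gt0//; have : kap * c <= 1 by rewrite mulr_ile1 ?(ltW k0) ?(ltW c0).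
  lra.
have k101 : 0 < k1' <= 1 by rewrite k10.
have [alp [w0 [N0 [a0 w00 H]]]] := strip d n0 A1 lam1 osc0 th01 k101.
pose h0 := kap / (6 * n%:R).
have h00 : 0 < h0 by rewrite /h0 divr_gt0// mulr_gt0.
exists alp, w0, h0, N0; split => // S o T sh p x0 Nt h N w k F kn zn Xx0 ox0 dp [N3 _] hh0 NN ww gd [oF nF] y Xy xy.
have [T0 _] := zn; have t0 : 0 < side T p.1 by exact: side_gt0.
set rho := th / (2 * lam) * side T p.1.
have rho0 : 0 < rho by rewrite mulr_gt0.
have -> : kap * rho = n%:R * (3 * (k1' * side T p.1) + 3 * (h0 * rho)).
  by rewrite /k1' /h0 /rho /c; field; rewrite ?gt_eqF.
apply: enorm_coef_le => // [|i].
  by apply: addr_ge0; apply: mulr_ge0 => //; apply: mulr_ge0; exact: ltW.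
have [e [eN fe qe]] := nF i.
have he := H S o T sh p x0 e N w zn Xx0 ox0 dp (N3 e eN) NN ww (gd e eN) qe y Xy xy.
have eu : `|dotp e (y - x0)| <= k1' * side T p.1 by rewrite dotpBr.
apply: le_trans (net_dotp fe eu) _; rewrite lerD2l ler_pM2l//.
apply: ler_pM => //; [by apply: le_trans fe; exact: enorm_ge0|exact: enorm_ge0|].
by rewrite -eucl_distE eucl_distC.
Qed.

Lemma null_frame_mono {R : realType} {n d : nat} {A lam : R} {osc : R -> R}
    (S : @space R n d A lam osc) o T sh p Nt (h alp alp' : R) k (F : 'M[R]_(k, n)) :
  alp <= alp' -> null_frame_at S o T sh p Nt h alp F -> null_frame_at S o T sh p Nt h alp' F.
Proof.
move=> aa [oF H]; split => // i; have [e [h1 h2 h3]] := H i; exists e; split => //.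
exact: lt_le_trans aa.
Qed.

(* Induction on the number of null directions: while there are fewer than [n - d] of them, the set
   has a touching hyperplane orthogonal to them, and its normal is null by [not_one_sided]. *)
Lemma null_frame {R : realType} (n d : nat) (A lam : R) (osc : R -> R) (th : R) k :
  (0 < d)%N -> 1 <= A -> 1 <= lam -> (forall k : R, 0 < k -> 0 < osc k) -> 0 < th <= 1 ->
  (k + d <= n)%N -> forall alp : R, 0 < alp -> exists w0 h0 (N0 : nat), [/\ 0 < w0, 0 < h0 &
  forall (S : @space R n d A lam osc) o T sh p x0 Nt h N w,
  zone S o T -> sX S x0 -> eucl_dist o x0 <= srm S / 4 -> deep o T sh th p x0 ->
  net h Nt -> h <= h0 -> (N0 <= N)%N -> 0 < w <= w0 ->
  (forall e, e \in Nt -> good S o T sh e N w p) ->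
  exists F : 'M[R]_(k, n), null_frame_at S o T sh p Nt h alp F].
Proof.
move=> d0 A1 lam1 osc0 th01 kd; have /andP[th0 th1] := th01.
have n0 : (0 < n)%N by apply: leq_trans d0 _; apply: leq_trans kd; exact: leq_addl.
elim: k kd => [|k ih] kd alp a0.
  exists 1, 1, 0%N; split => // S o T sh p x0 Nt h N w _ _ _ _ _ _ _ _ _.
  by exists 0; split; [apply/matrixP => -[]|case].
wlog a1 : alp a0 / alp <= 1 => [W|].
  have m0 : 0 < Num.min alp 1 by rewrite lt_min a0 ltr01.
  have [|w0 [h0 [N0 [w00 h00 H]]]] := W (Num.min alp 1) m0; first by rewrite ge_min lexx orbT.
  exists w0, h0, N0; split => // S o T sh p x0 Nt h N w z Xx ox dp nt hh NN ww gd.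
  have [F HF] := H S o T sh p x0 Nt h N w z Xx ox dp nt hh NN ww gd.
  by exists F; apply: null_frame_mono HF; rewrite ge_min lexx.
have lam0 : 0 < lam by apply: lt_le_trans lam1.
have alp01 : 0 < alp <= 1 by rewrite a0.
have [om om01 Hom] := @not_one_sided R n d A lam osc alp n0 d0 A1 alp01.
have /andP[om0 om1] := om01.
have kdn : (k + d < n)%N by rewrite -addSn.
have [tau [kap [/andP[tau0 tau1] kap0 Htouch]]] := touching lam osc A1 kdn om01.
pose c := th / (2 * lam).
have c0 : 0 < c by rewrite divr_gt0// mulr_gt0.
have cth : c <= th / 2.
  by rewrite /c ler_pM2l// lef_pV2 ?posrE ?mulr_gt0// ler_peMr.
have tc01 : 0 < tau * c <= 1.
  by rewrite mulr_gt0// mulr_ile1 ?(ltW tau0) ?(ltW c0)//; lra.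
have [w1 [N1 [w10 Hone]]] := Hom _ tc01.
have kapm : 0 < Num.min kap 1 <= 1 by rewrite lt_min kap0 ltr01 ge_min lexx orbT.
have [alp2 [w2 [h2 [N2 [a20 w20 h20 Hstrip]]]]] :=
  @frame_strip R n d A lam osc th _ n0 A1 lam1 osc0 th01 kapm.
(* Densities below [alp2] give the strip that [touching] requires, and those below [alp] the
   conclusion. *)
have am0 : 0 < Num.min alp alp2 by rewrite lt_min a0.
have [w3 [h3 [N3 [w30 h30 Hih]]]] := ih (ltnW kd) _ am0.
exists (Num.min w1 (Num.min w2 w3)), (Num.min (om / 3) (Num.min h2 h3)), (maxn N1 (maxn N2 N3)).
split; [by rewrite !lt_min w10 w20|by rewrite !lt_min h20 h30 divr_gt0|].
move=> S o T sh p x0 Nt h N w zn Xx0 ox0 dp nt; rewrite !le_min !geq_max.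
move=> /and3P[hh1 hh2 hh3] /and3P[NN1 NN2 NN3] /and4P[w_0 ww1 ww2 ww3] gd.
have W1 : 0 < w <= w1 by rewrite w_0.
have W2 : 0 < w <= w2 by rewrite w_0.
have W3 : 0 < w <= w3 by rewrite w_0.
have [F nF] := Hih S o T sh p x0 Nt h N w zn Xx0 ox0 dp nt hh3 NN3 W3 gd.
have [T0 Tn] := zn; set t := side T p.1.
have t0 : 0 < t by exact: side_gt0.
have tT : t <= T by exact: side_le.
have nn1 : 1 <= n%:R :> R by rewrite ler1n.
have Ts : 100 * T <= srm S.
  by apply: le_trans Tn; rewrite ler_wpM2r ?(ltW T0)// ler_peMr.
have ox0' : eucl_dist o x0 <= srm S / 2 by move: ox0 (eucl_dist_ge0 o x0); clear -R; lra.
pose rho := c * t; have rho0 : 0 < rho by rewrite mulr_gt0.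
have rt : rho <= th * t / 2.
  by rewrite (_ : th * t / 2 = th / 2 * t) ?ler_pM2r//; ring.
have tht : th * t <= t by rewrite ler_piMl// ltW.
have rs : 0 < rho <= srm S / 8 by apply/andP; split => //; move: rt tht tT Ts T0; clear -R; lra.
have kn : (k <= n)%N by apply: ltnW; apply: leq_ltn_trans kdn; exact: leq_addr.
have [//|x1 [nu [Xx1 x01 nu1 nuF low]]] := Htouch S o x0 rho F nF.1 Xx0 ox0 rs.
  move=> y Xy xy.
  apply: le_trans (Hstrip S o T sh p x0 Nt h N w k F kn zn Xx0 ox0' dp nt hh2 NN2 W2 gd _ y Xy xy) _.
    by apply: null_frame_mono nF; rewrite ge_min lexx orbT.
  by rewrite ler_pM2r// ge_min lexx.
have [N13 Napp] := nt.
have [e eN ne] := Napp nu nu1.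
exists (col_mx nu F : 'M[R]_(1 + k, n)); split.
  apply: (orthonormal_col_mx (orthonormal_unit nu1) nF.1).
  by rewrite -[LHS]trmxK trmx_mul trmxK nuF trmx0.
suff ea : cdens S o T sh e p < alp.
  move=> i; case: (@split_ordP 1 k i) => j ->.
    by exists e; split => //; rewrite (rowKu j nu F) row_id.
  have [_ nF2] := nF; have [e' [h1 hr hd]] := nF2 j.
  by exists e'; split => //; [rewrite (rowKd j nu F)|apply: lt_le_trans hd _; rewrite ge_min lexx].
(* Otherwise [not_one_sided] applies at [x1]. The permitted height [om * (tau * rho)] is used up by
   one third from the scaled normal and two thirds from the mesh [om / 3] over the distance
   [2 * (tau * rho)]. *)
rewrite ltNge; apply/negP => ae.
have trE : tau * c * t = tau * rho by rewrite /rho mulrA.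
have tr0 : 0 < tau * rho by rewrite mulr_gt0.
have trr : tau * rho <= 1 / 4 * rho by rewrite ler_pM2r.
apply: (Hone S o T sh p x1 e N w zn Xx1 _ _ (N13 e eN) NN1 W1 (gd e eN) ae).
- move: (eucl_dist_tri x0 o x1) ox0 x01 rs Ts (eucl_dist_ge0 x0 x1); clear -R => h1 h2 h3 /andP[h4 h5] h6 h7; lra.
- move=> y; rewrite -/t trE => yx; apply: dp; rewrite -/t.
  have := eucl_dist_tri x1 x0 y; rewrite (eucl_distC x1 y); move: yx x01 trr rt tht rho0; clear -R; lra.
- move=> y Xy; rewrite -/t trE => yx; rewrite -subr_ge0.
  have yx' : eucl_dist x1 y <= 2 * (tau * rho) by rewrite eucl_distC.
  have l1 := low y Xy yx'.
  suff : dotp e (y - x1) <= om * (tau * rho) by rewrite dotpBr -/(lin e y) -/(lin e x1); move: (lin e y) (lin e x1); clear -R => a b; lra.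
  have -> : dotp e (y - x1) = 3^-1 * dotp nu (y - x1) - dotp (3^-1 *: nu - e) (y - x1).
    by rewrite dotpBl dotpZl; ring.
  have l2 : - dotp (3^-1 *: nu - e) (y - x1) <= om / 3 * (2 * (tau * rho)).
    apply: le_trans (ler_norm _) _; rewrite normrN; apply: le_trans (dotp_abs _ _) _.
    apply: ler_pM; [exact: enorm_ge0|exact: enorm_ge0|exact: le_trans hh1|by rewrite -eucl_distE].
  move: l1 l2; clear -R; move: (dotp _ _) (dotp _ _) => a b; lra.
Qed.

(** * Shifted grids and bad cubes *)

Section Shifts.
Context {R : realType} {n : nat}.
Variables (o : 'rV[R]_n) (T : R).
Hypothesis T0 : 0 < T.

(* Odd, and larger than the number [2 * n] of coordinates of two points, each of which rules out at
   most one shift. *)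
Definition nshift : nat := (2 * n).+1.
Definition shift (k : 'I_nshift) : R := k%:R / (4 * nshift%:R).
Definition margin : R := (4 * nshift%:R)^-1.

Lemma nshift_gt0 : 0 < nshift%:R :> R. Proof. by rewrite ltr0n. Qed.

Lemma margin_bounds : 0 < margin <= 1 / 4.
Proof.
have h : 1 <= nshift%:R :> R by rewrite ler1n.
rewrite /margin invr_gt0 mulr_gt0 ?nshift_gt0//= mul1r lef_pV2 ?posrE ?mulr_gt0 ?nshift_gt0//; lra.
Qed.

Lemma shift_bounds k : 0 <= shift k <= 1 / 4.
Proof.
have h : 0 < 4 * nshift%:R :> R by rewrite mulr_gt0 ?nshift_gt0.
rewrite /shift divr_ge0 ?(ltW h)//=; rewrite ler_pdivrMr//.
have : k%:R <= nshift%:R :> R by rewrite ler_nat; exact: ltnW (ltn_ord k).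
lra.
Qed.

Lemma nat_close (a b : nat) : `|a%:R - b%:R| <= 1 / 2 :> R -> a = b.
Proof.
wlog ab : a b / (a <= b)%N => [W|].
  by have [ab|/ltnW ba] := leqP a b; [exact: W|rewrite distrC => /(W _ _ ba) ->].
rewrite distrC -natrB// normr_nat => h.
have : (b - a < 1)%N by rewrite -(ltr_nat R); apply: le_lt_trans h _; lra.
rewrite ltnS leqn0 subn_eq0 => ba.
by apply/eqP; rewrite eqn_leq ab ba.
Qed.

Definition near_grid (a : R) (j : nat) (k : 'I_nshift) : Prop :=
  exists z : nat, `|2 ^+ j * (a - shift k) - z%:R| <= margin.

(* Multiplication by [2 ^ (j - 2)] permutes the residues modulo the odd number [nshift], so the
   shifted grids of generation [j] are [1 / nshift] apart. *)
Lemma near_grid_inj (a : R) j k k' : (2 <= j)%N -> near_grid a j k -> near_grid a j k' -> k = k'.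
Proof.
wlog kk : k k' / (k <= k')%N => [W|].
  by have [kk|/ltnW kk] := leqP k k'; [exact: W|move=> h1 h2 h3; rewrite (W _ _ kk h1 h3 h2)].
move=> j2 [z hz] [z' hz']; have m0 := nshift_gt0.
have E : (nshift * z' + 2 ^ (j - 2) * (k' - k))%N = (nshift * z)%N.
  apply: nat_close; rewrite (natrD R (nshift * z')) (natrM R nshift z') (natrM R nshift z).
  rewrite (natrM R (2 ^ (j - 2))) natrX natrB//.
  have -> : nshift%:R * z'%:R + 2 ^+ (j - 2) * (k'%:R - k%:R) - nshift%:R * z%:R =
     nshift%:R * ((2 ^+ j * (a - shift k) - z%:R) - (2 ^+ j * (a - shift k') - z'%:R)).
    rewrite -{2 3}(subnK j2) exprD /shift; field; rewrite gt_eqF//.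
  rewrite normrM (ger0_norm (ltW m0)).
  apply: (@le_trans _ _ (nshift%:R * (margin + margin))).
    by apply: ler_wpM2l; [exact: ltW|apply: le_trans (ler_normB _ _) _; exact: lerD].
  by rewrite le_eqVlt; apply/orP; left; apply/eqP; rewrite /margin; field; rewrite gt_eqF.
have : (nshift %| 2 ^ (j - 2) * (k' - k))%N.
  by rewrite -(dvdn_addr _ (dvdn_mulr z' (dvdnn nshift))) E dvdn_mulr.
rewrite Gauss_dvdr; last by apply: coprimeXr; rewrite coprimen2 /nshift /= oddM.
move=> dv; apply/val_inj/eqP; rewrite eqn_leq kk /= -subn_eq0.
have lt : (k' - k < nshift)%N by apply: leq_ltn_trans (leq_subr _ _) (ltn_ord k').
by rewrite -leqn0 leqNgt; apply/negP => /dvdn_leq /(_ dv); rewrite leqNgt lt.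
Qed.

Definition deep_cell k j (x : 'rV[R]_n) := deep o T (shift k) margin (cell o T (shift k) j x) x.

(** Shifts are at most [1 / 4], so all shifted coordinates are nonnegative, as [cell] needs. *)
Definition central (x : 'rV[R]_n) := forall i, 1 / 4 <= (x ord0 i - o ord0 i) / T + 2^-1.

Lemma central_gcoord x k i : central x -> 0 <= gcoord o T (shift k) x i.
Proof. by move=> /(_ i) h; have /andP[_ h2] := shift_bounds k; rewrite /gcoord; lra. Qed.

Lemma deep_cellP k j x : central x ->
  (forall i, ~ near_grid ((x ord0 i - o ord0 i) / T + 2^-1) j k) -> deep_cell k j x.
Proof.
move=> cx H y xy i; have g0 := central_gcoord k i cx.
have p0 : 0 < 2 ^+ j :> R by rewrite exprn_gt0.
rewrite /= ffunE; set z := Num.truncn _.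
have /andP[z1] : z%:R <= 2 ^+ j * gcoord o T (shift k) x i < z.+1%:R.
  by apply: truncn_itv; rewrite mulr_ge0// ltW.
rewrite -[z.+1%:R]natr1 => z2.
have l1 : margin < 2 ^+ j * gcoord o T (shift k) x i - z%:R.
  rewrite ltNge; apply/negP => h; apply: (H i); exists z.
  by rewrite ger0_norm ?subr_ge0.
have l2 : margin < z%:R + 1 - 2 ^+ j * gcoord o T (shift k) x i.
  rewrite ltNge; apply/negP => h; apply: (H i); exists z.+1.
  rewrite -[z.+1%:R]natr1 distrC ger0_norm; [exact: h|rewrite subr_ge0; exact: ltW z2].
have sE : 2 ^+ j * (T^-1 * (margin * side T j)) = margin.
  by rewrite /side; field; rewrite !gt_eqF.
have bnd u v : eucl_dist u v <= margin * side T j ->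
    2 ^+ j * gcoord o T (shift k) u i - 2 ^+ j * gcoord o T (shift k) v i <= margin.
  move=> uv; rewrite -mulrBr -sE; apply: ler_wpM2l; first exact: ltW.
  apply: le_trans (gcoord_lip o (shift k) T0 u v i) _; apply: ler_wpM2l; first by rewrite invr_ge0 ltW.
  by [].
have b1 := bnd x y xy; have b2 : _ := bnd y x _; rewrite eucl_distC in b2; have {}b2 := b2 xy.
by apply/andP; split; lra.
Qed.

(** The density at [x] in an early generation and at [y] in a later one can only be compared within
    one grid, so a single shift must suit both points. By the pigeonhole principle, the [2 * n]
    coordinates cannot exclude all [2 * n + 1] shifts. *)
Lemma common_deep j j' x x' : (2 <= j)%N -> (2 <= j')%N -> central x -> central x' ->
  exists k, deep_cell k j x /\ deep_cell k j' x'.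
Proof.
move=> j2 j2' cx cx'; pose a (b : bool) i := if b then (x ord0 i - o ord0 i) / T + 2^-1 else (x' ord0 i - o ord0 i) / T + 2^-1.
pose g (b : bool) := if b then j else j'.
have g2 b : (2 <= g b)%N by case: b.
have [[k Hk]|N] := pselect (exists k, forall b i, ~ near_grid (a b i) (g b) k).
  by exists k; split; apply: deep_cellP => // i; [exact: (Hk true)|exact: (Hk false)].
have bad k : exists bi : bool * 'I_n, near_grid (a bi.1 bi.2) (g bi.1) k.
  apply: contrapT => H; apply: N; exists k => b i h; apply: H; by exists (b, i).
have [f Hf] := choice bad.
have fI : injective f.
  move=> k k' e; apply: (@near_grid_inj (a (f k).1 (f k).2) (g (f k).1)) => //.
  by rewrite e; exact: Hf.
by have := leq_card f fI; rewrite card_prod card_bool !card_ord /nshift ltnn.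
Qed.

End Shifts.

Lemma bset_exists {R : realType} n (I : eqType) (r : seq I) (F : I -> set 'rV[R]_n) :
  (forall i, bset (F i)) -> bset [set x | exists2 i, i \in r & F i x].
Proof.
move=> mF; elim: r => [|i r ih].
  suff -> : [set x | exists2 i, i \in [::] & F i x] = set0 by exact: measurable0.
  by apply/seteqP; split => [x [i]|x//]; rewrite in_nil.
rewrite (_ : [set _ | _] = F i `|` [set x | exists2 i, i \in r & F i x]); first by apply: measurableU; [exact: mF|exact: ih].
apply/seteqP; split => x.
  by move=> [k]; rewrite inE => /predU1P[->|kr] Fk; [left|right; exists k].
by move=> [Fi|[k kr Fk]]; [exists i => //; exact: mem_head|exists k => //; rewrite inE kr orbT].
Qed.

Lemma sm_cover_seq {R : realType} (n d : nat) (A lam : R) (osc : R -> R) (S : @space R n d A lam osc) o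
    (I : eqType) (r : seq I) (B : set 'rV[R]_n) (F : I -> set 'rV[R]_n) :
  bset B -> (forall i, bset (F i)) -> (forall x, sX S x -> B x -> exists2 i, i \in r & F i x) ->
  sm S o B <= \sum_(i <- r) sm S o (F i).
Proof.
move=> mB mF cov; apply: msr_cover; [exact: bset_sdom|exact: fin_sdom|exact: mB|exact: mF|].
move=> x [Xx _] Bx; have [i ir Fi] := cov x Xx Bx.
by exists (index i r); [rewrite index_mem|exists i; rewrite nth_index].
Qed.

Section Events.
Context {R : realType} {n d : nat} {A lam : R} {osc : R -> R}.
Variables (S : @space R n d A lam osc) (o : 'rV[R]_n) (T : R) (Nt : seq 'rV[R]_n) (N : nat) (w eta del : R).
Implicit Types (x y e : 'rV[R]_n) (p : node (n := n)) (sh : R).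
Local Notation M := (cmass S o T).
Local Notation q := (cdens S o T).

Definition heavy sh p : bool := eta * side T p.1 ^+ d <= M sh p.
Definition restless sh e p : bool :=
  w ^+ 2 * M sh p < energy2 subnodes (M sh) (emin S o T sh e) N p - M sh p * q sh e p ^+ 2.

(* Resetting the reference density at heavy cubes only makes the mass of each reset comparable to
   that of its neighbourhood. *)
Fixpoint refdens sh e (j : nat) (z : {ffun 'I_n -> nat}) : R :=
  if j is j'.+1 then
    let c := refdens sh e j' [ffun i => (z i)./2] in
    if heavy sh (j, z) && (del < `|q sh e (j, z) - c|) then q sh e (j, z) else c
  else q sh e (0, z).

Definition jump sh e p : bool := if p.1 is j.+1 then
  heavy sh p && (del < `|q sh e p - refdens sh e j [ffun i => (p.2 i)./2]|) else false.

Definition event (r : 'I_(@nshift n) * node (n := n)) : bool :=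
  has (fun e => heavy (shift r.1) r.2 && (restless (shift r.1) e r.2 || jump (shift r.1) e r.2)) Nt.
Definition events j := [seq r <- allpairs pair (enum 'I_(@nshift n)) (desc subnodes j root) | event r].
Definition evset j : set 'rV[R]_n :=
  [set x | exists2 r, r \in events j & cube o T (shift r.1) r.2 x].
Definition near_cube j (r : 'I_(@nshift n) * node (n := n)) : set 'rV[R]_n :=
  [set y | exists2 x, cube o T (shift r.1) r.2 x & eucl_dist y x < 2 * side T j].
(** If a point lies in [evset j], the whole ball of radius [side T j] around it lies here. This lets
    the stopping argument charge one bad generation to all points near a stopped one. *)
Definition near_evset j : set 'rV[R]_n := [set x | exists2 r, r \in events j & near_cube j r x].

Lemma bset_evset j : 0 < T -> bset (evset j).
Proof. by move=> T0; apply: bset_exists => r; exact: bset_cube. Qed.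

Lemma bset_near_cube j r : bset (near_cube j r).
Proof.
apply: open_bset; rewrite (_ : near_cube j r =
  \bigcup_(x in cube o T (shift r.1) r.2) [set y | eucl_dist y x < 2 * side T j]).
  by apply: bigcup_open => x _; apply: open_eball.
by apply/seteqP; split => y [x h1 h2]; exists x.
Qed.

Lemma bset_near_evset j : bset (near_evset j).
Proof. by apply: bset_exists => r; exact: bset_near_cube. Qed.

Lemma evset_near j x y : 0 < T -> evset j x -> eucl_dist y x <= side T j -> near_evset j y.
Proof.
move=> T0 [r re rx] yx; exists r => //; exists x => //; apply: le_lt_trans yx _.
by have := side_gt0 T0 j; lra.
Qed.

Hypotheses (n0 : (0 < n)%N) (A1 : 1 <= A) (zn : zone S o T) (Xo : sX S o).
Hypotheses (eta0 : 0 < eta) (w0 : 0 < w) (del0 : 0 < del).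
Hypothesis Nt3 : forall e, e \in Nt -> enorm e <= 1 / 3.

Let T0 : 0 < T := proj1 zn.

Lemma root_cube x (k : 'I_(@nshift n)) : eucl_dist o x <= T / 8 -> cube o T (shift k) root x.
Proof.
move=> ox i; rewrite /= ffunE expr0 mul1r add0r /gcoord.
have /andP[s1 s2] := shift_bounds (R := R) k.
have : `|x ord0 i - o ord0 i| <= T / 8.
  apply: le_trans ox; rewrite eucl_distC eucl_distE; apply: le_trans (coord_le_enorm _ i).
  by rewrite !mxE.
rewrite ler_norml => /andP[h1 h2].
have g1 : (x ord0 i - o ord0 i) / T <= 1 / 8 by rewrite ler_pdivrMr//; lra.
have g2 : - (1 / 8) <= (x ord0 i - o ord0 i) / T by rewrite ler_pdivlMr//; lra.
by apply/andP; split; lra.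
Qed.

Lemma ntT : n%:R * T <= srm S / 100.
Proof. by have [_ h] := zn; rewrite ler_pdivlMr//; apply: le_trans h; rewrite mulrC mulrA. Qed.

Lemma desc_root_near sh j p x : cube o T sh root o -> p \in desc subnodes j root -> cube o T sh p x ->
  eucl_dist o x <= n%:R * T.
Proof.
move=> ro pd px; have := cube_diam T0 ro (desc_cube pd px).
by rewrite /side expr0 divr1.
Qed.

Lemma cmass_root (k : 'I_(@nshift n)) : M (shift k) root <= A * (n%:R * T) ^+ d.
Proof.
have ro : cube o T (shift k) root o by apply: root_cube; rewrite eucl_dist0; have := T0; lra.
have h := ntT; have nT0 : 0 < n%:R * T by rewrite mulr_gt0 ?ltr0n.
have oo : eucl_dist o o <= srm S / 2 by rewrite eucl_dist0; lra.
have nTs : n%:R * T <= srm S / 2 by lra.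
apply: le_trans (sm_ball_le Xo oo nT0 nTs).
apply: sm_le; [exact: bset_cube|exact: bset_cball|].
move=> z Xz rz; apply: (@desc_root_near (shift k) 0 root z ro) => //; exact: mem_head.
Qed.

(** The neighbourhood lies in a ball of radius [(n + 2) * t] around a point of [X] in the cube, and
    heaviness bounds [t ^ d] by the mass of the cube. *)
Lemma near_cube_mass j r : r.2 \in desc subnodes j root -> heavy (shift r.1) r.2 ->
  sm S o (near_cube j r) <= A * (n%:R + 2) ^+ d / eta * M (shift r.1) r.2.
Proof.
move=> rd hv; have lev := desc_level rd; rewrite /= add0n in lev.
set t := side T j; have t0 : 0 < t by exact: side_gt0.
have tT : t <= T by exact: side_le.
have A0 : 0 < A by apply: lt_le_trans A1.
have M0 : 0 < M (shift r.1) r.2.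
  by apply: lt_le_trans hv; rewrite mulr_gt0// exprn_gt0// side_gt0.
have [x Xx rx] : exists2 x, sX S x & cube o T (shift r.1) r.2 x.
  apply: contrapT => H; move: M0; rewrite ltNge => /negP; apply.
  rewrite /cmass /sm /msr -[leRHS](Lf0 (smu S) (bset_sdom S o)).
  apply: Lf_le; [exact: bset_sdom|exact: fin_sdom|by apply: bbm_ind; exact: bset_cube|exact: bbm_cst|].
  by move=> x [Xx _]; rewrite ind_out// => rx; apply: H; exists x.
have ro : cube o T (shift r.1) root o by apply: root_cube; rewrite eucl_dist0; have := T0; lra.
have ox := desc_root_near ro rd rx.
have h := ntT; have nn1 : 1 <= n%:R :> R by rewrite ler1n.
have TnT : T <= n%:R * T by rewrite ler_peMl// ltW.
have s0 : 0 < (n%:R + 2) * t by rewrite mulr_gt0//; lra.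
have s1 : (n%:R + 2) * t <= srm S / 2.
  have : n%:R * t <= n%:R * T by rewrite ler_pM2l// ltr0n.
  rewrite mulrDl; lra.
have ox' : eucl_dist o x <= srm S / 2 by lra.
apply: (@le_trans _ _ (A * ((n%:R + 2) * t) ^+ d)).
  apply: le_trans (sm_ball_le Xx ox' s0 s1).
  apply: sm_le; [exact: bset_near_cube|exact: bset_cball|].
  move=> y _ [z rz yz]; have := cube_diam T0 rx rz; rewrite lev -/t => xz.
  rewrite /cball/= mulrDl; rewrite -/t in yz.
  have := eucl_dist_tri z x y; rewrite (eucl_distC z y); lra.
move: hv; rewrite /heavy lev -/t => hv; rewrite exprMn.
have c0 : 0 <= A * (n%:R + 2) ^+ d / eta by rewrite divr_ge0 ?mulr_ge0 ?exprn_ge0 ?(ltW A0) ?(ltW eta0)//; lra.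
apply: le_trans (ler_wpM2l c0 hv).
by rewrite le_eqVlt; apply/orP; left; apply/eqP; field; rewrite gt_eqF.
Qed.

Local Notation D sh e := (emin S o T sh e).

Lemma restless_mass sh e J : enorm e <= 1 / 3 ->
  \sum_(j < J) \sum_(p <- desc subnodes j root | restless sh e p) M sh p <= N%:R / w ^+ 2 * M sh root.
Proof.
move=> e3; have w2 : 0 < w ^+ 2 by rewrite exprn_gt0.
have := @oscillating_mass R _ subnodes (M sh) (D sh e) (@cmass_ge0 R n d A lam osc S o T sh)
  (emin_ge0 S o T sh e3) (emin_le_mass S o sh T0 e3) (cmass_sub S o sh T0) (emin_sub S o sh T0 e3)
  _ N J root w2.
by move=> H; rewrite [leRHS]mulrAC ler_pdivlMr// mulrC.
Qed.

Lemma refdens01 sh e j z : enorm e <= 1 / 3 -> 0 <= refdens sh e j z <= 1.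
Proof.
move=> e3; have q01 p : 0 <= q sh e p <= 1 by rewrite (cdens_ge0 S o T sh e3) (cdens_le1 S o sh T0 e3).
by elim: j z => [|j ih] z //=; case: ifP.
Qed.

Lemma half_subnode p c : [ffun i => ((subnode p c).2 i)./2] = p.2.
Proof. by apply/ffunP => i; rewrite !ffunE addnC half_bit_double. Qed.

Lemma jump_mass_total sh e J : enorm e <= 1 / 3 ->
  \sum_(j < J) \sum_(p <- desc subnodes j root | jump sh e p) M sh p <= 2 / del ^+ 2 * M sh root.
Proof.
move=> e3; have del2 : 0 < del ^+ 2 by rewrite exprn_gt0.
have H := @jump_mass R _ subnodes (M sh) (D sh e) (@cmass_ge0 R n d A lam osc S o T sh)
  (emin_ge0 S o T sh e3) (emin_le_mass S o sh T0 e3) (cmass_sub S o sh T0) (emin_sub S o sh T0 e3)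
  (fun p => refdens sh e p.1 p.2) (jump sh e) _ del0.
have {}H := H (fun p => refdens01 sh p.1 p.2 e3) _ J root.
apply: (@le_trans _ _ (\sum_(j < J) \sum_(p <- desc subnodes j.+1 root | jump sh e p) M sh p)); last first.
  rewrite [leRHS]mulrAC ler_pdivlMr// mulrC; apply: H => t i it /=.
  have /mapP[c _ ->] : nth t (subnodes t) i \in subnodes t by exact: mem_nth.
  rewrite /jump /= -/(subnode t c) half_subnode.
  by case E: (heavy sh _ && _) => //; split => //; case/andP: E => _ /ltW.
case: J {H} => [|J]; first by rewrite !big_ord0.
rewrite big_ord_recl.
have -> : \sum_(p <- desc subnodes (@ord0 J) root | jump sh e p) M sh p = 0 by rewrite /= big_cons big_nil.
rewrite add0r big_ord_recr /= lerDl.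
by apply: sumr_ge0 => p _; exact: cmass_ge0.
Qed.

(** The packing estimate: the bound does not depend on [J]. Its factors count the shifts and the net
    vectors, and for each pair of these the tree estimates bound the restless and the jumping cubes
    by the mass of the root. *)
Lemma near_evset_mass J : \sum_(j < J) sm S o (near_evset j) <=
  A * (n%:R + 2) ^+ d / eta * ((@nshift n)%:R * ((size Nt)%:R *
    ((N%:R / w ^+ 2 + 2 / del ^+ 2) * (A * (n%:R * T) ^+ d)))).
Proof.
have A0 : 0 < A by apply: lt_le_trans A1.
set CC := A * _ / _; have CC0 : 0 <= CC by rewrite divr_ge0 ?mulr_ge0 ?exprn_ge0 ?(ltW A0) ?(ltW eta0)//; lra.
have M0 sh p : 0 <= M sh p by exact: cmass_ge0.
apply: (@le_trans _ _ (\sum_(j < J) CC * \sum_(k <- enum 'I_(@nshift n)) \sum_(p <- desc subnodes j root)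
   \sum_(e <- Nt) ((if restless (shift k) e p then M (shift k) p else 0) +
                   (if jump (shift k) e p then M (shift k) p else 0)))).
  apply: ler_sum => j _.
  apply: (@le_trans _ _ (\sum_(r <- events j) CC * M (shift r.1) r.2)).
    have cov := @sm_cover_seq R n d A lam osc S o _ (events j) (near_evset j) (near_cube j)
      (bset_near_evset j) (fun r => bset_near_cube j r) (fun x _ h => h).
    apply: le_trans cov _.
    rewrite big_seq [leRHS]big_seq; apply: ler_sum => r; rewrite mem_filter => /andP[ev].
    move=> /allpairsP[[k p] [_ /= pd rE]]; apply: near_cube_mass; first by rewrite rE.
    by move: ev => /hasP[e _ /andP[]].
  rewrite -mulr_sumr ler_wpM2l// /events big_filter big_mkcond big_allpairs_dep /=.
  apply: ler_sum => k _; apply: ler_sum => p _.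
  have nn : forall e, 0 <= (if restless (shift k) e p then M (shift k) p else 0) +
      (if jump (shift k) e p then M (shift k) p else 0).
    by move=> e; case: ifP; case: ifP => *; rewrite ?addr_ge0.
  case: ifPn => [/hasP[e eN /andP[_ re]]|_]; last by apply: sumr_ge0.
  rewrite (big_rem e eN) /=; apply: (@le_trans _ _ ((if restless (shift k) e p then M (shift k) p else 0) +
      (if jump (shift k) e p then M (shift k) p else 0))).
    by case/orP: re => ->; [rewrite lerDl|rewrite lerDr]; case: ifP.
  by rewrite lerDl sumr_ge0.
rewrite -mulr_sumr ler_wpM2l// exchange_big /=.
apply: (@le_trans _ _ (\sum_(k <- enum 'I_(@nshift n)) (size Nt)%:R *
    ((N%:R / w ^+ 2 + 2 / del ^+ 2) * (A * (n%:R * T) ^+ d)))); last first.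
  by rewrite big_const_seq count_predT iter_addr_0 size_enum_ord -(mulr_natl ((size Nt)%:R * _)).
apply: ler_sum => k _.
rewrite (eq_bigr (fun j : 'I_J => \sum_(e <- Nt) \sum_(p <- desc subnodes j root)
   ((if restless (shift k) e p then M (shift k) p else 0) +
    (if jump (shift k) e p then M (shift k) p else 0)))); last by move=> j _; rewrite exchange_big.
rewrite exchange_big /=.
apply: (@le_trans _ _ (\sum_(e <- Nt) ((N%:R / w ^+ 2 + 2 / del ^+ 2) * (A * (n%:R * T) ^+ d)))); last first.
  by rewrite big_const_seq count_predT iter_addr_0 -(mulr_natl ((_ + _) * (A * _))).
rewrite big_seq [leRHS]big_seq; apply: ler_sum => e eN; have e3 := Nt3 eN.
rewrite (eq_bigr (fun j : 'I_J => \sum_(p <- desc subnodes j root | restless (shift k) e p) M (shift k) p +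
   \sum_(p <- desc subnodes j root | jump (shift k) e p) M (shift k) p)); last first.
  by move=> j _; rewrite big_split /= -!big_mkcond.
rewrite big_split /=.
have r1 := restless_mass (shift k) J e3; have r2 := jump_mass_total (shift k) J e3.
have c0 : 0 <= N%:R / w ^+ 2 + 2 / del ^+ 2 by rewrite addr_ge0// divr_ge0// exprn_ge0// ltW.
have := ler_wpM2l c0 (cmass_root k); rewrite mulrDl.
by apply: le_trans; apply: lerD.
Qed.

End Events.

(** * Flatness away from the bad cubes *)

Lemma two_close {R : realType} (a b c d : R) : `|a - c| <= d -> `|b - c| <= d -> b <= a + 2 * d.
Proof. by rewrite !ler_norml => /andP[? ?] /andP[? ?]; lra. Qed.

Section NoEvent.
Context {R : realType} {n d : nat} {A lam : R} {osc : R -> R}.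
Variables (S : @space R n d A lam osc) (o : 'rV[R]_n) (T : R) (Nt : seq 'rV[R]_n) (N : nat) (w eta del : R).
Hypothesis zn : zone S o T.
Let T0 : 0 < T := proj1 zn.
Implicit Types (x y : 'rV[R]_n) (k : 'I_(@nshift n)).
Local Notation cl k j y := (cell o T (shift k) j y).
Local Notation rd k e j y := (refdens S o T eta del (shift k) e j (cl k j y).2).
Local Notation evs := (evset S o T Nt N w eta del).

Lemma central_near x : eucl_dist o x <= T / 8 -> central o T x.
Proof.
move=> ox i; have : `|x ord0 i - o ord0 i| <= T / 8.
  apply: le_trans ox; rewrite eucl_distC eucl_distE; apply: le_trans (coord_le_enorm _ i).
  by rewrite !mxE.
rewrite ler_norml => /andP[h1 h2].
have g2 : - (1 / 8) <= (x ord0 i - o ord0 i) / T by rewrite ler_pdivlMr//; lra.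
lra.
Qed.

Lemma half_cell k j x : central o T x -> [ffun i => ((cl k j.+1 x).2 i)./2] = (cl k j x).2.
Proof.
move=> cx; apply/ffunP => i; rewrite !ffunE; have g0 := central_gcoord k i cx.
set g := gcoord _ _ _ _ _ in g0 *.
have h1 : 0 <= 2 ^+ j.+1 * g by rewrite mulr_ge0// exprn_ge0.
have /andP[q1 q2] := truncn_itv h1; set z := Num.truncn _ in q1 q2 *.
apply/esym/truncn_def; rewrite exprS -mulrA in q1 q2.
rewrite -[z]odd_double_half in q1 q2; move: q1 q2; set b : nat := odd z; set y := z./2.
have b1 : b%:R <= 1 :> R by rewrite /b lern1 leq_b1.
have b0 : 0 <= b%:R :> R by [].
rewrite -[(_ + _).+1%:R]natr1 -[y.+1%:R]natr1 natrD -muln2 natrM; move: b1 b0.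
move: (b%:R : R) (y%:R : R) (2 ^+ j * g) => b' y' a *; apply/andP; split; lra.
Qed.

Lemma no_event k e j y : eucl_dist o y <= T / 8 -> e \in Nt -> ~ evs j y ->
  heavy S o T eta (shift k) (cl k j y) ->
  ~~ restless S o T N w (shift k) e (cl k j y) /\ ~~ jump S o T eta del (shift k) e (cl k j y).
Proof.
move=> oy eN ne hv; apply/andP; rewrite -negb_or; apply/negP => re; apply: ne.
exists (k, cl k j y); last first.
  by apply: cell_cube => i; apply: central_gcoord => //; exact: central_near.
rewrite mem_filter; apply/andP; split; first by apply/hasP; exists e => //=; rewrite hv.
apply/allpairsP; exists (k, cl k j y); split => //=; first by rewrite mem_enum.
by apply: (mem_desc j (p := root)); exact: (root_cube zn).
Qed.

Lemma refdens_stable k e j y : eucl_dist o y <= T / 8 -> e \in Nt -> ~ evs j.+1 y ->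
  rd k e j.+1 y = rd k e j y /\
  (heavy S o T eta (shift k) (cl k j.+1 y) -> `|cdens S o T (shift k) e (cl k j.+1 y) - rd k e j y| <= del).
Proof.
move=> oy eN ne; have cy := central_near oy; rewrite /= half_cell//.
rewrite -/(cl k j.+1 y).
have [hv|nh] := boolP (heavy S o T eta (shift k) (j.+1, [ffun i => Num.truncn (2 ^+ j.+1 * gcoord o T (shift k) y i)])).
  have [_] := no_event oy eN ne hv.
  by rewrite /jump /= half_cell// hv /= -leNgt => h; rewrite ltNge h.
by split => //; rewrite (negbTE nh).
Qed.

(** Without events the reference density is never reset, and heavy cells have a density within [del]
    of it. *)
Lemma refdens_const k e j0 j y : eucl_dist o y <= T / 8 -> e \in Nt -> (0 < j0)%N -> (j0 <= j)%N ->
  (forall i, (j0 <= i <= j)%N -> ~ evs i y) ->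
  heavy S o T eta (shift k) (cl k j y) -> heavy S o T eta (shift k) (cl k j0 y) ->
  cdens S o T (shift k) e (cl k j y) <= cdens S o T (shift k) e (cl k j0 y) + 2 * del.
Proof.
(* The common reference value is the one of the generation before [j0], so [j0] must be positive. *)
case: j0 => // j0 oy eN _ jj ne hj h0.
have same i : (j0.+1 <= i <= j)%N -> rd k e i y = rd k e j0 y /\
    (heavy S o T eta (shift k) (cl k i y) -> `|cdens S o T (shift k) e (cl k i y) - rd k e j0 y| <= del).
  elim: i => // i ih /andP[ji ij].
  have [r1 r2] := refdens_stable k oy eN (ne i.+1 (introT andP (conj ji ij))).
  move: ji; rewrite ltnS leq_eqVlt => /predU1P[->//|ji].
  by have [r3 _] := ih (introT andP (conj ji (ltnW ij))); rewrite r1 -r3.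
have [_ /(_ hj)] := same j (introT andP (conj jj (leqnn j))).
have [_ /(_ h0)] := same j0.+1 (introT andP (conj (leqnn _) jj)).
exact: two_close.
Qed.

End NoEvent.

Lemma heavy_deep {R : realType} {n d : nat} {A lam : R} {osc : R -> R}
    (S : @space R n d A lam osc) o T (k : 'I_(@nshift n)) j y :
  (0 < n)%N -> 1 <= A -> zone S o T -> sX S y -> eucl_dist o y <= T / 8 -> deep_cell o T k j y ->
  heavy S o T (A^-1 * margin (n := n) ^+ d) (shift k) (cell o T (shift k) j y).
Proof.
move=> n0 A1 [T0 Tn] Xy oy dp; have t0 : 0 < side T j by exact: side_gt0.
have tT : side T j <= T by exact: side_le.
have nn1 : 1 <= n%:R :> R by rewrite ler1n.
have Ts : 100 * T <= srm S.
  by apply: le_trans Tn; rewrite ler_wpM2r ?(ltW T0)// ler_peMr.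
have /andP[m0 m1] := margin_bounds (R := R) (n := n).
have mt0 : 0 < margin (R := R) (n := n) * side T j by rewrite mulr_gt0.
have mt1 : margin (R := R) (n := n) * side T j <= side T j by rewrite ler_piMl ?(ltW t0)//; lra.
have mt2 : margin (R := R) (n := n) * side T j <= srm S / 2 by lra.
have oy' : eucl_dist o y <= srm S / 2 by lra.
rewrite /heavy /= -mulrA -exprMn; apply: le_trans (sm_ball_ge Xy oy' mt0 mt2) _.
apply: sm_le; [exact: bset_cball|exact: bset_cube|].
by move=> z Xz yz; apply: icube_cube; exact: dp.
Qed.

(** The frame [F] found at [x] belongs to one shift, while [y] may be deep only for another shift
    [k]. A shift is therefore chosen that is deep for both; its frame [Fk] at [x] stays null down to
    the cell of [y], so [z - y] is almost orthogonal to [Fk]. As [F] and [Fk] both describe [X]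
    around [x], [frame_angle] bounds the part of [z - y] along [F], and the complement [G] of [F]
    keeps half of the length. *)
Lemma projection_frame {R : realType} (n d : nat) (A lam : R) (osc : R -> R) :
  (0 < d)%N -> (d <= n)%N -> 1 <= A -> 1 <= lam -> (forall k : R, 0 < k -> 0 < osc k) ->
  exists (Nt : seq 'rV[R]_n) (N : nat) (w eta del c : R),
  [/\ (forall e, e \in Nt -> enorm e <= 1 / 3), [/\ 0 < w, 0 < eta & 0 < del], 0 < c <= 1 &
  forall (S : @space R n d A lam osc) o T x j0, zone S o T -> (1 < j0)%N -> sX S x -> eucl_dist o x <= T / 8 ->
  ~ evset S o T Nt N w eta del j0 x ->
  exists2 G : 'M[R]_(d, n), orthonormal_rows G &
  forall j y z, (j0 <= j)%N -> sX S y -> eucl_dist o y <= T / 8 -> eucl_dist x y <= c * side T j0 ->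
  (forall i, (j0 <= i <= j)%N -> ~ evset S o T Nt N w eta del i y) ->
  sX S z -> c * side T j / 2 <= eucl_dist y z <= c * side T j ->
  eucl_dist y z / 2 <= enorm ((z - y) *m G^T)].
Proof.
move=> d0 dn A1 lam1 osc0; have n0 : (0 < n)%N by exact: leq_trans dn.
have A0 : 0 < A by apply: lt_le_trans A1.
have lam0 : 0 < lam by apply: lt_le_trans lam1.
have cdn : (n - d + d = n)%N by rewrite subnK.
have [bet bet0 Hang] := frame_angle lam osc A1 d0 cdn.
have mb := margin_bounds (R := R) (n := n); have /andP[m0 m1] := mb.
set th := margin (R := R) (n := n) in mb m0 m1.
have th01 : 0 < th <= 1 by rewrite m0; lra.
pose kap := Num.min bet (1 / 8).
have kap01 : 0 < kap <= 1 by rewrite lt_min bet0 ge_min; apply/andP; split; [lra|apply/orP; right; lra].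
have kb : kap <= bet by rewrite ge_min lexx.
have k8 : kap <= 1 / 8 by rewrite ge_min lexx orbT.
have [alp [w1 [h1 [N1 [a0 w10 h10 Hstrip]]]]] := @frame_strip R n d A lam osc th kap n0 A1 lam1 osc0 th01 kap01.
(* Densities below [alp / 2] at [x] grow by at most twice the jump threshold [alp / 4] and so stay
   below [alp]. *)
have a20 : 0 < alp / 2 by rewrite divr_gt0.
have kd : (n - d + d <= n)%N by rewrite cdn.
have [w2 [h2 [N2 [w20 h20 Hnull]]]] := @null_frame R n d A lam osc th (n - d) d0 A1 lam1 osc0 th01 kd _ a20.
pose h := Num.min h1 h2; have h0 : 0 < h by rewrite lt_min h10.
have hh1 : h <= h1 by rewrite ge_min lexx.
have hh2 : h <= h2 by rewrite ge_min lexx orbT.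
have [Nt nt] := @net_exists R n h h0.
pose N := maxn N1 N2; pose w := Num.min w1 w2.
have w_0 : 0 < w by rewrite lt_min w10.
have W1 : 0 < w <= w1 by rewrite w_0 ge_min lexx.
have W2 : 0 < w <= w2 by rewrite w_0 ge_min lexx orbT.
pose c := th / (2 * lam).
have c0 : 0 < c by rewrite divr_gt0// mulr_gt0.
have cth : c <= th / 2 by rewrite /c ler_pM2l// lef_pV2 ?posrE ?mulr_gt0// ler_peMr.
have eta0 : 0 < A^-1 * th ^+ d by rewrite mulr_gt0 ?invr_gt0// exprn_gt0.
exists Nt, N, w, (A^-1 * th ^+ d), (alp / 4), c; split; [exact: nt.1|by split => //; rewrite divr_gt0|by rewrite c0; lra|].
move=> S o T x j0 zn j02 Xx ox nex; have [T0 Tn] := zn.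
set evs := evset S o T Nt N w (A^-1 * th ^+ d) (alp / 4) in nex *.
have nn1 : 1 <= n%:R :> R by rewrite ler1n.
have Ts : 100 * T <= srm S.
  by apply: le_trans Tn; rewrite ler_wpM2r ?(ltW T0)// ler_peMr.
have ox4 : eucl_dist o x <= srm S / 4 by move: ox T0 Ts; clear -R; lra.
have ox2 : eucl_dist o x <= srm S / 2 by move: ox T0 Ts; clear -R; lra.
have cx := central_near zn ox.
pose cl (k : 'I_(@nshift n)) (j : nat) (y : 'rV[R]_n) := cell o T (shift k) j y.
have goodc k j y e : sX S y -> eucl_dist o y <= T / 8 -> deep_cell o T k j y -> ~ evs j y -> e \in Nt ->
    good S o T (shift k) e N w (cl k j y).
  move=> Xy oy dp ne eN.
  have [re _] := no_event zn oy eN ne (heavy_deep n0 A1 zn Xy oy dp).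
  by rewrite /good leNgt.
have nullx k : deep_cell o T k j0 x -> exists F : 'M[R]_(n - d, n),
    null_frame_at S o T (shift k) (cl k j0 x) Nt h (alp / 2) F.
  move=> dp; apply: (Hnull S o T (shift k) (cl k j0 x) x Nt h N w) => //.
    exact: leq_maxr.
  by move=> e eN; exact: goodc.
have stripx k (F : 'M[R]_(n - d, n)) : deep_cell o T k j0 x ->
    null_frame_at S o T (shift k) (cl k j0 x) Nt h (alp / 2) F ->
    forall y, sX S y -> eucl_dist x y <= c * side T j0 -> enorm ((y - x) *m F^T) <= bet * (c * side T j0).
  move=> dp nF y Xy xy.
  have t0 : 0 < side T j0 by exact: side_gt0.
  apply: (@le_trans _ _ (kap * (c * side T j0))); last by rewrite ler_pM2r// mulr_gt0.
  apply: (Hstrip S o T (shift k) (cl k j0 x) x Nt h N w (n - d)%N F) => //; first exact: leq_subr.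
  - exact: leq_maxl.
  - by move=> e eN; exact: goodc.
  - by apply: null_frame_mono nF; move: a0; clear -R; lra.
have [k0 [dk0 _]] := common_deep T0 j02 j02 cx cx.
have [F nF] := nullx k0 dk0.
have [|G oG GF] := @frame_complement R n (n - d) d F nF.1; first by rewrite cdn.
exists G => // j y z jj Xy oy xy ney Xz /andP[yz1 yz2].
have cy := central_near zn oy.
have j2 : (2 <= j)%N by exact: leq_trans jj.
have [k [dkx dky]] := common_deep T0 j02 j2 cx cy.
have [Fk nFk] := nullx k dkx.
have tj0 : 0 < side T j by exact: side_gt0.
have tx0 : 0 < side T j0 by exact: side_gt0.
have cly : cl k j0 y = cl k j0 x.
  apply/esym/(@cube_cell _ _ o T (shift k) (cl k j0 x)); apply: icube_cube; apply: dkx.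
  apply: le_trans xy _; rewrite /= ler_pM2r// -/th; move: cth m0; clear -R; lra.
have dky0 : heavy S o T (A^-1 * th ^+ d) (shift k) (cl k j0 y).
  by rewrite cly; exact: heavy_deep.
have dkyj : heavy S o T (A^-1 * th ^+ d) (shift k) (cl k j y) by exact: heavy_deep.
have nFy : null_frame_at S o T (shift k) (cl k j y) Nt h alp Fk.
  split; first exact: nFk.1.
  move=> i; have [e [eN fe qe]] := nFk.2 i; exists e; split => //.
  have := refdens_const zn oy eN (ltnW j02) jj ney dkyj dky0.
  rewrite -/(cl k j y) -/(cl k j0 y) cly; move: qe; clear -R; lra.
have nej : ~ evs j y by apply: ney; rewrite jj leqnn.
have oy2 : eucl_dist o y <= srm S / 2 by move: oy T0 Ts; clear -R; lra.
have s1 : enorm ((z - y) *m Fk^T) <= kap * (c * side T j).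
  apply: (Hstrip S o T (shift k) (cl k j y) y Nt h N w (n - d)%N Fk) => //; first exact: leq_subr.
  - exact: leq_maxl.
  - by move=> e eN; exact: goodc.
have ct0 : 0 < c * side T j by rewrite mulr_gt0.
have s2 : enorm ((z - y) *m Fk^T) <= enorm (z - y) / 4.
  apply: le_trans s1 _; rewrite -eucl_distE eucl_distC.
  have := ler_wpM2r (ltW ct0) k8; move: yz1; clear -R; lra.
have rs : 0 < c * side T j0 <= srm S / 4.
  have tT : side T j0 <= T by exact: side_le.
  have cT : c * side T j0 <= side T j0 by rewrite ler_piMl ?(ltW tx0)//; move: cth m1; clear -R; lra.
  by rewrite mulr_gt0//=; move: cT tT Ts T0; clear -R; lra.
have s3 := Hang S o x (c * side T j0) F Fk nF.1 nFk.1 Xx ox4 rs (stripx k0 F dk0 nF) (stripx k Fk dkx nFk) _ s2.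
have P := parseval (z - y) cdn nF.1 oG GF.
rewrite eucl_distC eucl_distE -(ler_pXn2r (ltn0Sn 1)) ?nnegrE ?enorm_ge0 ?divr_ge0 ?enorm_ge0//.
have s4 : enorm ((z - y) *m F^T) ^+ 2 <= (enorm (z - y) / 2) ^+ 2.
  by rewrite lerXn2r ?nnegrE ?enorm_ge0 ?divr_ge0 ?enorm_ge0.
have s5 := sqr_ge0 (enorm (z - y)); move: s4 s5 P; rewrite !expr_div_n; clear -R; lra.
Qed.

(** * Stopping time *)

Section Covering.
Context {R : realType} {n : nat}.
Variables (P : set 'rV[R]_n) (sg : 'rV[R]_n -> nat) (rad : nat -> R).
Hypothesis rad0 : forall j, 0 < rad j.

(** The distance has to exceed the radius belonging to the smaller value of [sg], that is, to the
    point stopped earlier. *)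
Definition separated (ys : seq 'rV[R]_n) : Prop := uniq ys /\
  forall a b, a \in ys -> b \in ys -> a != b -> (sg a <= sg b)%N -> rad (sg a) < eucl_dist a b.

(** A Vitali selection: generation by generation, as many points as possible are added to those
    already selected. The bound [K] guarantees that a maximal number exists; a point left uncovered
    could be added. *)
Lemma greedy_cover (J K : nat) :
  (forall ys, separated ys -> (forall a, a \in ys -> P a /\ (sg a < J)%N) -> (size ys <= K)%N) ->
  exists ys, [/\ separated ys, (forall a, a \in ys -> P a /\ (sg a < J)%N) &
    forall y, P y -> (sg y < J)%N -> exists2 a, a \in ys & eucl_dist a y <= rad (sg a)].
Proof.
elim: J => [|J ih] bnd; first by exists [::]; split.
have [|ys [sys Pys cov]] := ih.
  by move=> ys s H; apply: bnd => // a /H[Pa ja]; split => //; exact: ltnW.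
pose Q k := exists zs, [/\ size zs = k, separated (zs ++ ys) & forall a, a \in zs -> P a /\ sg a = J].
have all_ok zs : (forall a, a \in zs -> P a /\ sg a = J) -> forall a, a \in zs ++ ys -> P a /\ (sg a < J.+1)%N.
  move=> H a; rewrite mem_cat => /orP[/H[Pa ->]|/Pys[Pa ja]]; split => //; exact: ltnW.
have exQ : exists k, `[< Q k >] by exists 0%N; apply/asboolP; exists [::]; split.
have Qb k : `[< Q k >] -> (k <= K)%N.
  move=> /asboolP[zs [<- sz Pz]]; apply: leq_trans (bnd _ sz (all_ok _ Pz)).
  by rewrite size_cat leq_addr.
case: (ex_maxnP exQ Qb) => k /asboolP[zs [zk sz Pz]] kmax.
exists (zs ++ ys); split => // [|y Py]; first exact: all_ok.
rewrite ltnS leq_eqVlt => /predU1P[yJ|yJ]; last first.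
  by have [a ay h] := cov y Py yJ; exists a => //; rewrite mem_cat ay orbT.
apply: contrapT => N.
have far a : a \in zs ++ ys -> rad (sg a) < eucl_dist a y.
  by move=> az; rewrite ltNge; apply/negP => h; apply: N; exists a.
have yn : y \notin zs ++ ys.
  apply/negP => /far; rewrite eucl_dist0 => h; by have := lt_trans (rad0 (sg y)) h; rewrite ltxx.
have : Q k.+1.
  exists (y :: zs); split; first by rewrite /= zk.
    split; first by rewrite /= yn; exact: sz.1.
    move=> a b; rewrite !inE => /predU1P[->|az] /predU1P[->|bz]; rewrite ?eqxx//.
    - move=> _; rewrite yJ => Jb; have [_ bJ] := all_ok _ Pz _ bz.
      have bE : sg b = J by apply/eqP; rewrite eqn_leq Jb -ltnS bJ.
      by rewrite -bE eucl_distC; exact: far.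
    - by move=> _ _; exact: far.
    - exact: sz.2.
  by move=> a; rewrite inE => /predU1P[->|/Pz].
move=> /asboolP /kmax; by rewrite ltnn.
Qed.

End Covering.

Lemma scale_exists {R : realType} (T c r : R) (j1 : nat) : 0 < T -> 0 < c -> 0 < r -> r <= c * side T j1 ->
  exists2 j, (j1 <= j)%N & c * side T j / 2 <= r <= c * side T j.
Proof.
move=> T0 c0 r0 rj1; have [N0 HN] := @half_pow_le R (r / (c * T)) (divr_gt0 r0 (mulr_gt0 c0 T0)).
have exj : exists j, (j1 <= j)%N && (c * side T j / 2 <= r).
  exists (j1 + N0)%N; rewrite leq_addr /=.
  have h := HN (j1 + N0)%N (leq_addl _ _); rewrite ler_pdivlMr ?mulr_gt0// in h.
  have : c * side T (j1 + N0) <= r.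
    by apply: le_trans h; rewrite /side; move: (2 ^+ (j1 + N0))^-1 => z; rewrite mulrA mulrC.
  have : 0 < c * side T (j1 + N0) by rewrite mulr_gt0// side_gt0.
  lra.
case: (ex_minnP exj) => j /andP[j1j rj] jmin; exists j => //; rewrite rj /=.
move: j1j; rewrite leq_eqVlt => /predU1P[<-//|].
case: j rj jmin => // j rj jmin j1j; rewrite leNgt; apply/negP => h.
have : r < c * side T j / 2.
  by rewrite ltNge; apply/negP => h'; have := jmin j (introT andP (conj j1j h')); rewrite ltnn.
by move: h; rewrite sideS; lra.
Qed.

Section MassTools.
Context {R : realType} {n d : nat} {A lam : R} {osc : R -> R}.
Variables (S : @space R n d A lam osc) (o : 'rV[R]_n).

Lemma sm_point (B : set 'rV[R]_n) : bset B -> 0 < sm S o B -> exists2 x, sX S x & B x.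
Proof.
move=> mB B0; apply: contrapT => H; move: B0; rewrite ltNge => /negP; apply.
rewrite /sm /msr -[leRHS](Lf0 (smu S) (bset_sdom S o)).
apply: Lf_le; [exact: bset_sdom|exact: fin_sdom|exact: bbm_ind|exact: bbm_cst|].
by move=> x [Xx _]; rewrite ind_out// => Bx; apply: H; exists x.
Qed.

Lemma sm_split (B C : set 'rV[R]_n) : bset B -> bset C -> sm S o B = sm S o (B `&` C) + sm S o (B `\` C).
Proof.
move=> mB mC; rewrite /sm /msr -LfD; [|exact: bset_sdom|exact: fin_sdom|apply: bbm_ind; exact: measurableI|apply: bbm_ind; exact: measurableD].
apply: Lf_eq => x _; have [Bx|nB] := pselect (B x); have [Cx|nC] := pselect (C x).
- by rewrite (ind_in Bx) (ind_in (conj Bx Cx)) ind_out ?addr0// => -[].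
- by rewrite (ind_in Bx) (ind_in (conj Bx nC)) ind_out ?add0r// => -[].
- by rewrite !ind_out ?addr0// => -[].
- by rewrite !ind_out ?addr0// => -[].
Qed.

Lemma sm_bigcup_le (F : nat -> set 'rV[R]_n) (b : R) : (forall J, bset (F J)) ->
  (forall i j, (i <= j)%N -> F i `<=` F j) -> (forall J, sm S o (F J) <= b) ->
  sm S o (\bigcup_J F J) <= b.
Proof.
move=> mF inc Fb; have mD := bset_sdom S o.
have mU : bset (\bigcup_J F J) by apply: bigcupT_measurable => J; exact: mF.
have fin B : bset B -> smu S (B `&` sdom S o) \is a fin_num.
  move=> mB; rewrite ge0_fin_numE//; apply: le_lt_trans (fin_sdom S o).
  have m1 : measurable (B `&` sdom S o : set (borelRV R n)) by apply: measurableI.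
  by apply: le_measure; rewrite ?inE//; exact: subIsetr.
rewrite /sm msrE// -lee_fin fineK ?fin// setI_bigcupl.
have mFD J : measurable (F J `&` sdom S o : set (borelRV R n)) by apply: measurableI => //; exact: mF.
have mUD : measurable (\bigcup_J (F J `&` sdom S o) : set (borelRV R n)) by exact: bigcupT_measurable.
have hom : {homo (fun J => F J `&` sdom S o) : i j / (i <= j)%N >-> (i <= j)%O}.
  by move=> i j ij; apply/subsetPset => x [Fx Dx]; split => //; exact: inc Fx.
have cv := @nondecreasing_cvg_mu _ _ _ (smu S) (fun J => F J `&` sdom S o) mFD mUD hom.
rewrite -(cvg_lim _ cv)//; apply: lime_le; first by apply/cvg_ex; eexists; exact: cv.
by apply: nearW => J /=; have := Fb J; rewrite /sm msrE// -lee_fin fineK// fin.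
Qed.

End MassTools.

Lemma side_anti {R : realType} (T : R) i j : 0 < T -> (i <= j)%N -> side T j <= side T i.
Proof.
move=> T0 ij; rewrite -(subnKC ij) sideD ler_piMr ?(ltW (side_gt0 T0 i))// invf_le1 ?exprn_gt0//.
by rewrite exprn_ege1// ler1n.
Qed.

Lemma sm_packing_seq {R : realType} (n d : nat) (A lam : R) (osc : R -> R) (S : @space R n d A lam osc) o
    (ys : seq 'rV[R]_n) (B : set 'rV[R]_n) (F : 'rV[R]_n -> set 'rV[R]_n) :
  uniq ys -> bset B -> (forall a, bset (F a)) -> (forall a x, a \in ys -> F a x -> B x) ->
  (forall a b x, a \in ys -> b \in ys -> F a x -> F b x -> a = b) ->
  \sum_(a <- ys) sm S o (F a) <= sm S o B.
Proof.
move=> uys mB mF FB dF; rewrite (big_nth 0) big_mkord.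
apply: (sm_packing S o (P := predT) (F := fun i : 'I_(size ys) => F (nth 0 ys i))) => // [i x _|i j x _ _ Fi Fj].
  by apply: FB; exact: mem_nth.
apply/val_inj/eqP; rewrite -(nth_uniq 0 _ _ uys) ?ltn_ord//; apply/eqP.
by apply: dF Fi Fj; exact: mem_nth.
Qed.

(** Balls of half the separation radius are disjoint and lie in the ball of radius [(1 + H) * t]
    around [x1]; regularity compares their masses. *)
Lemma separated_mass {R : realType} (n d : nat) (A lam : R) (osc : R -> R) (S : @space R n d A lam osc) o T
    (H t : R) (sg : 'rV[R]_n -> nat) x1 ys :
  0 < A -> 0 < T -> 0 < H -> 0 < t -> sX S x1 -> eucl_dist o x1 <= srm S / 2 -> (1 + H) * t <= srm S / 2 ->
  separated sg (fun j => H * side T j) ys ->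
  (forall a, a \in ys -> [/\ sX S a, eucl_dist o a <= srm S / 2, eucl_dist x1 a <= t & side T (sg a) <= t]) ->
  \sum_(a <- ys) side T (sg a) ^+ d <= (2 / H) ^+ d * (A ^+ 2 * (1 + H) ^+ d) * t ^+ d.
Proof.
move=> A0 T0 H0 t0 Xx1 ox1 ts [uys sep] Hys.
have H1 : 0 < (1 + H) * t by rewrite mulr_gt0// addr_gt0.
have up := sm_ball_le Xx1 ox1 H1 ts.
have pk : \sum_(a <- ys) sm S o (cball a (H / 2 * side T (sg a))) <= sm S o (cball x1 ((1 + H) * t)).
  apply: sm_packing_seq => //; [exact: bset_cball|by move=> a; exact: bset_cball| |].
    move=> a x ays ax; have ax' : eucl_dist a x <= H / 2 * side T (sg a) := ax.
    have [_ _ xa st] := Hys a ays; rewrite /cball/=.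
    have := eucl_dist_tri a x1 x; have := ler_wpM2l (ltW H0) st; have := mulr_gt0 H0 t0; lra.
  move=> a b x; wlog ab : a b / (sg a <= sg b)%N => [W|] ay by_.
    by have [ab|/ltnW ab] := leqP (sg a) (sg b) => h1 h2; [exact: (W a b)|apply/esym; exact: (W b a)].
  move=> ax bx; have ax' : eucl_dist a x <= H / 2 * side T (sg a) := ax.
  have bx' : eucl_dist b x <= H / 2 * side T (sg b) := bx.
  apply/eqP; rewrite -[_ == _]negbK; apply/negP => anb.
  have h1 := sep a b ay by_ anb ab; have := eucl_dist_tri x a b; rewrite (eucl_distC x b).
  have := ler_wpM2l (ltW H0) (side_anti T0 ab); lra.
have lo : \sum_(a <- ys) A^-1 * (H / 2) ^+ d * side T (sg a) ^+ d <= A * ((1 + H) * t) ^+ d.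
  apply: le_trans up; apply: le_trans pk; rewrite big_seq [leRHS]big_seq; apply: ler_sum => a ay.
  have [Xa oa _ st] := Hys a ay; have s0 : 0 < side T (sg a) by exact: side_gt0.
  rewrite -mulrA -exprMn; apply: sm_ball_ge => //; first by rewrite mulr_gt0 ?divr_gt0.
  have h1 := ler_wpM2l (ltW H0) st; lra.
rewrite -mulr_sumr in lo.
have c0 : 0 < A^-1 * (H / 2) ^+ d by rewrite mulr_gt0 ?invr_gt0// exprn_gt0// divr_gt0.
rewrite -(ler_pM2l c0); apply: le_trans lo _.
rewrite le_eqVlt; apply/orP; left; apply/eqP; rewrite !exprMn !exprVn.
by field; rewrite ?expf_neq0 ?gt_eqF.
Qed.

(** The upper constant is [2] at every stage of the induction; only the lower one deteriorates. *)
Definition bilip_on {R : realType} {n d : nat} (F : set 'rV[R]_n) (f : 'rV[R]_n -> 'rV[R]_d) (l : R) : Prop :=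
  forall x y, F x -> F y -> l * eucl_dist x y <= eucl_dist (f x) (f y) <= 2 * eucl_dist x y.

(** The interface between the geometry and the stopping argument: [E1 j] are the points at which
    generation [j] is bad, [E2 j] a neighbourhood of them, and one projection works around [x] for
    as long as no bad generation occurs. *)
Definition flat_scales {R : realType} {n d : nat} {A lam : R} {osc : R -> R} (S : @space R n d A lam osc)
    (o : 'rV[R]_n) (T c : R) (E1 E2 : nat -> set 'rV[R]_n) : Prop :=
  [/\ (forall j, bset (E1 j)), (forall j x y, E1 j x -> eucl_dist y x <= side T j -> E2 j y) &
  forall x j0, (1 < j0)%N -> sX S x -> eucl_dist o x <= T / 8 -> ~ E1 j0 x ->
  exists2 G : 'M[R]_(d, n), orthonormal_rows G &
  forall j y z, (j0 <= j)%N -> sX S y -> eucl_dist o y <= T / 8 -> eucl_dist x y <= c * side T j0 ->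
  (forall i, (j0 <= i <= j)%N -> ~ E1 i y) ->
  sX S z -> c * side T j / 2 <= eucl_dist y z <= c * side T j ->
  eucl_dist y z / 2 <= enorm ((z - y) *m G^T)].

Section Pieces.
Context {R : realType} {n d : nat} {A lam : R} {osc : R -> R}.
Variables (S : @space R n d A lam osc) (o : 'rV[R]_n) (T c : R) (E1 E2 : nat -> set 'rV[R]_n).
Hypotheses (T0 : 0 < T) (c0 : 0 < c) (flat : flat_scales S o T c E1 E2).
Variables (j1 : nat) (G : set 'rV[R]_n).
Hypothesis j1_gt1 : (1 < j1)%N.
Hypothesis GX : forall x, G x -> sX S x /\ eucl_dist o x <= T / 8.
Hypothesis Gdiam : forall x y, G x -> G y -> eucl_dist x y <= c * side T j1.

(** Any two points of the piece are at distance comparable to [c * side T j] for some generation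
    [j >= j1], which is not bad; the projection found at [x] keeps half of that distance. *)
Lemma unstopped_piece x : G x -> ~ E1 j1 x -> exists f : 'rV[R]_n -> 'rV[R]_d,
  bilip_on (G `&` [set y | forall j, (j1 <= j)%N -> ~ E1 j y]) f (1 / 2).
Proof.
move=> Gx nx; have [_ _ proj] := flat; have [Xx ox] := GX Gx.
have [P oP HP] := proj x j1 j1_gt1 Xx ox nx.
exists (fun y => y *m P^T) => y z [Gy ny] [Gz _].
have E : eucl_dist (y *m P^T) (z *m P^T) = enorm ((z - y) *m P^T).
  by rewrite eucl_distC eucl_distE mulmxBl.
apply/andP; split; last first.
  rewrite E; apply: le_trans (bessel _ oP) _; rewrite -eucl_distE eucl_distC.
  have := eucl_dist_ge0 y z; lra.
have [->|yz] := eqVneq y z; first by rewrite eucl_dist0 mulr0 eucl_dist_ge0.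
have r0 : 0 < eucl_dist y z.
  by rewrite lt_neqAle eucl_dist_ge0 andbT eq_sym; apply: contra yz => /eqP/eucl_dist_eq0 ->.
have [j jj rj] := scale_exists T0 c0 r0 (Gdiam Gy Gz).
have [Xy oy] := GX Gy; have [Xz _] := GX Gz.
rewrite E mul1r mulrC; apply: HP rj => // [|i /andP[ji _]]; first exact: Gdiam.
exact: ny.
Qed.

(* The pieces are seen from far apart, so the projection separates them and the rescaled charts of
   the pieces only perturb it. *)
Lemma merge_pieces (ys : seq 'rV[R]_n) (sg : 'rV[R]_n -> nat) (Fa : 'rV[R]_n -> set 'rV[R]_n)
    (fa : 'rV[R]_n -> 'rV[R]_n -> 'rV[R]_d) (l : R) : 0 < l -> c <= 1 ->
  separated sg (fun j => 16 * side T j) ys ->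
  (forall a, a \in ys -> G a /\ (j1 < sg a)%N) ->
  (forall a, a \in ys -> forall i, (j1 <= i < sg a)%N -> ~ E1 i a) ->
  (forall a x, a \in ys -> Fa a x -> eucl_dist a x <= c / 4 * side T (sg a)) ->
  (forall a, a \in ys -> bilip_on (Fa a) (fa a) l) ->
  (forall a, a \in ys -> Fa a !=set0) ->
  exists f : 'rV[R]_n -> 'rV[R]_d,
    bilip_on [set x | exists2 a, a \in ys & Fa a x] f (Num.min (l / 2) (1 / 4)).
Proof.
move=> l0 c1 [uys sep] yG nE Fnear Fl Fne; have [_ _ proj] := flat.
case: ys => [|a0 ys'] in uys sep yG nE Fnear Fl Fne *; first by exists (fun=> 0) => x y [].
set ys := a0 :: ys' in uys sep yG nE Fnear Fl Fne *.
have a0y : a0 \in ys by rewrite mem_head.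
have [Ga0 ja0] := yG a0 a0y; have [Xa0 oa0] := GX Ga0.
have nEa0 : ~ E1 j1 a0 by apply: (nE a0 a0y); rewrite leqnn.
have [P oP HP] := proj a0 j1 j1_gt1 Xa0 oa0 nEa0.
have selP x : exists a, (exists2 b, b \in ys & Fa b x) -> a \in ys /\ Fa a x.
  by have [[b by_ Fb]|N] := pselect (exists2 b, b \in ys & Fa b x); [exists b|exists a0].
have [sel Hsel] := choice selP.
have basP a : exists b, a \in ys -> Fa a b.
  by have [ay|ay] := boolP (a \in ys); [have [b Fb] := Fne a ay; exists b|exists a].
have [bas Hbas] := choice basP.
(* Charts may stretch by [2], so after halving, the image of a piece stays within [c / 2 * side] of
   the projected centre. This is small against the separation [16 * side], of which the projection
   keeps half. *)
pose f x := sel x *m P^T + 2^-1 *: (fa (sel x) x - fa (sel x) (bas (sel x))).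
have half a x : a \in ys -> Fa a x -> enorm (2^-1 *: (fa a x - fa a (bas a))) <= c / 2 * side T (sg a).
  move=> ay Fx; rewrite enormZ ger0_norm ?invr_ge0// -eucl_distE.
  have /andP[_ h] := Fl a ay x (bas a) Fx (Hbas a ay).
  have h1 := Fnear a x ay Fx; have h2 := Fnear a _ ay (Hbas a ay).
  have := eucl_dist_tri a x (bas a); rewrite (eucl_distC x a); lra.
exists f => x y Ux Uy; have [sx Fx] := Hsel x Ux; have [sy Fy] := Hsel y Uy.
have dxy := eucl_dist_ge0 x y.
have m1 : Num.min (l / 2) (1 / 4) <= l / 2 by rewrite ge_min lexx.
have m2 : Num.min (l / 2) (1 / 4) <= 1 / 4 by rewrite ge_min lexx orbT.
have k1 := ler_wpM2r dxy m1; have k2 := ler_wpM2r dxy m2.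
have [e|ne] := eqVneq (sel x) (sel y).
  have -> : eucl_dist (f x) (f y) = 2^-1 * eucl_dist (fa (sel x) x) (fa (sel x) y).
    rewrite !eucl_distE /f -e opprD addrACA subrr add0r -scalerBr enormZ ger0_norm ?invr_ge0//.
    by rewrite opprB addrA subrK.
  rewrite -e in Fy; have /andP[h1 h2] := Fl (sel x) sx x y Fx Fy.
  by apply/andP; split; lra.
have far a b u v : a \in ys -> b \in ys -> a != b -> (sg a <= sg b)%N -> Fa a u -> Fa b v ->
    eucl_dist u v / 4 <= eucl_dist (a *m P^T + 2^-1 *: (fa a u - fa a (bas a)))
      (b *m P^T + 2^-1 *: (fa b v - fa b (bas b))) <= 2 * eucl_dist u v.
  move=> ay by_ ab sab Fu Fv; have r16 := sep a b ay by_ ab sab.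
  have [Ga ja] := yG a ay; have [Gb jb] := yG b by_; have [Xa oa] := GX Ga; have [Xb ob] := GX Gb.
  have sa0 : 0 < side T (sg a) by exact: side_gt0.
  have sba := side_anti T0 sab.
  set r := eucl_dist a b in r16; have r0 : 0 < r by lra.
  have [j jj rj] := scale_exists T0 c0 r0 (Gdiam Ga Gb).
  (* The separation places the distance of [a] and [b] at a generation before [a] is stopped, where
     the projection is still controlled. *)
  have jsa : (j < sg a)%N.
    rewrite ltnNge; apply/negP => saj; have /andP[_ h] := rj; have h1 := side_anti T0 saj.
    have h2 : c * side T j <= side T j by rewrite ler_piMl// ltW// side_gt0.
    lra.
  have lo : r / 2 <= enorm ((b - a) *m P^T).
    apply: HP rj => //; first exact: Gdiam.
    by move=> i /andP[ji ij]; apply: (nE a ay); rewrite ji (leq_ltn_trans ij).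
  have up : enorm ((b - a) *m P^T) <= r.
    by apply: le_trans (bessel _ oP) _; rewrite -eucl_distE eucl_distC.
  have ca : c * side T (sg a) <= r / 16.
    have : c * side T (sg a) <= side T (sg a) by rewrite ler_piMl// ltW.
    lra.
  have cb : c * side T (sg b) <= r / 16 by apply: le_trans ca; rewrite ler_pM2l.
  have ha := half a u ay Fu; have hb := half b v by_ Fv.
  have na := Fnear a u ay Fu; have nb := Fnear b v by_ Fv.
  move: ha hb; set p := _ *: _; set q := _ *: _ => ha hb.
  have E : eucl_dist (a *m P^T + p) (b *m P^T + q) = enorm ((b - a) *m P^T + (q - p)).
    by rewrite eucl_distC eucl_distE mulmxBl; congr enorm; rewrite opprD addrACA.
  have pq : enorm (q - p) <= r / 16.
    apply: le_trans (enormD _ _) _; rewrite enormN; lra.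
  have uv1 : eucl_dist u v <= r + r / 32.
    have := eucl_dist_tri a u v; have := eucl_dist_tri b a v; rewrite (eucl_distC u a) -/r; lra.
  have uv2 : r - r / 32 <= eucl_dist u v.
    have := eucl_dist_tri u a b; have := eucl_dist_tri v u b; rewrite (eucl_distC v b) -/r; lra.
  rewrite E; apply/andP; split.
    have : enorm ((b - a) *m P^T) <= enorm ((b - a) *m P^T + (q - p)) + enorm (q - p).
      apply: le_trans (_ : enorm (((b - a) *m P^T + (q - p)) - (q - p)) <= _); first by rewrite addrK.
      by apply: le_trans (enormD _ _) _; rewrite enormN.
    lra.
  by have := enormD ((b - a) *m P^T) (q - p); lra.
have [sab|/ltnW sba] := leqP (sg (sel x)) (sg (sel y)).
  by have /andP[h1 h2] := far _ _ x y sx sy ne sab Fx Fy; apply/andP; split => //; lra.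
have ne' : sel y != sel x by rewrite eq_sym.
have := far _ _ y x sy sx ne' sba Fy Fx; rewrite (eucl_distC y) (eucl_distC (_ + _)).
by move=> /andP[h1 h2]; apply/andP; split => //; rewrite -/(f x) -/(f y) in h1 *; lra.
Qed.

End Pieces.

Lemma bilip_mono {R : realType} {n d : nat} (F F' : set 'rV[R]_n) (f : 'rV[R]_n -> 'rV[R]_d) (l l' : R) :
  F `<=` F' -> l <= l' -> bilip_on F' f l' -> bilip_on F f l.
Proof.
move=> FF ll H x y Fx Fy; have /andP[h1 h2] := H x y (FF x Fx) (FF y Fy).
by rewrite h2 andbT; apply: le_trans h1; rewrite ler_wpM2r// eucl_dist_ge0.
Qed.

Lemma first_stop {V : Type} (E : nat -> set V) (j1 : nat) : exists sg : V -> nat,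
  forall y, (exists2 j, (j1 <= j)%N & E j y) ->
  [/\ (j1 <= sg y)%N, E (sg y) y & forall i, (j1 <= i < sg y)%N -> ~ E i y].
Proof.
pose Q y k := (exists2 j, (j1 <= j)%N & E j y) ->
  [/\ (j1 <= k)%N, E k y & forall i, (j1 <= i < k)%N -> ~ E i y].
suff H y : exists k, Q y k by have [sg Hsg] := choice H; exists sg.
have [[j jj Ej]|N] := pselect (exists2 j, (j1 <= j)%N & E j y); last by exists 0%N.
have ex : exists j, (j1 <= j)%N && `[< E j y >] by exists j; rewrite jj; apply/asboolP.
case: (ex_minnP ex) => k /andP[jk /asboolP Ek] kmin; exists k => _; split => // i /andP[ji ik] Ei.
by have := kmin i; rewrite ji leqNgt ik /=; move/asboolP: Ei => -> /(_ isT).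
Qed.

Section Stopping.
Context {R : realType} {n d : nat} {A lam : R} {osc : R -> R}.
Variables (S : @space R n d A lam osc) (o : 'rV[R]_n) (T c : R) (E1 E2 : nat -> set 'rV[R]_n).
Hypotheses (n0 : (0 < n)%N) (A1 : 1 <= A) (zn : zone S o T) (c01 : 0 < c <= 1).
Hypothesis flat : flat_scales S o T c E1 E2.
Variables (j0 : nat) (x0 : 'rV[R]_n) (G : set 'rV[R]_n).
Hypotheses (j00 : (0 < j0)%N) (mG : bset G).
Hypothesis GX : forall x, G x -> [/\ sX S x, eucl_dist o x <= T / 8 & eucl_dist x0 x <= c / 4 * side T j0].
Local Notation t := (side T j0).
Local Notation j1 := j0.+1.
Local Notation m := (sm S o).

Let T0 : 0 < T := proj1 zn.
Let c0 : 0 < c. Proof. by case/andP: c01. Qed.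
Let A0 : 0 < A. Proof. exact: lt_le_trans A1. Qed.
Let t0 : 0 < t. Proof. exact: side_gt0. Qed.

Lemma scales_fit : 100 * t <= srm S /\ 100 * T <= srm S.
Proof.
have nn1 : 1 <= n%:R :> R by rewrite ler1n.
have h : 100 * T <= srm S.
  by have [_ h] := zn; apply: le_trans h; rewrite ler_wpM2r ?(ltW T0)// ler_peMr.
by split => //; have := side_le j0 T0; lra.
Qed.

Lemma piece_diam x y : G x -> G y -> eucl_dist x y <= c * side T j1.
Proof.
move=> /GX[_ _ h1] /GX[_ _ h2]; rewrite sideS; have := eucl_dist_tri x0 x y; rewrite (eucl_distC x x0); lra.
Qed.

Lemma piece_near x : G x -> sX S x /\ eucl_dist o x <= T / 8. Proof. by case/GX. Qed.

Lemma far_center x : G x -> eucl_dist o x <= srm S / 2.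
Proof. by move=> /GX[_ h _]; have [_ h2] := scales_fit; have := T0; lra. Qed.

Lemma stopped_mass (H : R) (sg : 'rV[R]_n -> nat) ys : 0 < H <= 16 ->
  separated sg (fun j => H * side T j) ys -> (forall a, a \in ys -> G a /\ (j1 <= sg a)%N) ->
  \sum_(a <- ys) side T (sg a) ^+ d <= (2 / H) ^+ d * (A ^+ 2 * (1 + H) ^+ d) * t ^+ d.
Proof.
move=> /andP[H0 H16] sep Hys.
case: ys => [|a ys] in sep Hys *.
  rewrite big_nil; apply: mulr_ge0; last by rewrite exprn_ge0// ltW.
  by apply: mulr_ge0; [|apply: mulr_ge0]; rewrite exprn_ge0// ltW ?divr_gt0 ?addr_gt0.
have [Ga ja] := Hys a (mem_head a ys); have [Xa _] := piece_near Ga.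
have [st sT] := scales_fit; have t0' : 0 < t := t0.
apply: (@separated_mass R n d A lam osc S o T H t sg a) => //; first exact: far_center.
  have := ler_wpM2r (ltW t0) H16; lra.
move=> b by_; have [Gb jb] := Hys b by_; have [Xb _] := piece_near Gb; split => //.
- exact: far_center.
- apply: le_trans (piece_diam Ga Gb) _; rewrite sideS.
  have /andP[_ c1] := c01; have := ler_wpM2r (ltW t0) c1; lra.
- by apply: side_anti => //; exact: ltnW.
Qed.

(** Sides are at least [side T J], so the mass bound limits the number of points. The bound depends
    on [J]; it only makes the greedy selection finite and does not enter the constants. *)
Lemma stopped_count (H : R) (sg : 'rV[R]_n -> nat) (J : nat) : 0 < H <= 16 -> exists K, forall ys,
  separated sg (fun j => H * side T j) ys -> (forall a, a \in ys -> [/\ G a, (j1 <= sg a)%N & (sg a < J)%N]) ->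
  (size ys <= K)%N.
Proof.
move=> H16; set C := (2 / H) ^+ d * (A ^+ 2 * (1 + H) ^+ d) * t ^+ d.
have sJ : 0 < side T J ^+ d by rewrite exprn_gt0// side_gt0.
have [K hK] := natr_gt (C / side T J ^+ d); exists K.+1 => ys sep Hys.
rewrite -(ler_nat R); apply: le_trans (ltW hK); rewrite ler_pdivlMr//.
apply: (le_trans _ (stopped_mass H16 sep _)); last by move=> a /Hys[].
rewrite mulr_natl -[leLHS](iter_addr_0 _ (side T J ^+ d)) -(count_predT ys) -big_const_seq.
rewrite big_seq [leRHS]big_seq; apply: ler_sum => a /Hys[_ _ aJ].
by rewrite lerXn2r ?nnegrE ?(ltW (side_gt0 T0 _))//; apply: side_anti => //; exact: ltnW.
Qed.

End Stopping.

Lemma bsetI {R : realType} {n : nat} (B C : set 'rV[R]_n) : bset B -> bset C -> bset (B `&` C).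
Proof. exact: measurableI. Qed.

Lemma bsetD {R : realType} {n : nat} (B C : set 'rV[R]_n) : bset B -> bset C -> bset (B `\` C).
Proof. exact: measurableD. Qed.

(* Induction on the number of bad generations: each point of [G] is stopped at its first bad
   generation, and around a stopped point one bad generation has been used up. *)
Lemma bilip_piece {R : realType} (n d : nat) (A lam : R) (osc : R -> R) (c : R) (m : nat) :
  (0 < n)%N -> 1 <= A -> 0 < c <= 1 -> forall eta : R, 0 < eta -> exists kap l : R, [/\ 0 < kap, 0 < l &
  forall (S : @space R n d A lam osc) o T E1 E2, zone S o T -> flat_scales S o T c E1 E2 ->
  forall (G : set 'rV[R]_n) x0 j0, (0 < j0)%N -> bset G ->
  (forall x, G x -> [/\ sX S x, eucl_dist o x <= T / 8 & eucl_dist x0 x <= c / 4 * side T j0]) ->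
  eta * side T j0 ^+ d <= sm S o G ->
  (forall x, G x -> forall s, uniq s -> (forall j, j \in s -> (j0 < j)%N /\ E2 j x) -> (size s <= m)%N) ->
  exists F (f : 'rV[R]_n -> 'rV[R]_d),
    [/\ bset F, F `<=` G, kap * side T j0 ^+ d <= sm S o F & bilip_on F f l]].
Proof.
move=> n0 A1 c01; have A0 : 0 < A by apply: lt_le_trans A1.
have /andP[c0 c1] := c01.
elim: m => [|m ih] eta eta0.
  exists eta, (1 / 2); split => // S o T E1 E2 zn flat G x0 j0 j00 mG GX mass cnt.
  have T0 := proj1 zn.
  have t0 : 0 < side T j0 ^+ d by rewrite exprn_gt0// side_gt0.
  have never y j : G y -> (j0.+1 <= j)%N -> ~ E1 j y.
    move=> Gy jj Ej; have [_ near _] := flat.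
    have := cnt y Gy [:: j] isT; rewrite ltnn => H; suff : false by []; apply: H => i.
    rewrite inE => /eqP ->; split => //; apply: near Ej _.
    by rewrite eucl_dist0 ltW// side_gt0.
  have [x _ Gx] := sm_point mG (lt_le_trans (mulr_gt0 eta0 t0) mass).
  have [f Hf] := @unstopped_piece R n d A lam osc S o T c E1 E2 T0 c0 flat j0.+1 G j00
    (piece_near GX) (piece_diam GX) x Gx (never x _ Gx (leqnn _)).
  exists G, f; split => //; apply: bilip_mono Hf => // y Gy; split => // j jj; exact: never.
have c4 : 0 < c / 4 <= 16 by apply/andP; split; lra.
have [c40 _] := andP c4.
pose C1 := (2 / (c / 4)) ^+ d * (A ^+ 2 * (1 + c / 4) ^+ d).
have C10 : 0 < C1.
  by rewrite /C1 !mulr_gt0 ?exprn_gt0 ?divr_gt0// ?addr_gt0.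
pose eta' := eta / 8 / C1; have eta'0 : 0 < eta' by rewrite !divr_gt0.
have [kap' [l' [kap'0 l'0 Hih]]] := ih eta' eta'0.
pose D := 8 * (A * 16 ^+ d); have D0 : 0 < D by rewrite mulr_gt0// mulr_gt0// exprn_gt0.
(* One term for each way in which the construction can end: a large part that is never stopped, a
   point stopped already at generation [j0.+1], and the merged pieces. *)
pose kap := Num.min (eta / 2) (Num.min (kap' / 2 ^+ d) (kap' * eta / D)).
pose l := Num.min (l' / 2) (1 / 4).
have p20 : 0 < 2 ^+ d :> R by rewrite exprn_gt0.
have kap0 : 0 < kap by rewrite !lt_min !divr_gt0// mulr_gt0.
have kap1 : kap <= eta / 2 by rewrite ge_min lexx.
have kap2 : kap <= kap' / 2 ^+ d by rewrite !ge_min lexx orbT.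
have kap3 : kap <= kap' * eta / D by rewrite !ge_min lexx !orbT.
have l0 : 0 < l by rewrite lt_min !divr_gt0.
have l1 : l <= 1 / 2.
  have : l <= 1 / 4 by rewrite ge_min lexx orbT.
  by clear -R; lra.
have l2 : l <= l'.
  have : l <= l' / 2 by rewrite ge_min lexx.
  by move: l'0; clear -R; lra.
exists kap, l; split => // S o T E1 E2 zn flat G x0 j0 j00 mG GX mass cnt.
have T0 := proj1 zn; have [mE near _] := flat.
set t := side T j0 in GX mass *; have t0 : 0 < t by exact: side_gt0.
have td : 0 < t ^+ d by rewrite exprn_gt0.
pose UJ J := [set y | exists2 j, j \in index_iota j0.+1 J & E1 j y].
have mUJ J : bset (UJ J) by exact: bset_exists.
pose U := \bigcup_J (UJ J).
have mU : bset U by apply: bigcupT_measurable => J; exact: mUJ.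
have UP y : U y <-> exists2 j, (j0.+1 <= j)%N & E1 j y.
  split; first by move=> [J _ [j]]; rewrite mem_index_iota => /andP[h _] Ej; exists j.
  by move=> [j h Ej]; exists j.+1 => //; exists j => //; rewrite mem_index_iota h /=.
(* Points that are never stopped need no gluing, since a single projection serves all of them. *)
have [Zbig|Zsmall] := leP (eta / 2 * t ^+ d) (sm S o (G `\` U)).
  have eta2 : 0 < eta / 2 by rewrite divr_gt0.
  have mZ : bset (G `\` U) by apply: bsetD.
  have [x _ [Gx nUx]] := sm_point mZ (lt_le_trans (mulr_gt0 eta2 td) Zbig).
  have nx : ~ E1 j0.+1 x by move=> Ex; apply: nUx; apply/UP; exists j0.+1.
  have [f Hf] := @unstopped_piece R n d A lam osc S o T c E1 E2 T0 c0 flat j0.+1 G j00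
    (piece_near GX) (piece_diam GX) x Gx nx.
  exists (G `\` U), f; split => //; first by apply: le_trans Zbig; rewrite ler_pM2r.
  apply: bilip_mono l1 Hf => y [Gy nUy]; split => // j jj Ej; apply: nUy; apply/UP; by exists j.
(* By continuity from below, finitely many generations already stop enough mass. From here on only
   finite families occur. *)
have [J HJ] : exists J, eta / 4 * t ^+ d <= sm S o (G `&` UJ J).
  apply: contrapT => N.
  have : sm S o (\bigcup_J (G `&` UJ J)) <= eta / 4 * t ^+ d.
    apply: sm_bigcup_le => [J|i j ij y [Gy [k]]|J]; first by apply: bsetI.
      rewrite mem_index_iota => /andP[k1 k2] Ek; split => //; exists k => //.
      by rewrite mem_index_iota k1 (leq_trans k2 ij).
    by rewrite leNgt; apply/negP => h; apply: N; exists J; exact: ltW.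
  rewrite -setI_bigcupr -/U => h; have := sm_split S o mG mU.
  have := mulr_gt0 eta0 td; move: h Zsmall mass; clear -R.
  move: (sm S o _) (sm S o _) (sm S o _) => *; lra.
pose GJ := G `&` UJ J; have mGJ : bset GJ by apply: bsetI.
have [sg Hsg] := first_stop E1 j0.+1.
have sgP y : GJ y -> [/\ (j0.+1 <= sg y)%N, (sg y < J)%N, E1 (sg y) y & forall i, (j0.+1 <= i < sg y)%N -> ~ E1 i y].
  move=> [Gy [j]]; rewrite mem_index_iota => /andP[jj jJ] Ej.
  have [|h1 h2 h3] := Hsg y; first by exists j.
  split => //; apply: leq_ltn_trans jJ; rewrite leqNgt; apply/negP => h.
  by apply: (h3 j) => //; rewrite jj.
pose ball y := cball y (c / 4 * side T (sg y)).
have mball y : bset (ball y) by exact: bset_cball.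
(* Stopped points with too little of [G] around them, where the induction hypothesis does not apply.
   The Vitali covering and the choice of [eta'] show that discarding the balls around them loses at
   most [eta / 8 * t ^ d]. *)
pose low := [set y | GJ y /\ sm S o (G `&` ball y) < eta' * side T (sg y) ^+ d].
have rad0 (H : R) : 0 < H -> forall j, 0 < H * side T j by move=> H0 j; rewrite mulr_gt0// side_gt0.
have [K HK] := stopped_count n0 A1 zn c01 GX sg J c4.
have [|yl [sepl Pl covl]] := @greedy_cover R n low sg (fun j => c / 4 * side T j) (rad0 _ c40) J K.
  move=> ys sep Hys; apply: HK => // a /Hys[[Ga _] aJ]; have [h1 h2 _ _] := sgP a Ga.
  by case: Ga.
pose Ul := [set x | exists2 a, a \in yl & ball a x].
have mUl : bset Ul by exact: bset_exists.
have lowmass : sm S o (GJ `&` Ul) <= eta / 8 * t ^+ d.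
  apply: (@le_trans _ _ (\sum_(a <- yl) sm S o (G `&` ball a))).
    apply: sm_cover_seq; [by apply: bsetI|by move=> a; apply: bsetI|].
    by move=> x _ [[Gx _] [a ay ax]]; exists a.
  apply: (@le_trans _ _ (eta' * \sum_(a <- yl) side T (sg a) ^+ d)).
    rewrite mulr_sumr big_seq [leRHS]big_seq; apply: ler_sum => a /Pl[[_ h] _]; exact: ltW.
  have -> : eta / 8 * t ^+ d = eta' * (C1 * t ^+ d) by rewrite /eta'; field; rewrite gt_eqF.
  rewrite ler_pM2l//; apply: (stopped_mass n0 A1 zn c01 GX c4 sepl) => a /Pl[[Ga _] _].
  by have [h1 _ _ _] := sgP a Ga; case: Ga.
pose G2 := GJ `\` Ul; have mG2 : bset G2 by apply: bsetD.
have G2mass : eta / 8 * t ^+ d <= sm S o G2.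
  have := sm_split S o mGJ mUl; move: lowmass HJ; rewrite -/GJ -/G2; clear -R.
  move: (sm S o _) (sm S o _) (sm S o _) => *; lra.
have dense y : G2 y -> exists F (f : 'rV[R]_n -> 'rV[R]_d),
    [/\ bset F, F `<=` G `&` ball y, kap' * side T (sg y) ^+ d <= sm S o F & bilip_on F f l'].
  move=> [Gy nUl]; have [s1 sJ sE sN] := sgP y Gy; have [G0y _] := Gy.
  apply: (Hih S o T E1 E2 zn flat (G `&` ball y) y (sg y)).
  - exact: leq_trans s1.
  - by apply: bsetI.
  - by move=> x [Gx bx]; have [h1 h2 _] := GX x Gx; split.
  - rewrite leNgt; apply/negP => h; have lowy : low y by [].
    by have [a ay h2] := covl y lowy sJ; apply: nUl; exists a.
  (* Generation [sg y] is bad for every point of the ball and differs from the later generations in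
     [s]; this is where the number of bad generations drops. *)
  move=> x [Gx bx] s us Hs; rewrite -ltnS; apply: (cnt x Gx (sg y :: s)).
    by rewrite /= us andbT; apply/negP => /Hs[]; rewrite ltnn.
  move=> j; rewrite inE => /predU1P[->|/Hs[h1 h2]]; last by split => //; apply: leq_trans h1; exact: leqW.
  split => //; apply: near sE _; rewrite eucl_distC; apply: le_trans bx _.
  by rewrite ler_piMl ?(ltW (side_gt0 T0 _))//; move: c1; clear -R; lra.
(* Merging needs a frame at generation [j0.+1], which a point stopped exactly there does not have.
   The piece around such a point is large enough by itself. *)
have [[y Gy sy]|noj1] := pselect (exists2 y, G2 y & sg y = j0.+1).
  have [F [f [mF FG Fm Ff]]] := dense y Gy; exists F, f; split => //.
  - by move=> x /FG[].
  - apply: le_trans Fm; rewrite sy sideS -/t; apply: le_trans (ler_wpM2r (ltW td) kap2) _.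
    have -> : kap' * (t / 2) ^+ d = kap' / 2 ^+ d * t ^+ d by rewrite expr_div_n; field; rewrite gt_eqF.
    exact: lexx.
  - exact: bilip_mono l2 Ff.
have later y : G2 y -> (j0.+1 < sg y)%N.
  move=> Gy; have [s1 _ _ _] := sgP y Gy.1; rewrite ltn_neqAle s1 andbT; apply/eqP => e.
  by apply: noj1; exists y.
have fam y : exists p : set 'rV[R]_n * ('rV[R]_n -> 'rV[R]_d), bset p.1 /\ (G2 y ->
    [/\ p.1 `<=` G `&` ball y, kap' * side T (sg y) ^+ d <= sm S o p.1 & bilip_on p.1 p.2 l']).
  have [Gy|nGy] := pselect (G2 y); last by exists (set0, fun=> 0); split => //; exact: measurable0.
  by have [F [f [h1 h2 h3 h4]]] := dense y Gy; exists (F, f).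
have [Ff HFf] := choice fam.
have c16 : 0 < (16 : R) <= 16 by rewrite lexx andbT ltr0n.
have [K' HK'] := stopped_count n0 A1 zn c01 GX sg J c16.
have [|ys [sep Py cov]] := @greedy_cover R n G2 sg (fun j => 16 * side T j) (rad0 _ (proj1 (andP c16))) J K'.
  move=> zs sz Hz; apply: HK' => // a /Hz[Ga aJ]; have [h1 h2 _ _] := sgP a Ga.1.
  by case: Ga => -[].
have Py2 a : a \in ys -> [/\ (Ff a).1 `<=` G `&` ball a, kap' * side T (sg a) ^+ d <= sm S o (Ff a).1 &
    bilip_on (Ff a).1 (Ff a).2 l'] by move=> /Py[Ga _]; exact: (HFf a).2 Ga.
have sd0 a : 0 < side T (sg a) ^+ d by rewrite exprn_gt0// side_gt0.
have [f Hf] : exists f, bilip_on (d := d) [set x | exists2 a, a \in ys & (Ff a).1 x] f l.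
  apply: (@merge_pieces R n d A lam osc S o T c E1 E2 T0 c0 flat j0.+1 G j00
    (piece_near GX) (piece_diam GX) ys sg (fun a => (Ff a).1) (fun a => (Ff a).2) l' l'0 c1 sep).
  - by move=> a /Py[Ga _]; split; [case: Ga => -[]|exact: later].
  - by move=> a /Py[Ga _]; have [_ _ _ h] := sgP a Ga.1.
  - by move=> a x /Py2[h _ _] /h[].
  - by move=> a /Py2[].
  - move=> a ay; have [_ h _] := Py2 a ay; have [mFa _] := HFf a.
    by have [x _ Fx] := sm_point mFa (lt_le_trans (mulr_gt0 kap'0 (sd0 a)) h); exists x.
have mF : bset [set x | exists2 a, a \in ys & (Ff a).1 x].
  by apply: bset_exists => a; have [] := HFf a.
exists [set x | exists2 a, a \in ys & (Ff a).1 x], f; split => //.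
  by move=> x [a /Py2[h _ _] /h[]].
have disj : \sum_(a <- ys) sm S o (Ff a).1 <= sm S o [set x | exists2 a, a \in ys & (Ff a).1 x].
  apply: sm_packing_seq => //; [exact: sep.1|by move=> a; have [] := HFf a|by move=> a x ay Fx; exists a|].
  move=> a b x; wlog ab : a b / (sg a <= sg b)%N => [W|] ay by_.
    by have [ab|/ltnW ab] := leqP (sg a) (sg b) => h1 h2; [exact: (W a b)|apply/esym; exact: (W b a)].
  move=> Fax Fbx; have [ha _ _] := Py2 a ay; have [hb _ _] := Py2 b by_.
  have [_ ax] := ha x Fax; have [_ bx] := hb x Fbx.
  have ax' : eucl_dist a x <= c / 4 * side T (sg a) := ax.
  have bx' : eucl_dist b x <= c / 4 * side T (sg b) := bx.
  apply/eqP; rewrite -[_ == _]negbK; apply/negP => anb.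
  have h1 := sep.2 a b ay by_ anb ab; have h2 := eucl_dist_tri x a b; rewrite (eucl_distC x b) in h2.
  have h3 := side_anti T0 ab; have h4 := side_gt0 T0 (sg a).
  have h5 := ler_wpM2l (ltW c40) h3; have h6 := ler_wpM2r (ltW h4) (_ : c / 4 <= 1).
  have {}h6 : c / 4 * side T (sg a) <= 1 * side T (sg a) by apply: h6; move: c1; clear -R; lra.
  move: h1 h2 h3 h4 h5 h6 ax' bx'; clear -R; move: (eucl_dist _ _) (eucl_dist _ _) (eucl_dist _ _) (side T _) (side T _) => *.
  lra.
(* The balls of radius [16 * side] around the selected points cover [G2], so the sum of the
   [side ^ d], and with it the mass of the pieces, is comparable to the mass of [G2]. *)
have c5 : eta / 8 * t ^+ d <= A * 16 ^+ d * \sum_(a <- ys) side T (sg a) ^+ d.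
  apply: le_trans G2mass _; rewrite mulr_sumr.
  apply: (@le_trans _ _ (\sum_(a <- ys) sm S o (cball a (16 * side T (sg a))))).
    apply: sm_cover_seq => //; first by move=> a; exact: bset_cball.
    move=> x _ Gx; have [_ sJ _ _] := sgP x Gx.1; by have [a ay h] := cov x Gx sJ; exists a.
  rewrite big_seq [leRHS]big_seq; apply: ler_sum => a /Py[Ga _].
  have [[Ga0 _] _] := Ga; have [s1 _ _ _] := sgP a Ga.1; have [Xa oa _] := GX a Ga0.
  rewrite -mulrA -exprMn; apply: sm_ball_le => //.
  - exact: (far_center n0 zn GX).
  - by rewrite mulr_gt0// side_gt0.
  - have [h _] := scales_fit n0 zn j0; have h2 := side_anti T0 (ltnW s1).
    move: h h2 t0; rewrite -/t; clear -R; move: (side T (sg a)) => *; lra.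
apply: le_trans disj; apply: (@le_trans _ _ (kap' * \sum_(a <- ys) side T (sg a) ^+ d)); last first.
  by rewrite mulr_sumr big_seq [leRHS]big_seq; apply: ler_sum => a /Py2[].
apply: (@le_trans _ _ (kap' * eta / D * t ^+ d)); first by rewrite ler_pM2r.
have -> : kap' * eta / D * t ^+ d = kap' / (A * 16 ^+ d) * (eta / 8 * t ^+ d).
  by rewrite /D; field; rewrite ?expf_neq0 ?gt_eqF.
have D1 : 0 < A * 16 ^+ d by rewrite mulr_gt0// exprn_gt0.
have D2 : 0 <= kap' / (A * 16 ^+ d) by rewrite divr_ge0// ltW.
apply: le_trans (ler_wpM2l D2 c5) _.
by rewrite mulrA divfK ?gt_eqF.
Qed.

(** * Conclusion *)

Section MassDistribution.
Context {R : realType} {n d : nat} {A lam : R} {osc : R -> R}.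
Variables (S : @space R n d A lam osc) (o : 'rV[R]_n).
Hypotheses (d0 : (0 < d)%N) (A0 : 0 < A) (s0 : 0 < srm S).
Implicit Types (E : set 'rV[R]_n).

Lemma diam_ge0 E : (0 <= diam E)%E. Proof. by rewrite /diam le_max lexx. Qed.

Lemma diam_ge E x y : E x -> E y -> ((eucl_dist x y)%:E <= diam E)%E.
Proof.
by move=> Ex Ey; rewrite /diam le_max; apply/orP; right; apply: ereal_sup_ubound; exists (x, y).
Qed.

Lemma bset_ball_in x r : bset (ball_in (sX S) x r).
Proof. by apply: bsetI; [apply: closed_bset; exact: s_closed|exact: bset_cball]. Qed.

(** Radius [0] is included because a cover may contain single points. Their mass vanishes by
    comparison with small balls, which uses [0 < d]. *)
Lemma mu_ball_in_le a r : sX S a -> 0 <= r <= srm S ->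
  (smu S (ball_in (sX S) a r) <= (A * r ^+ d)%:E)%E.
Proof.
move=> Xa /andP[r0 rs]; have fin s : smu S (ball_in (sX S) a s) \is a fin_num.
  by rewrite ge0_fin_numE//; exact: s_fin.
rewrite -(fineK (fin r)) lee_fin; move: r0; rewrite le_eqVlt => /predU1P[<-|r0]; last exact: s_up.
rewrite expr0n gtn_eqF// mulr0 leNgt; apply/negP; set v := fine _ => v0.
pose e := Num.min (Num.min (srm S) 1) (v / (2 * A)).
have e0 : 0 < e by rewrite !lt_min s0 ltr01 divr_gt0// mulr_gt0.
have e1 : e <= srm S by rewrite !ge_min lexx.
have e2 : e <= 1 by rewrite !ge_min lexx orbT.
have e3 : e <= v / (2 * A) by rewrite !ge_min lexx orbT.
have h1 : v <= A * e ^+ d.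
  apply: le_trans (s_up Xa e0 e1); rewrite /v; apply: fine_le => //.
  apply: le_measure; rewrite ?inE; [exact: bset_ball_in|exact: bset_ball_in|].
  move=> y [Xy ay]; split => //; have ay' : eucl_dist a y <= 0 := ay.
  by rewrite /cball/=; exact: le_trans (ltW e0).
have h2 : e ^+ d <= e by rewrite -(prednK d0) exprS ler_piMr ?exprn_ile1// ltW.
have h3 : A * e ^+ d <= A * (v / (2 * A)) by rewrite ler_pM2l//; exact: le_trans e3.
have h4 : A * (v / (2 * A)) = v / 2 by field; rewrite gt_eqF.
by move: h1 h3 v0; rewrite h4; lra.
Qed.

(* Each set of a cover is replaced by a ball around one of its points of [F]. *)
Lemma hausdorff_ge (F : set 'rV[R]_n) : bset F -> F `<=` sdom S o ->
  ((A^-1 * sm S o F)%:E <= hausdorff d F)%E.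
Proof.
move=> mF FD; apply: (@le_trans _ _ (hausdorff_pre d (srm S) F)); last first.
  by apply: ereal_sup_ubound; exists (srm S).
apply: le_ereal_inf_tmp => _ [E [cov small] <-].
have fdiam k : (diam (E k)) = (fine (diam (E k)))%:E.
  rewrite fineK// ge0_fin_numE ?diam_ge0//; exact: le_lt_trans (small k) (ltry _).
pose P k a := F a /\ E k a.
have pick k : exists a, (exists b, P k b) -> P k a.
  by have [[b Pb]|N] := pselect (exists b, P k b); [exists b|exists o].
have [a Ha] := choice pick.
pose B k := if `[< exists b, P k b >] then ball_in (sX S) (a k) (fine (diam (E k))) else set0.
have mB k : bset (B k) by rewrite /B; case: ifP => _; [exact: bset_ball_in|exact: measurable0].
have FB : F `<=` \bigcup_k B k.
  move=> x Fx; have [k _ Ekx] := cov x Fx; have Px : exists b, P k b by exists x.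
  exists k => //; rewrite /B asboolT//; have [Fa Ea] := Ha k Px; have [Xx _] := FD x Fx.
  by split => //; rewrite /cball/= -lee_fin -fdiam; exact: diam_ge.
have muB k : (smu S (B k) <= A%:E * diam (E k) ^+ d)%E.
  rewrite fdiam -EFin_expe -EFinM /B; case: asboolP => [/Ha[Fa _]|_]; last first.
    by rewrite measure0 lee_fin mulr_ge0 ?(ltW A0)// exprn_ge0// fine_ge0// diam_ge0.
  have [Xa _] := FD _ Fa; apply: mu_ball_in_le => //.
  by rewrite fine_ge0 ?diam_ge0//= -lee_fin -fdiam; exact: small.
have mFE : (sm S o F)%:E = smu S F.
  rewrite /sm msrE//; last exact: bset_sdom.
  rewrite (_ : F `&` sdom S o = F); last by apply/setIidl.
  rewrite fineK// ge0_fin_numE//; apply: le_lt_trans (fin_sdom S o).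
  by apply: le_measure; rewrite ?inE//; exact: bset_sdom.
rewrite EFinM mFE lee_pdivrMl//.
apply: (@le_trans _ _ (\sum_(0 <= k <oo) smu S (B k))%E).
  exact: (measure_sigma_subadditive (smu S)).
rewrite -nneseriesZl; last by move=> k _; rewrite fdiam -EFin_expe lee_fin exprn_ge0// fine_ge0// diam_ge0.
by apply: lee_nneseries => // k _; exact: muB.
Qed.

End MassDistribution.

Section BadPoints.
Context {R : realType} {n d : nat} {A lam : R} {osc : R -> R}.
Variables (S : @space R n d A lam osc) (o : 'rV[R]_n) (E2 : nat -> set 'rV[R]_n) (m : nat).
Hypothesis mE2 : forall j, bset (E2 j).
Implicit Types (x : 'rV[R]_n).

Definition overloaded J : set 'rV[R]_n := [set x | m%:R < \sum_(j < J) ind (E2 j) x].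

Let bsum J : bbm (fun x => \sum_(j < J) ind (E2 j) x).
Proof. by apply: bbm_sum => j; exact: bbm_ind. Qed.

Lemma bset_overloaded J : bset (overloaded J).
Proof. by apply: bset_lt; [exact: measurable_cst|case: (bsum J)]. Qed.

Lemma overloaded_mono i j : (i <= j)%N -> overloaded i `<=` overloaded j.
Proof.
move=> ij x; rewrite /overloaded /= => h; apply: lt_le_trans h _.
rewrite -!(big_mkord xpredT (fun k => ind (E2 k) x)) [leRHS](@big_cat_nat _ _ _ i)//= lerDl.
by apply: sumr_ge0 => k _; exact: ind_ge0.
Qed.

(** Chebyshev's inequality for the multiplicity of the sets [E2 j], uniform in the number [J] of
    generations, followed by continuity from below. *)
Lemma overloaded_mass (b : R) : (forall J, \sum_(j < J) sm S o (E2 j) <= b) ->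
  m%:R * sm S o (\bigcup_J overloaded J) <= b.
Proof.
move=> Hb; have b0 : 0 <= b by have := Hb 0%N; rewrite big_ord0.
have [->|m0] := eqVneq m 0%N; first by rewrite mul0r.
have m0' : 0 < m%:R :> R by rewrite ltr0n lt0n.
rewrite mulrC -ler_pdivlMr//; apply: sm_bigcup_le => [J|i j|J]; [exact: bset_overloaded|exact: overloaded_mono|].
have mD := bset_sdom S o; have fD := fin_sdom S o.
rewrite ler_pdivlMr// mulrC; apply: le_trans (Hb J).
rewrite /sm /msr -LfZ//; last by apply: bbm_ind; exact: bset_overloaded.
rewrite -Lf_sum//; last by move=> j; exact: bbm_ind.
apply: Lf_le => //; first by apply: bbmZ; apply: bbm_ind; exact: bset_overloaded.
move=> x _; have [ox|nx] := pselect (overloaded J x); first by rewrite (ind_in ox) mulr1 ltW.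
by rewrite (ind_out nx) mulr0; apply: sumr_ge0 => j _; exact: ind_ge0.
Qed.

Lemma not_overloaded x s : ~ (\bigcup_J overloaded J) x -> uniq s -> (forall j, j \in s -> E2 j x) ->
  (size s <= m)%N.
Proof.
move=> no us Hs; rewrite leqNgt; apply/negP => ms; apply: no.
pose J := (\max_(j <- s) j).+1; exists J => //; rewrite /overloaded /=.
have sJ j : j \in s -> (j < J)%N by move=> js; rewrite ltnS; exact: leq_bigmax_seq.
apply: (@lt_le_trans _ _ (size s)%:R); first by rewrite ltr_nat.
rewrite -(big_mkord xpredT (fun k => ind (E2 k) x)) -sum1_size natr_sum.
have -> : \sum_(0 <= k < J) ind (E2 k) x = \sum_(k <- [seq k <- index_iota 0 J | k \in s]) ind (E2 k) x +
    \sum_(k <- index_iota 0 J | k \notin s) ind (E2 k) x.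
  by rewrite big_filter (bigID (fun k => k \in s)).
have ps : perm_eq s [seq k <- index_iota 0 J | k \in s].
  apply: uniq_perm => //; first by rewrite filter_uniq// iota_uniq.
  move=> k; rewrite mem_filter mem_index_iota /=; case ks : (k \in s) => //=; by rewrite sJ.
rewrite -(perm_big _ ps) /= (eq_big_seq (fun k => ind (E2 k) x)).
  by rewrite lerDl; apply: sumr_ge0 => k _; exact: ind_ge0.
by move=> k /Hs h; rewrite ind_in.
Qed.

End BadPoints.

Lemma osc_energy_gt0 {R : realType} (d : nat) (C A k : R) : 0 < C -> 0 < A -> 0 < k -> 0 < osc_energy (d := d) C A k.
Proof.
move=> C0 A0 k0; have h1 : 0 < (k / 4) ^+ d.+1 by rewrite exprn_gt0// divr_gt0.
have h2 : 0 < A ^+ 2 by rewrite exprn_gt0.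
by rewrite /osc_energy; apply: divr_gt0; rewrite ?mulr_gt0// exprn_gt0// !divr_gt0// mulr_gt0.
Qed.

Lemma chart_inverse {R : realType} {n d : nat} (F : set 'rV[R]_n) (f : 'rV[R]_n -> 'rV[R]_d) (l : R) :
  0 < l -> bilip_on F f l -> exists g, bilipschitz (Num.max 2 l^-1) (f @` F) g /\ g @` (f @` F) = F.
Proof.
move=> l0 Hf; have inv u : exists y, (f @` F) u -> F y /\ f y = u.
  by have [[y Fy fy]|N] := pselect ((f @` F) u); [exists y|exists 0].
have [g Hg] := choice inv.
have L2 : 2 <= Num.max 2 l^-1 by rewrite le_max lexx.
have Ll : l^-1 <= Num.max 2 l^-1 by rewrite le_max lexx orbT.
have L0 : 0 < Num.max 2 l^-1 by apply: lt_le_trans L2.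
exists g; split.
  move=> a b Ea Eb; have [Fa fa] := Hg a Ea; have [Fb fb] := Hg b Eb.
  have /andP[h1 h2] := Hf (g a) (g b) Fa Fb; rewrite fa fb in h1 h2.
  have d1 := eucl_dist_ge0 a b; have d2 := eucl_dist_ge0 (g a) (g b).
  apply/andP; split.
    rewrite mulrC ler_pdivrMr// mulrC; apply: le_trans h2 _; exact: ler_wpM2r.
  apply: le_trans (ler_wpM2r d1 Ll); by rewrite mulrC ler_pdivlMr// mulrC.
apply/seteqP; split => [_ [u Eu <-]|y Fy]; first by have [] := Hg u Eu.
exists (f y); first by exists y.
have [Fg fg] := Hg (f y) (ex_intro2 _ _ y Fy erefl).
have /andP[h _] := Hf _ _ Fg Fy; rewrite fg eucl_dist0 in h.
apply: eucl_dist_eq0; apply/le_anti; rewrite eucl_dist_ge0 andbT.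
by rewrite -(ler_pM2l l0) mulr0.
Qed.

Lemma uniformly_rectifiable_dim {R : realType} (n d : nat) (C lam A : R) :
  1 <= C -> 1 <= lam -> 1 <= A -> (0 < d)%N -> (d <= n)%N -> exists L c : R, [/\ 0 < L, 0 < c &
  forall (X : set 'rV[R]_n) (mu : {measure set (borelRV R n) -> \bar R}), closed X ->
    ahlfors_regular d A X mu -> weak_poincare d%:R C lam X mu -> uniformly_rectifiable d L c X].
Proof.
move=> C1 lam1 A1 d0 dn; have n0 : (0 < n)%N by exact: leq_trans dn.
have A0 : 0 < A by apply: lt_le_trans A1.
have C0 : 0 < C by apply: lt_le_trans C1.
have nn0 : 0 < n%:R :> R by rewrite ltr0n.
pose osc : R -> R := osc_energy (d := d) C A.
have osc0 k : 0 < k -> 0 < osc k by exact: osc_energy_gt0.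
have [Nt [N [w [eta [del [c [Nt3 [w0 eta0 del0] c01 Hproj]]]]]]] :=
  @projection_frame R n d A lam osc d0 dn A1 lam1 osc0.
have /andP[c0 c1] := c01.
pose M1 := A * (n%:R + 2) ^+ d / eta * ((@nshift n)%:R * ((size Nt)%:R *
    ((N%:R / w ^+ 2 + 2 / del ^+ 2) * (A * n%:R ^+ d)))).
pose et := A^-1 * (c / 4) ^+ d / 2.
have et0 : 0 < et by rewrite divr_gt0// mulr_gt0 ?invr_gt0// exprn_gt0// divr_gt0.
(* The total bad mass is at most [M1 * T ^ d]. For this [K] the points of multiplicity above [K.+1]
   carry at most [et * t ^ d], which is half of the lower bound for the mass of the ball of radius
   [c / 4 * t]. *)
have [K hK] := natr_gt (M1 * 2 ^+ d / et).
have [kap [l [kap0 l0 Hpiece]]] := @bilip_piece R n d A lam osc c K.+1 n0 A1 c01 et et0.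
pose q : R := (2 * (100 * n%:R))^-1.
have q0 : 0 < q by rewrite invr_gt0; apply: mulr_gt0 => //; apply: mulr_gt0 => //; rewrite ltr0n.
exists (Num.max 2 l^-1), (A^-1 * (kap * q ^+ d)); split.
- by rewrite lt_max ltr0n.
- by rewrite mulr_gt0 ?invr_gt0// mulr_gt0// exprn_gt0.
move=> X mu cX reg pi x r Xx r0 rD.
have sD s : s <= r -> (s%:E < diam X)%E by move=> sr; apply: le_lt_trans rD; rewrite lee_fin.
pose S := @Space R n d A lam osc X mu r cX (fun y s => mu_ball_lty cX reg y s r0 rD)
  (fun y s Xy s0 sr => mu_ball_ge cX reg Xy s0 (sD s sr))
  (fun y s Xy s0 sr => mu_ball_le cX reg Xy s0 (sD s sr))
  (fun v rho k y s vL mr r01 vl k01 Xy s0 lr =>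
     poincare_osc C1 lam1 A1 d0 cX reg pi vL mr r01 vl k01 Xy s0 (sD _ lr)).
pose T := r / (100 * n%:R).
have h0 : 0 < 100 * n%:R :> R by apply: mulr_gt0 => //; rewrite ltr0n.
have T0 : 0 < T by rewrite divr_gt0.
have zn : zone S x T by split => //; rewrite /T mulrC divfK ?gt_eqF.
pose E1 := evset S x T Nt N w eta del; pose E2 := near_evset S x T Nt N w eta del.
have flat : flat_scales S x T c E1 E2.
  split => [j|j y z Ey yz|y j0 j1 Xy oy nE]; [exact: bset_evset|exact: (evset_near T0 Ey)|].
  exact: (Hproj S x T y j0 zn j1 Xy oy nE).
(* The construction starts at generation [1], because frames are available only from generation [2]
   on. *)
set t := side T 1; have t0 : 0 < t by exact: side_gt0.
have tE : t = T / 2 by rewrite /t /side expr1.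
have tq : t = q * r by rewrite tE /T /q; field; rewrite gt_eqF.
have Tr : 100 * T <= r.
  have [_ h] := zn; apply: le_trans h; rewrite ler_wpM2r ?(ltW T0)// ler_peMr ?ler0n// ler1n//.
have mE2 j : bset (E2 j) by exact: bset_near_evset.
pose Bad := \bigcup_J overloaded E2 K.+1 J.
have mBad : bset Bad by apply: bigcupT_measurable => J; exact: bset_overloaded.
pose B := X `&` cball x (c / 4 * t).
have mB : bset B by apply: bsetI; [exact: closed_bset|exact: bset_cball].
have ct0 : 0 < c / 4 * t by rewrite mulr_gt0// divr_gt0.
have ctT : c / 4 * t <= T / 8.
  by have := ler_wpM2r (ltW t0) c1; rewrite tE; lra.
have Bmass : 2 * et * t ^+ d <= sm S x B.
  have xx : eucl_dist x x <= srm S / 2 by rewrite eucl_dist0 /= divr_ge0// ltW.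
  have ctr : c / 4 * t <= srm S / 2 by rewrite /=; lra.
  apply: (@le_trans _ _ (A^-1 * (c / 4 * t) ^+ d)).
    rewrite [(c / 4 * t) ^+ d]exprMn /et; move: ((c / 4) ^+ d) (t ^+ d) => u v.
    by have -> : 2 * (A^-1 * u / 2) * v = A^-1 * (u * v) by field; rewrite gt_eqF.
  apply: le_trans (sm_ball_ge (S := S) Xx xx ct0 ctr) _.
  by apply: sm_le; [exact: bset_cball|exact: mB|move=> y Xy xy].
have Badmass : sm S x Bad <= et * t ^+ d.
  have h J : \sum_(j < J) sm S x (E2 j) <= M1 * T ^+ d.
    apply: le_trans (near_evset_mass N n0 A1 zn Xx eta0 w0 del0 Nt3 J) _.
    by rewrite /M1 exprMn le_eqVlt; apply/orP; left; apply/eqP; ring.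
  have K0 : 0 < K.+1%:R :> R by rewrite ltr0n.
  have := overloaded_mass K.+1 mE2 h; rewrite mulrC -ler_pdivlMr// => h2.
  apply: le_trans h2 _; rewrite ler_pdivrMr// tE [(T / 2) ^+ d]expr_div_n.
  have Td0 : 0 < T ^+ d by rewrite exprn_gt0.
  have p2 : 0 < 2 ^+ d :> R by rewrite exprn_gt0.
  have h3 : M1 * 2 ^+ d <= K.+1%:R * et by rewrite -ler_pdivrMr// ltW.
  have -> : et * (T ^+ d / 2 ^+ d) * K.+1%:R = K.+1%:R * et / 2 ^+ d * T ^+ d.
    by field; rewrite gt_eqF.
  by rewrite ler_pM2r// ler_pdivlMr.
pose G := B `\` Bad; have mG : bset G by exact: bsetD.
have Gmass : et * t ^+ d <= sm S x G.
  have := sm_split S x mB mBad; have : sm S x (B `&` Bad) <= sm S x Bad.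
    by apply: sm_le; [exact: bsetI|exact: mBad|move=> y _ []].
  move: Bmass Badmass; rewrite -/G; clear -R.
  move: (sm S x B) (sm S x Bad) (sm S x _) (sm S x G) => *; lra.
have [F [f [mF FG Fmass Hf]]] := Hpiece S x T E1 E2 zn flat G x 1%N isT mG
  (fun y Gy => And3 (proj1 (proj1 Gy)) (le_trans (proj2 (proj1 Gy)) ctT) (proj2 (proj1 Gy)))
  Gmass (fun y Gy s us Hs => not_overloaded (proj2 Gy) us (fun j js => proj2 (Hs j js))).
have [g [gL gF]] := chart_inverse l0 Hf.
have FX : F `<=` X `&` cball x r.
  move=> y /FG[[Xy xy] _]; split => //; have xy' : eucl_dist x y <= c / 4 * t := xy.
  by rewrite /cball/=; lra.
exists (f @` F), g; split => //; rewrite gF//.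
have := hausdorff_ge (S := S) d0 A0 r0 mF FX.
apply: le_trans; rewrite lee_fin -mulrA ler_pM2l ?invr_gt0//.
by apply: le_trans Fmass; rewrite -/t tq exprMn mulrA.
Qed.

Lemma uniformly_rectifiable_weaken {R : realType} (n d : nat) (L L' c c' : R) (X : set 'rV[R]_n) :
  0 < L -> L <= L' -> c' <= c -> uniformly_rectifiable d L c X -> uniformly_rectifiable d L' c' X.
Proof.
move=> L0 LL cc H x r Xx r0 rD; have [E [f [fL fX fH]]] := H x r Xx r0 rD.
exists E, f; split => // [a b Ea Eb|].
  have /andP[h1 h2] := fL a b Ea Eb; have d0 := eucl_dist_ge0 a b.
  apply/andP; split; last by apply: le_trans h2 _; exact: ler_wpM2r.
  apply: le_trans h1; apply: ler_wpM2r => //.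
  by rewrite lef_pV2 ?posrE//; exact: lt_le_trans LL.
by apply: le_trans fH; rewrite lee_fin ler_wpM2r// exprn_ge0// ltW.
Qed.

Theorem mainTheorem1 (R : realType) (n : nat) (C lambda A : R)
    (hC : 1 <= C) (hlambda : 1 <= lambda) (hA : 1 <= A) :
  exists L c : R, [/\ 0 < L, 0 < c &
    forall (d : nat) (X : set 'rV[R]_n)
        (mu : {measure set (borelRV R n) -> \bar R}),
      (2 <= d < n)%N -> closed X ->
      ahlfors_regular d A X mu ->
      weak_poincare d%:R C lambda X mu ->
      uniformly_rectifiable d L c X].
Proof.
(* Since [d < n], only finitely many dimensions occur; constants independent of [d] are obtained as
   extremes over them, one dimension at a time. *)
suff bounded : forall D, exists L c : R, [/\ 0 < L, 0 < c &
    forall (d : nat) (X : set 'rV[R]_n) (mu : {measure set (borelRV R n) -> \bar R}),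
      (d < D)%N -> (2 <= d < n)%N -> closed X -> ahlfors_regular d A X mu ->
      weak_poincare d%:R C lambda X mu -> uniformly_rectifiable d L c X].
  have [L [c [L0 c0 H]]] := bounded n; exists L, c; split => // d X mu dn.
  by apply: (H d X mu) => //; case/andP: dn.
elim=> [|D [L [c [L0 c0 H]]]]; first by exists 1, 1; split.
have [Dn|nD] := boolP (2 <= D < n)%N; last first.
  exists L, c; split => // d X mu; rewrite ltnS leq_eqVlt => /predU1P[->|]; last exact: H.
  by rewrite (negbTE nD).
have /andP[D2 Dn'] := Dn.
have [L' [c' [L'0 c'0 H']]] := uniformly_rectifiable_dim hC hlambda hA (ltnW D2) (ltnW Dn').
exists (Num.max L L'), (Num.min c c'); split; [by rewrite lt_max L0|by rewrite lt_min c0|].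
move=> d X mu; rewrite ltnS leq_eqVlt => /predU1P[->|dD] dn cX reg pi.
  apply: uniformly_rectifiable_weaken (H' X mu cX reg pi) => //; [by rewrite le_max lexx orbT|].
  by rewrite ge_min lexx orbT.
apply: uniformly_rectifiable_weaken (H d X mu dD dn cX reg pi) => //; [by rewrite le_max lexx|].
by rewrite ge_min lexx.
Qed.
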